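(* In the setting described in the context (in particular under assumptions (A1)–(A4) and $2<\phi_N<\phi_D$), with all quantities other than $N$ held fixed, as $N\to\infty$, \[\sqrt N\,(S-\mu(f))\Rightarrow\mathcal N(0,\sigma_S^2)\quad\text{and}\quad \sqrt N\,(S(c_R)-\mu(f))\Rightarrow\mathcal N(0,\sigma_S^2)\] for any $0\le c_R<\phi_N^{-1/2}$, where $\sigma_S^2:=\mathrm{Var}(D_0)+\sum_{l=0}^\infty\frac{\mathrm{Var}(D_{l,l+1})}{c_{l,l+1}}$ and $\Rightarrow$ denotes convergence in distribution.
   Context: Let $f$ be a real-valued measurable function, $\mu(f)\in\mathbb R$, and $(\tilde\mu_{h_l}(f))_{l\ge0}$ real numbers converging to $\mu(f)$. $D_0$, $D_{l,l+1}$ ($l\ge0$) are real random variables. Given positive constants $c_{0,1}\ge c_{1,2}\ge\cdots$ with $c_{l,l+1}\to0$ and $N\ge1$: $L(N)=\min\{l\in\mathbb N:c_{l,l+1}N\le1\}$; $N_{l,l+1}=\lceil c_{l,l+1}N\rceil$ for $l\le L(N)$, and $N_{l,l+1}\sim\mathrm{Bernoulli}(c_{l,l+1}N)$ for $l>L(N)$, independent of everything else. $D_0^{(1)},\dots,D_0^{(N)}$ are i.i.d. copies of $D_0$ independent of everything else, $S_0=\frac1N\sum_rD_0^{(r)}$; $D^{(r)}_{l,l+1}$ ($1\le r\le N_{l,l+1}$) have the law of $D_{l,l+1}$ and $S_{l,l+1}=\frac{1}{\mathbb E(N_{l,l+1})}\sum_{r=1}^{N_{l,l+1}}D^{(r)}_{l,l+1}$.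 $S=S_0+\sum_{l\ge0}S_{l,l+1}$ with $S_0,S_{0,1},S_{1,2},\dots$ independent, and $S(c_R)=S_0+\sum_{l=0}^{L(N)-1}S_{l,l+1}+\frac{D^{(1)}_{L(N),L(N)+1}}{1-c_R}+\sum_{l>L(N)}\frac{\mathbb 1[N_{l,l+1}=1]}{\mathbb E(N_{l,l+1})}[D^{(1)}_{l,l+1}-D^{(1)}_{L(N),L(N)+1}c_R^{l-L(N)}]$, where $\{D^{(1)}_{l,l+1}\}_{l\ge L(N)}$ may be dependent among themselves. Assumptions: (A1) $\mathbb E(D_0)=\tilde\mu_{h_0}(f)$, $\mathrm{Var}(D_0)<\infty$, $\mathbb E(D_{l,l+1})=\tilde\mu_{h_{l+1}}(f)-\tilde\mu_{h_l}(f)$, $\mathbb E(D_{l,l+1}^2)\le V_D\phi_D^{-l}$ with $V_D>0,\phi_D>2$; (A2) $\underline c_N\phi_N^{-l}\le c_{l,l+1}\le\overline c_N\phi_N^{-l}$ with $0<\underline c_N\le\overline c_N$, $\phi_N>2$; (A3) generating a sample of $D_{l,l+1}$ costs at most $C'2^l(K+lB+B_0)$ for finite constants, and a sample of $D_0$ has finite cost; (A4) for $1\le l\le L(N)-1$, $1\le r\le N_{l,l+1}$, the $D^{(r)}_{l,l+1}$ are mutually independent and independent of $\{D^{(1)}_{l,l+1}\}_{l\ge L(N)}$.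
   Formalization: Assumption (A4) is taken for 0 ≤ l ≤ L(N)−1 instead of 1 ≤ l ≤ L(N)−1, so the level-0 samples are also independent; otherwise the claim fails, e.g. if all D_{0,1}^{(r)} are equal to one non-constant variable. *)

(* Defs.v *)
From HB Require Import structures.
From mathcomp Require Import all_boot all_order all_algebra.
From mathcomp Require Import all_classical all_reals all_analysis.
Set Implicit Arguments. Unset Strict Implicit. Unset Printing Implicit Defensive.
Import Order.TTheory GRing.Theory Num.Theory.
Import numFieldTopology.Exports numFieldNormedType.Exports.
Local Open Scope classical_set_scope.
Local Open Scope ring_scope.

(* Independence (not in the library): a family of disjoint blocks of
   real random variables X_i (i in blk k) is independent iff for every
   finite choice of distinct blocks, finitely many variables in each and
   Borel sets, the probability of the joint cylinder event factorises
   over the blocks.  (Finite-dimensional cylinders form a pi-system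
   generating sigma(X_i : i in blk k), so this is the usual notion.)   *)
Definition indep_blocks {d} {T : measurableType d} {R : realType}
  (P : probability T R) {I K : Type} (X : I -> T -> R) (blk : K -> set I) :=
  forall (m : nat) (ks : 'I_m -> K) (n : K -> nat)
         (F : forall k, 'I_(n k) -> I) (B : I -> set R),
    injective ks ->
    (forall k j, blk k (F k j)) ->
    (forall i, measurable (B i)) ->
    let E k := \big[setI/setT]_(j < n k) (X (F k j) @^-1` B (F k j)) in
    P (\big[setI/setT]_(a < m) E (ks a)) = (\prod_(a < m) P (E (ks a)))%E.

(* The variables X_i, i in A, are mutually independent and (jointly)
   independent of the family (X_j)_{j in Bs}. *)
Definition indep_and_of {d} {T : measurableType d} {R : realType}
  (P : probability T R) {I : Type} (X : I -> T -> R) (A Bs : set I) :=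
  indep_blocks P X (fun k : option I =>
    match k with Some i => [set j | j = i /\ A i] | None => Bs end).

Definition mutually_indep {d} {T : measurableType d} {R : realType}
  (P : probability T R) {I : Type} (X : I -> T -> R) :=
  indep_and_of P X setT set0.

Definition same_law {d d0} {T : measurableType d} {T0 : measurableType d0}
  {R : realType} (P : probability T R) (X : T -> R)
  (P0 : probability T0 R) (Y : T0 -> R) :=
  forall B : set R, measurable B -> P (X @^-1` B) = P0 (Y @^-1` B).

(* Convergence in distribution to N(0, s2) (variance s2 >= 0; for s2 = 0
   this is the point mass at 0), via bounded continuous test functions. *)
Definition gauss_expect {R : realType} (s2 : R) (g : R -> R) : \bar R :=
  if s2 == 0 then (g 0)%:E
  else (\int[normal_prob 0 (Num.sqrt s2)]_x (g x)%:E)%E.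

Definition cvg_in_distr_normal {R : realType} {d : nat -> measure_display}
  {T : forall N, measurableType (d N)} (P : forall N, probability (T N) R)
  (X : forall N, T N -> R) (s2 : R) :=
  forall g : R -> R, continuous g -> (exists M : R, forall x, `|g x| <= M) ->
    (fun N : nat => (\int[P N]_w (g (X N w))%:E)%E) @ \oo --> gauss_expect s2 g.

(* ceil, as a natural number, for nonnegative arguments *)
Definition nat_ceil {R : realType} (x : R) : nat := `|Num.ceil x|%N.

Definition is_LN {R : realType} (c : nat -> R) (N L : nat) :=
  c L * N%:R <= 1 /\ forall l, c l * N%:R <= 1 -> (L <= l)%N.

(* E(N_{l,l+1}) : ceil(c_l N) for l <= L(N), c_l N (Bernoulli mean) else *)
Definition ENl {R : realType} (c : nat -> R) (N L l : nat) : R :=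
  if (l <= L)%N then (nat_ceil (c l * N%:R))%:R else c l * N%:R.

(* indices of the basic random variables:
   I0 r   = D_0^{(r+1)},  ID l r = D_{l,l+1}^{(r+1)},  IN l = N_{l,l+1} *)
Inductive idx := I0 of nat | ID of nat & nat | IN of nat.

Definition allvars {T : Type} {R : realType} (D0s : nat -> T -> R)
  (Ds : nat -> nat -> T -> R) (Ns : nat -> T -> nat) : idx -> T -> R :=
  fun i => match i with
  | I0 r => D0s r | ID l r => Ds l r | IN l => fun w => (Ns l w)%:R end.

Definition D0_idx (N : nat) : set idx :=
  fun i => match i with I0 r => (r < N)%N | _ => False end.
Definition Dlow_idx {R : realType} (c : nat -> R) (N L : nat) : set idx :=
  fun i => match i with
  | ID l r => (l < L)%N /\ (r < nat_ceil (c l * N%:R))%N | _ => False end.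
Definition Dhigh_idx (L : nat) : set idx :=
  fun i => match i with ID l r => (L <= l)%N /\ r = 0%N | _ => False end.
Definition Nrand_idx (L : nat) : set idx :=
  fun i => match i with IN l => (L < l)%N | _ => False end.
Definition used_idx {R : realType} (c : nat -> R) (N L : nat) : set idx :=
  D0_idx N `|` Dlow_idx c N L `|` Dhigh_idx L `|` Nrand_idx L.

Definition S0 {T : Type} {R : realType} (N : nat) (D0s : nat -> T -> R) w :=
  (N%:R)^-1 * \sum_(r < N) D0s r w.
Definition Sl {T : Type} {R : realType} (c : nat -> R) (N L : nat)
  (Ds : nat -> nat -> T -> R) (Ns : nat -> T -> nat) (l : nat) w :=
  (ENl c N L l)^-1 * \sum_(r < Ns l w) Ds l r w.

Definition Sest {T : Type} {R : realType} (c : nat -> R) (N L : nat)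
  (D0s : nat -> T -> R) (Ds : nat -> nat -> T -> R) (Ns : nat -> T -> nat) w :=
  S0 N D0s w + limn (fun n => \sum_(0 <= l < n) Sl c N L Ds Ns l w).

Definition ScR {T : Type} {R : realType} (c : nat -> R) (N L : nat)
  (D0s : nat -> T -> R) (Ds : nat -> nat -> T -> R) (Ns : nat -> T -> nat)
  (cR : R) w :=
  S0 N D0s w + \sum_(0 <= l < L) Sl c N L Ds Ns l w
  + Ds L 0%N w / (1 - cR)
  + limn (fun n => \sum_(0 <= k < n)
      ((Ns (L + k.+1)%N w == 1%N)%:R / ENl c N L (L + k.+1)%N)
      * (Ds (L + k.+1)%N 0%N w - Ds L 0%N w * cR ^+ k.+1)).

Definition sigmaS2 {d0} {T0 : measurableType d0} {R : realType}
  (P0 : probability T0 R) (D0 : T0 -> R) (Dl : nat -> T0 -> R)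
  (c : nat -> R) : R :=
  fine ('V_P0[D0])%E
  + limn (fun n => \sum_(0 <= l < n) fine ('V_P0[Dl l])%E / c l).

(* Main.v *)
(** Write [S] as its part below level [L(N)] plus a remainder.  The remainder is
    negligible after scaling: Cauchy-Schwarz and [c_L N <= 1] bound
    [sqrt N * sum_(l >= L) E|D_l|] by a multiple of [(phiN / phiD) ^ (L(N) / 2)],
    and [L(N)] tends to infinity; the coupling terms of [S(cR)] are handled in the
    same way.  The main part is a sum of independent centred variables, compared
    with a Gaussian of the same variance by Lindeberg's replacement: for a test
    function with a second-order Taylor estimate, trading one summand [X] costs
    [E (min(X^2, |X|^3))] up to a constant.  These costs, summed over levels,
    vanish by dominated convergence, with the summable majorant
    [Var(D_l) / c_l = O((phiN / phiD) ^ l)] which also gives the limit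
    variance.  Bounded continuous test functions are reached by
    truncating them outside a segment and smoothing with divided differences. *)
Require Import Defs.
From HB Require Import structures.
From mathcomp Require Import all_boot all_order all_algebra.
From mathcomp Require Import all_classical all_reals all_analysis measurable_realfun.
From mathcomp Require Import ring lra.
Set Implicit Arguments. Unset Strict Implicit. Unset Printing Implicit Defensive.
Import Order.TTheory GRing.Theory Num.Theory.
Import numFieldTopology.Exports numFieldNormedType.Exports.
Local Open Scope classical_set_scope.
Local Open Scope ring_scope.

(** * Independence and product measures *)

(** Only second moments are available, each [N] has its own probability space, and the number of
    summands grows with [N] both inside a level and through [L N]. So the argument works with
    expectations of test functions throughout, and the Gaussian partners of the summands live on
    product measures instead of an enlarged space. This requires three facts on centred Gaussians,
    variance 0 included: stability under convolution, the second moment and a bound on the third.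
    Replacement ends at the Gaussian whose variance is that of the main part at [N]; Lipschitz
    dependence on the variance then leads to the limit law. Independence is exploited sample by
    sample, each sample being centred and scaled on its own. Above [L N], the Bernoulli probability
    [c l * N] cancels the normalisation of the level, so in mean absolute value a random level costs
    no more than one sample of it. These costs decay like [phiD ^ (- l / 2)], while [sqrt N] is at
    most of order [phiN ^ (L N / 2)]. The two estimators share one main part, and only the remainder
    has to be estimated twice. *)

Section probability_integral.
Context d (T : measurableType d) (R : realType) (Q : probability T R).
Implicit Types (f g h : T -> R) (M e : R).

Lemma bounded_integrable f M : measurable_fun setT f ->
  (forall x, `|f x| <= M) -> Q.-integrable setT (EFin \o f).
Proof.
move=> mf fM; apply: measurable_bounded_integrable => //.
  by rewrite (le_lt_trans (probability_le1 Q measurableT))// ltry.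
exists M; split; first exact: num_real.
by move=> y My x _ /=; apply: (le_trans (fM x)); exact: ltW.
Qed.

Lemma Rintegral_const M : \int[Q]_x M = M.
Proof. by rewrite Rintegral_cst// [X in fine X](_ : _ = 1%E) ?mulr1//; exact: probability_setT. Qed.

Lemma integrable_const M : Q.-integrable setT (EFin \o (fun=> M)).
Proof. exact: finite_measure_integrable_cst. Qed.

Lemma Rintegral_close f g h : Q.-integrable setT (EFin \o f) ->
  Q.-integrable setT (EFin \o g) -> Q.-integrable setT (EFin \o h) ->
  (forall x, `|f x - g x| <= h x) ->
  `|\int[Q]_x f x - \int[Q]_x g x| <= \int[Q]_x h x.
Proof.
move=> fi gi hi fgh; rewrite -RintegralB//.
have fgi : Q.-integrable setT (EFin \o (fun x => f x - g x)).
  exact: (integrableB measurableT fi gi).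
apply: (le_trans (le_normr_Rintegral measurableT fgi)).
apply: le_Rintegral => //.
exact: (integrable_norm fgi).
Qed.

Lemma Rintegral_close_cst f g e : Q.-integrable setT (EFin \o f) ->
  Q.-integrable setT (EFin \o g) -> (forall x, `|f x - g x| <= e) ->
  `|\int[Q]_x f x - \int[Q]_x g x| <= e.
Proof.
move=> fi gi fge; rewrite -[leRHS]Rintegral_const.
exact: Rintegral_close fi gi (integrable_const e) fge.
Qed.

Lemma Rintegral_bounded f M : measurable_fun setT f ->
  (forall x, `|f x| <= M) -> `|\int[Q]_x f x| <= M.
Proof.
move=> mf fM; have fi := bounded_integrable mf fM.
have := Rintegral_close_cst fi (integrable_const 0) (e := M).
by rewrite Rintegral_const subr0; apply => x; rewrite subr0.
Qed.

Lemma EFin_Rintegral f : Q.-integrable setT (EFin \o f) ->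
  (\int[Q]_x f x)%:E = (\int[Q]_x (f x)%:E)%E.
Proof. by move=> fi; rewrite /Rintegral fineK//; exact: integrable_fin_num. Qed.

End probability_integral.

Section bounded_fubini.
Context d1 d2 (T1 : measurableType d1) (T2 : measurableType d2) (R : realType).
Context (Q1 : probability T1 R) (Q2 : probability T2 R).
Variables (f : T1 * T2 -> R) (M : R).
Hypotheses (mf : measurable_fun setT f) (fM : forall z, `|f z| <= M).

Let fi : (Q1 \x Q2)%E.-integrable setT (EFin \o f).
Proof. exact: (@bounded_integrable _ _ _ (Q1 \x Q2)%E _ M). Qed.

Let measurable1 x : measurable_fun setT (fun y => f (x, y)).
Proof. exact: measurableT_comp. Qed.

Let measurable2 y : measurable_fun setT (fun x => f (x, y)).
Proof. exact: measurableT_comp. Qed.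

Lemma measurable_Rintegral2 : measurable_fun setT (fun x => \int[Q2]_y f (x, y)).
Proof.
have := @measurable_fubini_F _ _ _ _ _ Q1 Q2 _ fi.
move=> mF; exact: (measurableT_comp (@fine_measurable R setT measurableT) mF).
Qed.

Lemma measurable_Rintegral1 : measurable_fun setT (fun y => \int[Q1]_x f (x, y)).
Proof.
have := @measurable_fubini_G _ _ _ _ _ Q1 Q2 _ fi.
move=> mG; exact: (measurableT_comp (@fine_measurable R setT measurableT) mG).
Qed.

Lemma Rintegral_prod1 :
  \int[(Q1 \x Q2)%E]_z f z = \int[Q1]_x \int[Q2]_y f (x, y).
Proof.
rewrite /Rintegral -(integral12_prod_meas1 fi); congr fine; apply: eq_integral => x _.
rewrite /= fineK//; apply: (@integrable_fin_num _ _ _ _ setT) => //.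
exact: (@bounded_integrable _ _ _ _ _ M).
Qed.

Lemma Rintegral_prod2 :
  \int[(Q1 \x Q2)%E]_z f z = \int[Q2]_y \int[Q1]_x f (x, y).
Proof.
rewrite /Rintegral -(integral21_prod_meas1 fi); congr fine; apply: eq_integral => x _.
rewrite /= fineK//; apply: (@integrable_fin_num _ _ _ _ setT) => //.
exact: (@bounded_integrable _ _ _ _ _ M).
Qed.

Lemma Rintegral_swap :
  \int[Q1]_x \int[Q2]_y f (x, y) = \int[Q2]_y \int[Q1]_x f (x, y).
Proof. by rewrite -Rintegral_prod1 Rintegral_prod2. Qed.

End bounded_fubini.

(** Rectangles are stable under intersection and generate the product sigma-algebra. This is what
    turns the factorisation of probabilities over pairs of sets into an identity between joint
    laws. *)
Lemma measure_rectangle_unique d1 d2 (T1 : measurableType d1)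
    (T2 : measurableType d2) (R : realType)
    (m1 m2 : {measure set (T1 * T2) -> \bar R}) :
  (forall A B, measurable A -> measurable B -> m1 (A `*` B) = m2 (A `*` B)) ->
  (m1 setT < +oo)%E ->
  forall X, measurable X -> m1 X = m2 X.
Proof.
move=> m12 m1T.
pose C : set (set (T1 * T2)) :=
  [set C | exists A, measurable A /\ exists B, measurable B /\ C = A `*` B].
have CI : setI_closed C.
  move=> /= _ _ [X1 [mX1 [X2 [mX2 ->]]]] [Y1 [mY1 [Y2 [mY2 ->]]]].
  rewrite -setXI; exists (X1 `&` Y1); split; first exact: measurableI.
  by exists (X2 `&` Y2); split => //; exact: measurableI.
apply: (measure_unique C (fun=> setT)) => //.
- rewrite measurable_prod_measurableType//; congr (<<s _ >>).
  rewrite predeqE; split => [[A mA [B mB <-]]|[A [mA [B [mB ->]]]]].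
    by exists A; split => //; exists B.
  by exists A => //; exists B.
- by move=> n; exists setT; split => //; exists setT; split => //; rewrite setXTT.
- exact: bigcup_const.
- by move=> _ [A [mA [B [mB ->]]]]; exact: m12.
Qed.

Section independent_pair.
Context d (T : measurableType d) (R : realType) (P : probability T R).
Variables (X Y : T -> R).
Hypotheses (mX : measurable_fun setT X) (mY : measurable_fun setT Y).
Hypothesis XY : forall A B : set R, measurable A -> measurable B ->
  P (X @^-1` A `&` Y @^-1` B) = (P (X @^-1` A) * P (Y @^-1` B))%E.

Let mXA A : measurable A -> measurable (X @^-1` A).
Proof. by move=> mA; rewrite -[_ @^-1` _]setTI; exact: mX. Qed.

Let mYA A : measurable A -> measurable (Y @^-1` A).
Proof. by move=> mA; rewrite -[_ @^-1` _]setTI; exact: mY. Qed.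

Let XY1 (w : T) : R * R := (X w, Y w).
Let XY2 (z : T * T) : R * R := (X z.1, Y z.2).

Let mXY1 : measurable_fun setT XY1.
Proof. exact: measurable_fun_pair. Qed.

Let mXY2 : measurable_fun setT XY2.
Proof. by apply: measurable_fun_pair => //; exact: measurableT_comp. Qed.

(** Independence in the form used for integrals: the joint law is also that of two coordinates taken
    on separate copies of the space, so Fubini applies on [P \x P] with no new variable to
    construct. *)
Let law_XY A : measurable A ->
  pushforward P XY1 A = pushforward (P \x P)%E XY2 A.
Proof.
pose p1 : {mfun T >-> (R * R)%type} := HB.pack XY1 (isMeasurableFun.Build _ _ _ _ _ mXY1).
pose p2 : {mfun (T * T)%type >-> (R * R)%type} := HB.pack XY2 (isMeasurableFun.Build _ _ _ _ _ mXY2).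
apply: (@measure_rectangle_unique _ _ _ _ _ (pushforward P p1) (pushforward (P \x P)%E p2)).
- move=> B C mB mC; rewrite /pushforward /=.
  transitivity (P (X @^-1` B) * P (Y @^-1` C))%E; first exact: XY.
  exact: (esym (product_measure1E P P (mXA mB) (mYA mC))).
- exact: (le_lt_trans (probability_le1 P measurableT) (ltry _)).
Qed.

Lemma indep_ge0_integral (F : R * R -> \bar R) : measurable_fun setT F ->
  (forall z, 0 <= F z)%E ->
  (\int[P]_w F (X w, Y w) = \int[P]_w \int[P]_w' F (X w, Y w'))%E.
Proof.
move=> mF F0.
have e1 := ge0_integral_pushforward mXY1 P measurableT mF (fun y _ => F0 y).
have e2 := ge0_integral_pushforward mXY2 (P \x P)%E measurableT mF (fun y _ => F0 y).
rewrite preimage_setT in e1; rewrite preimage_setT in e2.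
transitivity (\int[P]_x (F \o XY1) x)%E; first by [].
transitivity (\int[P \x P]_x (F \o XY2) x)%E; last first.
  rewrite fubini_tonelli1//; last by move=> z; exact: F0.
  exact: measurableT_comp.
rewrite -e1 -e2; apply: eq_measure_integral => A mA _; exact: law_XY.
Qed.

Lemma indep_Rintegral (F : R * R -> R) M : measurable_fun setT F ->
  (forall z, `|F z| <= M) ->
  \int[P]_w F (X w, Y w) = \int[P]_w \int[P]_w' F (X w, Y w').
Proof.
move=> mF FM.
have mEF : measurable_fun setT (EFin \o F) by exact/measurable_EFinP.
have mF1 : measurable_fun setT (F \o XY1) by exact: measurableT_comp.
have mF2 : measurable_fun setT (F \o XY2) by exact: measurableT_comp.
have e1 := integral_pushforward mXY1 mEF
  (bounded_integrable P mF1 (fun z => FM _)) measurableT.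
have e2 := integral_pushforward mXY2 mEF
  (bounded_integrable (P \x P)%E mF2 (fun z => FM _)) measurableT.
rewrite preimage_setT in e1; rewrite preimage_setT in e2.
transitivity (\int[P]_x (F \o XY1) x); first by [].
transitivity (\int[(P \x P)%E]_x (F \o XY2) x); last first.
  by rewrite (Rintegral_prod1 _ _ mF2 (fun z => FM _)).
rewrite /Rintegral -e1 -e2; congr fine.
apply: eq_measure_integral => A mA _; exact: law_XY.
Qed.

(** For fixed [C], restricting the law of the pair to [C] and scaling it by [P C] give two finite
    measures on the plane that agree on rectangles. They agree therefore on the preimage of [A]
    under addition, which is no rectangle. *)
Lemma indep_add_event (C : set T) : measurable C ->
  (forall A B : set R, measurable A -> measurable B ->
    P (X @^-1` A `&` Y @^-1` B `&` C) =
    (P (X @^-1` A `&` Y @^-1` B) * P C)%E) ->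
  forall A, measurable A ->
  P ((fun w => X w + Y w) @^-1` A `&` C) =
  (P ((fun w => X w + Y w)%R @^-1` A) * P C)%E.
Proof.
move=> mC HC A mA.
have PCfin : P C \is a fin_num by exact: fin_num_measure.
pose k : {nonneg R} := NngNum (fine_ge0 (measure_ge0 P C)).
have kE : (k%:num%:E = P C)%E by rewrite /= fineK.
pose m1 : {measure set (R * R) -> \bar R} := pushforward (mrestr P mC) XY1.
pose m2 : {measure set (R * R) -> \bar R} := mscale k (pushforward P XY1).
have m1E D : m1 mXY1 D = P (XY1 @^-1` D `&` C) by [].
have m2E D : m2 mXY1 D = (P C * P (XY1 @^-1` D))%E by rewrite -kE.
have /(@measure_rectangle_unique _ _ _ _ _ (m1 mXY1) (m2 mXY1)) E :
    forall B D, measurable B -> measurable D ->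
    m1 mXY1 (B `*` D) = m2 mXY1 (B `*` D).
  by move=> B D mB mD; rewrite m1E m2E muleC; exact: HC.
have mTC : measurable (XY1 @^-1` setT `&` C) by rewrite preimage_setT setTI.
have {}E := E (le_lt_trans (probability_le1 P mTC) (ltry _)).
pose D := (fun z : R * R => z.1 + z.2) @^-1` A.
have mD : measurable D.
  rewrite /D -[X in measurable X]setTI.
  have : measurable_fun setT (fun z : R * R => z.1 + z.2).
    by apply: measurable_funD; [exact: measurable_fst|exact: measurable_snd].
  exact.
have := E D mD; rewrite m1E m2E muleC.
by [].
Qed.

End independent_pair.

Section lebesgue_shift.
Context {R : realType}.
Local Notation mu := (@lebesgue_measure R).

Lemma lebesgue_measure_shift (a : R) (A : set R) : measurable A ->
  mu ((fun x => x + a) @^-1` A) = mu A.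
Proof.
move=> mA.
have mS : measurable_fun [set: measurableTypeR R]
    ((fun x => x + a) : measurableTypeR R -> measurableTypeR R).
  exact: measurable_funD.
pose m : {measure set (measurableTypeR R) -> \bar R} :=
  pushforward mu ((fun x => x + a) : measurableTypeR R -> measurableTypeR R).
have mE (D : set R) : m mS D = mu ((fun x => x + a) @^-1` D) by [].
rewrite -mE; apply/esym.
apply: (@lebesgue_measure_unique _ (m mS)) => //= _ [[b c]] _ <-.
rewrite mE (_ : _ @^-1` _ = `](b - a), (c - a)]%classic); last first.
  by apply/seteqP; split => x /=; rewrite !in_itv/= ltrBlDr lerBrDr.
rewrite !lebesgue_measure_itv/= !lte_fin ltrD2r; case: ifP => // _.
by rewrite -!EFinB opprB addrA subrK.
Qed.

Lemma ge0_integral_shift (a : R) (f : R -> \bar R) : measurable_fun setT f ->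
  (forall x, 0 <= f x)%E ->
  (\int[mu]_x f (x + a)%R = \int[mu]_x f x)%E.
Proof.
move=> mf f0.
have mS : measurable_fun [set: measurableTypeR R]
    ((fun x => x + a) : measurableTypeR R -> measurableTypeR R).
  exact: measurable_funD.
have := ge0_integral_pushforward mS mu measurableT mf (fun y _ => f0 y).
rewrite preimage_setT => <-.
apply: eq_measure_integral => A mA _; exact: lebesgue_measure_shift.
Qed.

Lemma ge0_integral_opp (f : R -> \bar R) : measurable_fun setT f ->
  (forall x, 0 <= f x)%E ->
  (\int[mu]_x f (- x)%R = \int[mu]_x f x)%E.
Proof.
move=> mf f0.
have mS : measurable_fun [set: measurableTypeR R]
    (-%R : measurableTypeR R -> measurableTypeR R) by [].
have := ge0_integral_pushforward mS mu measurableT mf (fun y _ => f0 y).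
rewrite preimage_setT => <-.
by apply: eq_measure_integral => A mA _; exact: lebesgue_measureN.
Qed.

End lebesgue_shift.

(** * Density, second moment and third absolute moment of normal laws *)

Section normal_density_facts.
Context {R : realType}.
Local Notation mu := (@lebesgue_measure R).
Implicit Types (m s t u x z : R).

(** The abstract Radon-Nikodym derivative and the explicit density have the same integral over every
    measurable set, hence are equal almost everywhere. *)
Lemma ge0_integral_normal_prob m s (f : R -> \bar R) : measurable_fun setT f ->
  (forall x, 0 <= f x)%E ->
  (\int[normal_prob m s]_x f x = \int[mu]_x (f x * (normal_pdf m s x)%:E))%E.
Proof.
move=> mf f0.
have dom := normal_prob_dominates m s.
have := @Radon_Nikodym_SigmaFinite.change_of_variables _ _ _
  (normal_prob m s) mu dom f setT f0 measurableT mf.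
move=> <-; apply: ae_eq_integral => //.
- apply: emeasurable_funM => //; apply: (measurable_int mu).
  exact: Radon_Nikodym_SigmaFinite.f_integrable.
- apply: emeasurable_funM => //; apply/measurable_EFinP.
  exact: measurable_normal_pdf.
- apply: ae_eqe_mul2l; apply: integral_ae_eq => //.
  + exact: Radon_Nikodym_SigmaFinite.f_integrable.
  + by apply/measurable_EFinP; exact: measurable_normal_pdf.
  + by move=> E _ mE; rewrite -Radon_Nikodym_SigmaFinite.f_integral.
Qed.

(** Completing the square in [z]: the joint density of two independent normal summands is the
    density of their sum at [u] times the conditional density of one summand given that sum. *)
Lemma normal_pdf_mul s t u z : 0 < s -> 0 < t ->
  normal_pdf 0 s (u - z) * normal_pdf 0 t z =
  normal_pdf 0 (Num.sqrt (s ^+ 2 + t ^+ 2)) u *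
  normal_pdf (u * t ^+ 2 / (s ^+ 2 + t ^+ 2))
    (s * t / Num.sqrt (s ^+ 2 + t ^+ 2)) z.
Proof.
move=> s0 t0.
have st0 : 0 < s ^+ 2 + t ^+ 2 by rewrite addr_gt0// exprn_gt0.
have r0 : 0 < Num.sqrt (s ^+ 2 + t ^+ 2) by rewrite sqrtr_gt0.
have r2 : Num.sqrt (s ^+ 2 + t ^+ 2) ^+ 2 = s ^+ 2 + t ^+ 2.
  by rewrite sqr_sqrtr// ltW.
have sn0 : s != 0 by rewrite gt_eqF.
have tn0 : t != 0 by rewrite gt_eqF.
have rn0 : Num.sqrt (s ^+ 2 + t ^+ 2) != 0 by rewrite gt_eqF.
have stn0 : s ^+ 2 + t ^+ 2 != 0 by rewrite gt_eqF.
rewrite !normal_pdfE//; last by rewrite !mulf_neq0// invr_eq0.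
rewrite mulrACA [RHS]mulrACA; congr (_ * _).
  rewrite /normal_peak -!invfM -!sqrtrM; last 2 first.
  - by rewrite mulrn_wge0// mulr_ge0// ?sqr_ge0// pi_ge0.
  - by rewrite mulrn_wge0// mulr_ge0// ?sqr_ge0// pi_ge0.
  congr (Num.sqrt _)^-1; rewrite exprMn exprVn r2.
  by field.
rewrite /normal_fun -!expRD; congr expR; rewrite !exprMn exprVn r2.
by field; rewrite stn0 sn0 tn0.
Qed.

Let kappa : R := Num.sqrt (pi *+ 2).

Let kappa_gt0 : 0 < kappa.
Proof. by rewrite sqrtr_gt0 mulrn_wgt0// pi_gt0. Qed.

Let normal_peakE s : 0 < s -> normal_peak s = (s * kappa)^-1.
Proof.
move=> s0; rewrite /normal_peak -mulrnAr sqrtrM ?sqr_ge0// sqrtr_sqr.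
by rewrite gtr0_norm.
Qed.

Let mnf s : measurable_fun setT (fun x => (normal_fun 0 s x)%:E).
Proof. by apply/measurable_EFinP; exact: measurable_normal_fun. Qed.

Let integral_nf s : 0 < s ->
  (\int[mu]_x (normal_fun 0 s x)%:E = (s * kappa)%:E)%E.
Proof.
move=> s0; have := integral_normal_pdf 0 s.
rewrite normal_pdfE ?gt_eqF//.
under eq_integral do rewrite EFinM.
rewrite ge0_integralZl_EFin//; last 3 first.
- by move=> x _; rewrite lee_fin normal_fun_ge0.
- exact: mnf.
- exact: normal_peak_ge0.
rewrite normal_peakE// => /(congr1 (fun e => (s * kappa)%:E * e)%E).
by rewrite muleA -EFinM divff ?mul1e ?mule1// gt_eqF// mulr_gt0.
Qed.

Let normal_fun_diff s t x : 0 < s -> 0 < t ->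
  normal_fun 0 t x =
  normal_fun 0 s x * expR (((s ^+ 2 *+ 2)^-1 - (t ^+ 2 *+ 2)^-1) * x ^+ 2).
Proof.
move=> s0 t0; rewrite /normal_fun -expRD; congr expR.
by field; rewrite !gt_eqF.
Qed.

Let mx2nf s h : measurable_fun setT (fun x : R => (h * x ^+ 2 * normal_fun 0 s x)%:E).
Proof.
apply/measurable_EFinP; apply: measurable_funM; last exact: measurable_normal_fun.
by apply: measurable_funM => //; exact: measurable_funX.
Qed.

Let M2 s := (\int[mu]_x (x ^+ 2 * normal_fun 0 s x)%:E)%E.

Let M2Z s (h : R) : 0 <= h ->
  (\int[mu]_x (h * x ^+ 2 * normal_fun 0 s x)%:E = h%:E * M2 s)%E.
Proof.
move=> h0; rewrite /M2 -ge0_integralZl_EFin//.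
- by apply: eq_integral => x _; rewrite -EFinM -mulrA.
- by move=> x _; rewrite lee_fin mulr_ge0// ?sqr_ge0// normal_fun_ge0.
- by under eq_fun do rewrite -[_ ^+ 2]mul1r; exact: mx2nf.
Qed.

(** The exponent that separates two widths: [normal_fun 0 t x] is [normal_fun 0 s x] times
    [expR (gap s t * x ^+ 2)]. *)
Let gap s t := (s ^+ 2 *+ 2)^-1 - (t ^+ 2 *+ 2)^-1.

Let gapE s t : 0 < s -> 0 < t ->
  gap s t = (t - s) * (t + s) / (2 * s ^+ 2 * t ^+ 2).
Proof. by move=> s0 t0; rewrite /gap; field; rewrite !gt_eqF. Qed.

Let gap_gt0 s t : 0 < s -> s < t -> 0 < gap s t.
Proof.
move=> s0 st; have t0 := lt_trans s0 st; rewrite gapE//.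
by rewrite divr_gt0// ?mulr_gt0// ?subr_gt0// ?addr_gt0// exprn_gt0.
Qed.

(** The second moment is found without integration by parts. Integrating [1 + y <= expR y] at
    [y = gap s t * x ^+ 2] against the narrower profile bounds it by a difference of two normalising
    constants; [M2_lb] uses [- y] and the wider profile. Dividing by [gap s t] and letting the
    widths merge leaves [s ^+ 2]. *)
Let M2_ub s t : 0 < s -> s < t ->
  ((gap s t)%:E * M2 s + (s * kappa)%:E <= (t * kappa)%:E)%E.
Proof.
move=> s0 st; have t0 := lt_trans s0 st.
rewrite -M2Z; last exact/ltW/gap_gt0.
rewrite -!integral_nf// -ge0_integralD//; last 4 first.
- by move=> x _; rewrite lee_fin mulr_ge0 ?normal_fun_ge0// mulr_ge0 ?sqr_ge0// ltW// gap_gt0.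
- exact: mx2nf.
- by move=> x _; rewrite lee_fin normal_fun_ge0.
- exact: mnf.
apply: ge0_le_integral => //.
- move=> x _; rewrite adde_ge0// lee_fin ?normal_fun_ge0//.
  by rewrite mulr_ge0 ?normal_fun_ge0// mulr_ge0 ?sqr_ge0// ltW// gap_gt0.
- by apply: emeasurable_funD; [exact: mx2nf|exact: mnf].
- exact: mnf.
move=> x _; rewrite -EFinD lee_fin (@normal_fun_diff s t)// -/(gap s t).
rewrite -[X in _ + X]mul1r -mulrDl mulrC ler_wpM2l// ?normal_fun_ge0//.
by rewrite addrC expR_ge1Dx.
Qed.

Let M2_lb s t : 0 < s -> s < t ->
  ((t * kappa)%:E <= (gap s t)%:E * M2 t + (s * kappa)%:E)%E.
Proof.
move=> s0 st; have t0 := lt_trans s0 st.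
rewrite -M2Z; last exact/ltW/gap_gt0.
rewrite -!integral_nf// -ge0_integralD//; last 4 first.
- by move=> x _; rewrite lee_fin mulr_ge0 ?normal_fun_ge0// mulr_ge0 ?sqr_ge0// ltW// gap_gt0.
- exact: mx2nf.
- by move=> x _; rewrite lee_fin normal_fun_ge0.
- exact: mnf.
apply: ge0_le_integral => //.
- by move=> x _; rewrite lee_fin normal_fun_ge0.
- exact: mnf.
- by apply: emeasurable_funD; [exact: mx2nf|exact: mnf].
move=> x _; rewrite -EFinD lee_fin (@normal_fun_diff t s)//.
have := expR_ge1Dx (((t ^+ 2 *+ 2)^-1 - (s ^+ 2 *+ 2)^-1) * x ^+ 2).
have := normal_fun_ge0 0 t x.
by rewrite /gap; nra.
Qed.

Let M2_ge0 s : (0 <= M2 s)%E.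
Proof.
by apply: integral_ge0 => x _; rewrite lee_fin mulr_ge0 ?sqr_ge0// normal_fun_ge0.
Qed.

Let M2_fin s : 0 < s -> M2 s \is a fin_num.
Proof.
move=> s0; have s2 : s < s + 1 by rewrite ltrDl.
have := M2_ub s0 s2; have := M2_ge0 s; case: (M2 s) => // _.
by rewrite gt0_muley ?lte_fin ?gap_gt0// addye// leye_eq.
Qed.

Let secmom s := fine (M2 s) / (s * kappa).

Let secmom_ub s t : 0 < s -> s < t -> secmom s <= t ^+ 2.
Proof.
move=> s0 st; have t0 := lt_trans s0 st.
have := M2_ub s0 st; rewrite -(fineK (M2_fin s0)) -EFinM -EFinD lee_fin.
rewrite /secmom gapE//; set q := fine _ => H.
have e : q / (s * kappa) = (t - s) * (t + s) / (2 * s ^+ 2 * t ^+ 2) * q / kappa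
    * (2 * s * t ^+ 2 / ((t - s) * (t + s))).
  by field; rewrite !gt_eqF// ?subr_gt0// ?addr_gt0.
rewrite e.
have H1 : (t - s) * (t + s) / (2 * s ^+ 2 * t ^+ 2) * q / kappa <= t - s.
  rewrite ler_pdivrMr// mulrBl; lra.
have p0 : 0 <= 2 * s * t ^+ 2 / ((t - s) * (t + s)).
  rewrite divr_ge0// ?mulr_ge0// ?sqr_ge0// ?subr_ge0 ?addr_ge0// ltW//.
apply: (le_trans (ler_wpM2r p0 H1)).
rewrite [leLHS](_ : _ = t ^+ 2 * (2 * s / (t + s))); last first.
  by field; rewrite !gt_eqF// ?subr_gt0// ?addr_gt0.
rewrite ler_piMr ?sqr_ge0// ler_pdivrMr ?addr_gt0//; lra.
Qed.

Let secmom_lb s t : 0 < s -> s < t -> s ^+ 2 <= secmom t.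
Proof.
move=> s0 st; have t0 := lt_trans s0 st.
have := M2_lb s0 st; rewrite -(fineK (M2_fin t0)) -EFinM -EFinD lee_fin.
rewrite /secmom gapE//; set q := fine _ => H.
have e : q / (t * kappa) = (t - s) * (t + s) / (2 * s ^+ 2 * t ^+ 2) * q / kappa
    * (2 * t * s ^+ 2 / ((t - s) * (t + s))).
  by field; rewrite !gt_eqF// ?subr_gt0// ?addr_gt0.
rewrite e.
have H1 : t - s <= (t - s) * (t + s) / (2 * s ^+ 2 * t ^+ 2) * q / kappa.
  rewrite ler_pdivlMr// mulrBl; lra.
have p0 : 0 <= 2 * t * s ^+ 2 / ((t - s) * (t + s)).
  rewrite divr_ge0// ?mulr_ge0// ?sqr_ge0// ?subr_ge0 ?addr_ge0// ltW//.
apply: le_trans (ler_wpM2r p0 H1).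
rewrite [leRHS](_ : _ = s ^+ 2 * (2 * t / (t + s))); last first.
  by field; rewrite !gt_eqF// ?subr_gt0// ?addr_gt0.
rewrite ler_peMr ?sqr_ge0// ler_pdivlMr ?addr_gt0//; lra.
Qed.

Let secmomE s : 0 < s -> secmom s = s ^+ 2.
Proof.
move=> s0; apply/eqP; rewrite eq_le; apply/andP; split.
- rewrite leNgt; apply/negP => h.
  have h2 : 0 < s ^+ 2 by rewrite exprn_gt0.
  have m0 : 0 <= (s ^+ 2 + secmom s) / 2 by lra.
  (* The test width has as its square the midpoint of [s ^+ 2] and the supposedly larger second
     moment, which [secmom_ub] then contradicts; the other half is symmetric. *)
  have st : s < Num.sqrt ((s ^+ 2 + secmom s) / 2).
    rewrite -(@ltr_pXn2r _ 2) ?nnegrE ?sqrtr_ge0 ?(ltW s0)// sqr_sqrtr//; lra.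
  have := secmom_ub s0 st; rewrite sqr_sqrtr//; lra.
- rewrite leNgt; apply/negP => h.
  have q0 : 0 <= secmom s.
    by rewrite divr_ge0 ?fine_ge0// mulr_ge0// ltW.
  have m0 : 0 < (s ^+ 2 + secmom s) / 2 by have := exprn_gt0 2 s0; lra.
  have st : Num.sqrt ((s ^+ 2 + secmom s) / 2) < s.
    rewrite -(@ltr_pXn2r _ 2) ?nnegrE ?sqrtr_ge0 ?(ltW s0)// sqr_sqrtr//; lra.
  have := secmom_lb _ st; rewrite sqrtr_gt0 => /(_ m0).
  rewrite sqr_sqrtr//; lra.
Qed.

Lemma normal_second_moment s : 0 < s ->
  (\int[normal_prob 0 s]_x (x ^+ 2)%:E = (s ^+ 2)%:E)%E.
Proof.
move=> s0; rewrite ge0_integral_normal_prob//; last 2 first.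
- by apply/measurable_EFinP; exact: measurable_funX.
- by move=> x; rewrite lee_fin sqr_ge0.
transitivity (((s * kappa)^-1)%:E * M2 s)%E.
  rewrite -M2Z ?invr_ge0 ?mulr_ge0 ?(ltW s0) ?(ltW kappa_gt0)//.
  apply: eq_integral => x _; rewrite -EFinM normal_pdfE ?gt_eqF// normal_peakE//.
  by rewrite mulrCA mulrA.
by rewrite -(fineK (M2_fin s0)) -EFinM mulrC -/(secmom s) secmomE.
Qed.

(** With [e = expR (y ^+ 2 / 8) >= 1 + y ^+ 2 / 8] one gets [y ^+ 2 <= 8 * e ^+ 2] and
    [y ^+ 4 <= 64 * e ^+ 2]; the cube is at most the mean of these two powers, and
    [36 = (8 + 64) / 2]. *)
Let cube_exp (y : R) : `|y| ^+ 3 <= 36 * expR (y ^+ 2 / 4).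
Proof.
have a0 : 0 <= `|y| by [].
have -> : y ^+ 2 = `|y| ^+ 2 by rewrite real_normK ?num_real.
move: `|y| a0 => {}y a0.
have := expR_ge1Dx (y ^+ 2 / 8).
rewrite (_ : y ^+ 2 / 4 = y ^+ 2 / 8 + y ^+ 2 / 8); last by field.
rewrite expRD; set e := expR _ => h.
have y2 : 0 <= y ^+ 2 by exact: sqr_ge0.
have e1 : 1 <= e by lra.
have e2 : y ^+ 2 <= 8 * e by lra.
have e3 : y ^+ 2 <= 8 * (e * e) by nra.
have e4 : y ^+ 2 * y ^+ 2 <= 64 * (e * e) by nra.
have e5 : 2 * y ^+ 3 <= y ^+ 2 + y ^+ 2 * y ^+ 2.
  rewrite -subr_ge0.
  have -> : y ^+ 2 + y ^+ 2 * y ^+ 2 - 2 * y ^+ 3 = (y - y ^+ 2) ^+ 2 by ring.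
  exact: sqr_ge0.
lra.
Qed.

(** [cube_exp] at [x / s] trades half of the Gaussian exponent for the cube. What is left lies below
    the profile of width [2 * s], whose integral is twice that of width [s], hence [72 = 2 * 36]. *)
Lemma normal_third_moment s : 0 < s ->
  (\int[normal_prob 0 s]_x (`|x| ^+ 3)%:E <= (72 * s ^+ 3)%:E)%E.
Proof.
move=> s0; have m3 : measurable_fun setT (fun x : R => `|x| ^+ 3).
  by apply: measurable_funX; exact: normr_measurable.
rewrite ge0_integral_normal_prob//; last by apply/measurable_EFinP.
have s20 : 0 < 2 * s by rewrite mulr_gt0.
apply: (@le_trans _ _ (\int[mu]_x ((36 * s ^+ 3 / (s * kappa))%:E * (normal_fun 0 (2 * s) x)%:E)))%E.
  have k0 : 0 <= 36 * s ^+ 3 / (s * kappa).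
    by rewrite divr_ge0// ?mulr_ge0 ?exprn_ge0// ltW.
  apply: ge0_le_integral => //.
  - by move=> x _; rewrite -EFinM lee_fin mulr_ge0 ?exprn_ge0// normal_pdf_ge0.
  - apply: emeasurable_funM; apply/measurable_EFinP => //.
    exact: measurable_normal_pdf.
  - by apply: measurable_funeM; exact: mnf.
  move=> x _; rewrite -!EFinM lee_fin normal_pdfE ?gt_eqF// normal_peakE//.
  have := cube_exp (x / s); rewrite normf_div (gtr0_norm s0) expr_div_n.
  rewrite ler_pdivrMr ?exprn_gt0// => h.
  apply: (le_trans (ler_wpM2r _ h)).
    by rewrite mulr_ge0 ?normal_fun_ge0// invr_ge0 mulr_ge0// ltW.
  rewrite (_ : 36 * _ * _ * _ = 36 * s ^+ 3 / (s * kappa) *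
     (expR ((x / s) ^+ 2 / 4) * normal_fun 0 s x)); last by ring.
  rewrite ler_wpM2l// /normal_fun -expRD ler_expR -subr_ge0.
  rewrite (_ : _ - _ = x ^+ 2 / (8 * s ^+ 2)); last by field; rewrite gt_eqF.
  by rewrite divr_ge0 ?sqr_ge0// mulr_ge0 ?sqr_ge0.
rewrite ge0_integralZl_EFin//; last 3 first.
- by move=> x _; rewrite lee_fin normal_fun_ge0.
- exact: mnf.
- by rewrite divr_ge0// ?mulr_ge0 ?exprn_ge0// ltW.
rewrite integral_nf// -EFinM lee_fin le_eqVlt; apply/orP; left; apply/eqP.
by field; rewrite !gt_eqF.
Qed.

End normal_density_facts.

(** * Centred Gaussian measures *)

Section gaussian.
Context {R : realType}.
Local Notation mu := (@lebesgue_measure R).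
Implicit Types (a b v : R).

(** Indexed by the variance, so that convolution adds the indices. The Dirac mass at 0 is required
    because a level may have variance 0. *)
Definition gaussian v : probability (measurableTypeR R) R :=
  if v == 0 then (\d_(0 : measurableTypeR R) : probability _ R)
  else (normal_prob 0 (Num.sqrt v) : probability (measurableTypeR R) R).

Lemma gaussian0 : gaussian 0 = (\d_(0 : measurableTypeR R) : probability _ R).
Proof. by rewrite /gaussian eqxx. Qed.

Lemma gaussian_gt0 v : 0 < v ->
  gaussian v = (normal_prob 0 (Num.sqrt v) : probability (measurableTypeR R) R).
Proof. by move=> v0; rewrite /gaussian gt_eqF. Qed.

Lemma integral_gaussian0 (f : R -> \bar R) : measurable_fun setT f ->
  (\int[gaussian 0]_x f x = f 0%R)%E.
Proof.
by move=> mf; rewrite gaussian0 integral_dirac// diracE mem_set// mul1e.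
Qed.

Lemma gauss_expectE v (g : R -> R) : measurable_fun setT g ->
  gauss_expect v g = (\int[gaussian v]_x (g x)%:E)%E.
Proof.
move=> mg; rewrite /gauss_expect /gaussian; case: eqVneq => [_|//].
rewrite integral_dirac//; last exact/measurable_EFinP.
by rewrite diracE mem_set// mul1e.
Qed.

(** For positive variances, translation and Tonelli turn the right-hand side into a double integral
    of [f u] against a product of densities; [normal_pdf_mul] takes out the density of the sum and
    the other factor integrates to 1. *)
Lemma gaussian_conv_ge0 a b (f : R -> \bar R) : 0 <= a -> 0 <= b ->
  measurable_fun setT f -> (forall x, 0 <= f x)%E ->
  (\int[gaussian (a + b)]_x f x =
   \int[gaussian a]_y \int[gaussian b]_z f (y + z)%R)%E.
Proof.
move=> a0 b0 mf f0.
have mfD : measurable_fun setT (fun p : R * R => f (p.1 + p.2)%R).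
  by apply: measurableT_comp => //; apply: measurable_funD.
move: a0; rewrite le_eqVlt => /predU1P[<-|a0].
  rewrite [RHS]integral_gaussian0; last first.
    exact: (@measurable_fun_fubini_tonelli_F _ _ (measurableTypeR R) (measurableTypeR R) R (gaussian b) (fun p => f (p.1 + p.2)%R)).
  by rewrite add0r; apply: eq_integral => z _; rewrite add0r.
move: b0; rewrite le_eqVlt => /predU1P[<-|b0].
  rewrite addr0; apply: eq_integral => y _.
  rewrite integral_gaussian0 ?addr0//.
  by apply: measurableT_comp => //; exact: measurable_funD.
rewrite (gaussian_gt0 a0) (gaussian_gt0 b0) (gaussian_gt0 (addr_gt0 a0 b0)).
set s := Num.sqrt a; set t := Num.sqrt b.
have s0 : 0 < s by rewrite sqrtr_gt0.
have t0 : 0 < t by rewrite sqrtr_gt0.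
have abE : Num.sqrt (a + b) = Num.sqrt (t ^+ 2 + s ^+ 2).
  by rewrite !sqr_sqrtr ?ltW// addrC.
have r0 : 0 < Num.sqrt (t ^+ 2 + s ^+ 2).
  by rewrite sqrtr_gt0 addr_gt0// exprn_gt0.
have mpdf m r (h : R * R -> R) : measurable_fun setT h ->
    measurable_fun setT (fun p => (normal_pdf m r (h p))%:E).
  move=> mh; apply/measurable_EFinP.
  exact: (measurableT_comp (measurable_normal_pdf m r)).
transitivity (\int[mu]_y \int[mu]_u
    (f u * (normal_pdf 0 t (u - y))%:E * (normal_pdf 0 s y)%:E))%E.
  pose F (p : measurableTypeR R * measurableTypeR R) : \bar R :=
    (f p.1 * (normal_pdf 0 t (p.1 - p.2))%:E * (normal_pdf 0 s p.2)%:E)%E.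
  have mF : measurable_fun setT F.
    apply: emeasurable_funM; first apply: emeasurable_funM.
    + exact: (measurableT_comp mf).
    + by apply: (mpdf _ _ (fun p => p.1 - p.2)); exact: measurable_funB.
    + exact: (mpdf _ _ snd).
  have F0 p : (0 <= F p)%E.
    by rewrite /F !mule_ge0// lee_fin normal_pdf_ge0.
  transitivity (\int[mu]_u \int[mu]_y F (u, y))%E; last first.
    exact: (fubini_tonelli F mF F0).
  rewrite abE ge0_integral_normal_prob//.
  apply: eq_integral => u _.
  under eq_integral do rewrite /F/= -muleA -EFinM normal_pdf_mul// EFinM muleA.
  rewrite ge0_integralZl//; last 3 first.
  - by apply/measurable_EFinP; exact: measurable_normal_pdf.
  - by move=> y _; rewrite lee_fin normal_pdf_ge0.
  - by rewrite mule_ge0// lee_fin normal_pdf_ge0.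
  by rewrite integral_normal_pdf mule1.
rewrite ge0_integral_normal_prob//; last 2 first.
- exact: (@measurable_fun_fubini_tonelli_F _ _ (measurableTypeR R) (measurableTypeR R) R (normal_prob 0 t) (fun p => f (p.1 + p.2)%R)).
- by move=> y; exact: integral_ge0.
apply: eq_integral => y _.
have mfy : measurable_fun setT (fun z : R => f (y + z)%R).
  by apply: measurableT_comp => //; exact: measurable_funD.
have mF : measurable_fun setT (fun u : R => f u * (normal_pdf 0 t (u - y))%:E)%E.
  apply: emeasurable_funM => //; apply/measurable_EFinP.
  apply: (measurableT_comp (measurable_normal_pdf 0 t)); exact: measurable_funB.
rewrite ge0_integralZr//; last 2 first.
- by move=> u _; rewrite mule_ge0// lee_fin normal_pdf_ge0.
- by rewrite lee_fin normal_pdf_ge0.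
have F0 u : (0 <= f u * (normal_pdf 0 t (u - y))%:E)%E.
  by rewrite mule_ge0// lee_fin normal_pdf_ge0.
congr (_ * _)%E.
apply: etrans (esym (ge0_integral_normal_prob 0 t mfy (fun z => f0 _))).
apply: etrans (esym (ge0_integral_shift y mF F0)) _.
by apply: eq_integral => z _; rewrite addrK addrC.
Qed.

Lemma gaussian_conv a b (f : R -> R) M : 0 <= a -> 0 <= b ->
  measurable_fun setT f -> (forall x, `|f x| <= M) ->
  \int[gaussian (a + b)]_x f x =
  \int[gaussian a]_y \int[gaussian b]_z f (y + z).
Proof.
move=> a0 b0 mf fM.
(* Adding the bound [M] makes the integrand nonnegative, so the previous lemma applies; the constant
   is cancelled at the end. *)
have mfM : measurable_fun setT (fun x => f x + M) by exact: measurable_funD.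
have fM0 x : 0 <= f x + M.
  by have := fM x; rewrite ler_norml => /andP[]; lra.
have fMM x : `|f x + M| <= M + M.
  by rewrite (le_trans (ler_normD _ _))// lerD// ger0_norm// (le_trans _ (fM x)).
have mfD : measurable_fun setT (fun p : R * R => f (p.1 + p.2)%R).
  by apply: (measurableT_comp mf); apply: measurable_funD.
have mfy (y : R) : measurable_fun setT (fun z : R => f (y + z)).
  by apply: (measurableT_comp mf); exact: measurable_funD.
have ify (y : R) : (gaussian b).-integrable setT (EFin \o (fun z : R => f (y + z))).
  exact: (@bounded_integrable _ _ _ (gaussian _) _ M (mfy _) (fun z => fM _)).
have mI : measurable_fun setT (fun y : R => \int[gaussian b]_z f (y + z)).
  exact: (@measurable_Rintegral2 _ _ (measurableTypeR R) (measurableTypeR R) R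
    (gaussian a) (gaussian b) (fun p => f (p.1 + p.2)) M).
have iI : (gaussian a).-integrable setT
    (EFin \o (fun y : R => \int[gaussian b]_z f (y + z))).
  apply: (@bounded_integrable _ _ _ _ _ M) => // y.
  exact: (@Rintegral_bounded _ _ _ (gaussian b) _ M (mfy _) (fun z => fM _)).
have iab : (gaussian (a + b)).-integrable setT (EFin \o f).
  exact: (@bounded_integrable _ _ _ (gaussian _) _ M mf fM).
have i1 : (gaussian (a + b)).-integrable setT (EFin \o (fun x => f x + M)).
  exact: (@bounded_integrable _ _ _ (gaussian _) _ (M + M) mfM).
have i2 (y : R) : (gaussian b).-integrable setT (EFin \o (fun z : R => f (y + z) + M)).
  exact: (@bounded_integrable _ _ _ (gaussian _) _ (M + M)
    (measurable_funD (mfy y) (measurable_cst _)) (fun z => fMM _)).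
have i3 : (gaussian a).-integrable setT
    (EFin \o (fun y : R => \int[gaussian b]_z f (y + z) + M)).
  exact: (@integrableD _ _ _ (gaussian a) setT measurableT _ _ iI
    (integrable_const (gaussian a) M)).
have H := @gaussian_conv_ge0 a b (fun x => (f x + M)%:E) a0 b0
  ((measurable_EFinP _ _).2 mfM) fM0.
have E2 : (\int[gaussian a]_y \int[gaussian b]_z (f (y + z) + M)%:E =
    \int[gaussian a]_y (\int[gaussian b]_z f (y + z) + M)%R%:E)%E.
  apply: eq_integral => y _; apply: etrans (esym (EFin_Rintegral (i2 y))) _.
  congr EFin.
  apply: etrans (RintegralD measurableT (ify y) (integrable_const (gaussian b) M)) _.
  by congr (_ + _); exact: Rintegral_const.
have D1 : \int[gaussian (a + b)]_x (f x + M) = \int[gaussian (a + b)]_x f x + M.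
  apply: etrans (RintegralD measurableT iab (integrable_const (gaussian (a + b)) M)) _.
  by congr (_ + _); exact: Rintegral_const.
have D2 : \int[gaussian a]_y (\int[gaussian b]_z f (y + z) + M) =
    \int[gaussian a]_y \int[gaussian b]_z f (y + z) + M.
  apply: etrans (RintegralD measurableT iI (integrable_const (gaussian a) M)) _.
  by congr (_ + _); exact: Rintegral_const.
apply: (@addIr _ M); apply: etrans (esym D1) _; apply: etrans _ D2.
apply: EFin_inj; apply: etrans (EFin_Rintegral i1) _.
by apply: etrans H _; apply: etrans E2 _; exact: (esym (EFin_Rintegral i3)).
Qed.

Lemma gaussian_second_moment v : 0 <= v ->
  (\int[gaussian v]_x (x ^+ 2)%:E = v%:E)%E.
Proof.
rewrite le_eqVlt => /predU1P[<-|v0].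
  rewrite integral_gaussian0 ?expr0n//.
  by apply/measurable_EFinP; exact: measurable_funX.
by rewrite gaussian_gt0// normal_second_moment ?sqrtr_gt0// sqr_sqrtr// ltW.
Qed.

Lemma gaussian_third_moment v : 0 <= v ->
  (\int[gaussian v]_x (`|x| ^+ 3)%:E <= (72 * Num.sqrt v ^+ 3)%:E)%E.
Proof.
rewrite le_eqVlt => /predU1P[<-|v0].
  rewrite integral_gaussian0.
    by rewrite lee_fin normr0 sqrtr0 !expr0n mulr0.
  by apply/measurable_EFinP/measurable_funX; exact: normr_measurable.
by rewrite gaussian_gt0// normal_third_moment ?sqrtr_gt0.
Qed.

Lemma gaussian_opp v (f : R -> \bar R) : 0 <= v -> measurable_fun setT f ->
  (forall x, 0 <= f x)%E ->
  (\int[gaussian v]_x f (- x)%R = \int[gaussian v]_x f x)%E.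
Proof.
move=> + mf f0.
have mfo : measurable_fun setT (fun x : R => f (- x)%R).
  exact: (measurableT_comp mf).
rewrite le_eqVlt => /predU1P[<-|v0].
  by rewrite !integral_gaussian0// oppr0.
have s0 : Num.sqrt v != 0 by rewrite gt_eqF// sqrtr_gt0.
rewrite gaussian_gt0// !ge0_integral_normal_prob//.
rewrite -[RHS]ge0_integral_opp.
- apply: eq_integral => x _; congr (_ * _%:E)%E.
  by rewrite !normal_pdfE// /normal_fun !subr0 sqrrN.
- apply: emeasurable_funM => //; apply/measurable_EFinP.
  exact: measurable_normal_pdf.
- by move=> x; rewrite mule_ge0// lee_fin normal_pdf_ge0.
Qed.

Lemma gaussian_integrable2 v : 0 <= v ->
  (gaussian v).-integrable setT (EFin \o (fun x : R => x ^+ 2)).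
Proof.
move=> v0; apply/integrableP; split.
  by apply/measurable_EFinP; exact: measurable_funX.
under eq_integral do rewrite /= ger0_norm ?sqr_ge0//.
by rewrite gaussian_second_moment// ltry.
Qed.

(** The reflection [x -> - x] exchanges the positive and the negative part, so their integrals are
    equal; they may be subtracted because [|x| <= 1 + x ^+ 2] makes them finite. *)
Lemma gaussian_mean v : 0 <= v -> (\int[gaussian v]_x x%:E = 0)%E.
Proof.
move=> v0; rewrite integralE.
rewrite -(@gaussian_opp v (fun x => ((fun x : R => x%:E)^\- x)%E) v0).
- rewrite (_ : (fun x : R => (fun x : R => x%:E)^\- (- x)%R)%E =
      ((fun x : R => x%:E)^\+)%E).
    rewrite subee//.
    have mid : measurable_fun [set: measurableTypeR R] (fun x : R => x%:E).
      by apply/measurable_EFinP.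
    have ii : (gaussian v).-integrable setT (fun x : R => x%:E).
      apply: (@le_integrable _ _ _ (gaussian v) setT measurableT _
        (EFin \o (fun x : R => 1 + x ^+ 2))) => //.
        move=> x _; rewrite /= lee_fin (ger0_norm (_ : 0 <= 1 + x ^+ 2)).
          by rewrite ler_norml; apply/andP; split; nra.
        by rewrite addr_ge0// sqr_ge0.
      apply: (@integrableD _ _ _ (gaussian v) setT measurableT
        (EFin \o (fun=> 1)) (EFin \o (fun x : R => x ^+ 2))).
        exact: integrable_const.
      exact: gaussian_integrable2.
    exact: (integrable_pos_fin_num measurableT ii).
  by apply/funext => x; rewrite funenegE funeposE; congr maxe; rewrite -EFinN opprK.
- apply: measurable_funeneg; exact/measurable_EFinP.
- by move=> x; rewrite funeneg_ge0.
Qed.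

End gaussian.

(** * Lindeberg's replacement *)

Section taylor_class.
Context {R : realType}.
Implicit Types (f : R -> R) (h x K : R).

(** Size of a second-order Taylor remainder. The cube makes it negligible for small [h], while the
    square keeps its expectation finite when only a second moment exists. *)
Definition rho h := Num.min (h ^+ 2) (`|h| ^+ 3).

Lemma rho_ge0 h : 0 <= rho h.
Proof. by rewrite le_min sqr_ge0 exprn_ge0. Qed.

Lemma rho_le2 h : rho h <= h ^+ 2.
Proof. by rewrite ge_min lexx. Qed.

Lemma rho_le3 h : rho h <= `|h| ^+ 3.
Proof. by rewrite ge_min lexx orbT. Qed.

Lemma measurable_cube : measurable_fun setT (fun x : R => `|x| ^+ 3).
Proof. by apply: measurable_funX; exact: normr_measurable. Qed.

Lemma measurable_rho : measurable_fun setT rho.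
Proof.
apply: measurable_minr; first exact: measurable_funX.
exact: measurable_cube.
Qed.

(** [a] and [b] play the roles of f'(x) and f''(x) / 2. [a] needs no bound, since its term vanishes
    for centred summands; the bound on [b] controls changes of variance, and the Lipschitz bound
    absorbs remainders that are small in L1. *)
Definition taylor2 K f :=
  [/\ forall x, `|f x| <= K,
      forall x y, `|f x - f y| <= K * `|x - y| &
      forall x, exists a b, `|b| <= K /\
        forall h, `|f (x + h) - f x - a * h - b * h ^+ 2| <= K * rho h].

Lemma taylor2_ge0 K f : taylor2 K f -> 0 <= K.
Proof. by move=> [fK _ _]; apply: le_trans (fK 0). Qed.

Lemma lipschitz_continuous K f : (forall x y, `|f x - f y| <= K * `|x - y|) ->
  continuous f.
Proof.
move=> fK x; apply/cvgrPdist_lt => e e0.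
have K0 : 0 < `|K| + 1 by rewrite ltr_wpDl.
exists ((`|K| + 1)^-1 * e) => /=; first by rewrite mulr_gt0// invr_gt0.
move=> y /= xy; apply: (le_lt_trans (fK x y)).
apply: (@le_lt_trans _ _ ((`|K| + 1) * `|x - y|)).
  by rewrite ler_wpM2r// (le_trans (ler_norm _))// lerDl.
by rewrite -ltr_pdivlMl.
Qed.

Lemma taylor2_measurable K f : taylor2 K f -> measurable_fun setT f.
Proof.
move=> [_ fK _]; apply: continuous_measurable_fun.
exact: (lipschitz_continuous fK).
Qed.

Lemma measurable_shifted f x : measurable_fun setT f ->
  measurable_fun setT (fun z : R => f (x + z)).
Proof. by move=> mf; apply: (measurableT_comp mf); exact: measurable_funD. Qed.

End taylor_class.

Section taylor_expectation.
Context d (T : measurableType d) (R : realType) (Q : probability T R).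
Variables (Y : T -> R) (v : R).
Hypotheses (mY : measurable_fun setT Y).
Hypotheses (iY2 : Q.-integrable setT (EFin \o (fun w => Y w ^+ 2))).
Hypotheses (EY : \int[Q]_w Y w = 0) (EY2 : \int[Q]_w Y w ^+ 2 = v).

Lemma square_integrable_integrable : Q.-integrable setT (EFin \o Y).
Proof.
apply: (@le_integrable _ _ _ Q setT measurableT _
    (EFin \o (fun w => 1 + Y w ^+ 2))) => //.
- exact/measurable_EFinP.
- move=> w _; rewrite /= lee_fin (ger0_norm (_ : 0 <= 1 + Y w ^+ 2)).
    by rewrite ler_norml; apply/andP; split; nra.
  by rewrite addr_ge0// sqr_ge0.
- exact: (@integrableD _ _ _ Q setT measurableT _ _ (integrable_const Q 1) iY2).
Qed.

Let iY := square_integrable_integrable.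

Lemma rho_integrable : Q.-integrable setT (EFin \o (fun w => rho (Y w))).
Proof.
apply: (@le_integrable _ _ _ Q setT measurableT _
    (EFin \o (fun w => Y w ^+ 2))) => //.
- by apply/measurable_EFinP; exact: (measurableT_comp measurable_rho).
- move=> w _; rewrite /= lee_fin (ger0_norm (rho_ge0 _)) (ger0_norm (sqr_ge0 _)).
  exact: rho_le2.
Qed.

Let iQuad (c a b : R) :
  Q.-integrable setT (EFin \o (fun w => c + a * Y w + b * Y w ^+ 2)) /\
  \int[Q]_w (c + a * Y w + b * Y w ^+ 2) = c + b * v.
Proof.
have iaY : Q.-integrable setT (EFin \o (fun w => a * Y w)).
  exact: (integrableZl measurableT a iY).
have ibY : Q.-integrable setT (EFin \o (fun w => b * Y w ^+ 2)).
  exact: (integrableZl measurableT b iY2).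
have icY : Q.-integrable setT (EFin \o (fun w => c + a * Y w)).
  exact: (@integrableD _ _ _ Q setT measurableT _ _ (integrable_const Q c) iaY).
split; first exact: (@integrableD _ _ _ Q setT measurableT _ _ icY ibY).
rewrite (RintegralD measurableT icY ibY).
rewrite (RintegralD measurableT (integrable_const Q c) iaY).
by rewrite (Rintegral_const Q) !RintegralZl// EY EY2 mulr0 addr0.
Qed.

(** The linear term has mean 0 and the quadratic one has mean [b * v], so the law of [Y] enters
    through its variance alone, up to the remainder. Two centred variables of equal variance are
    thus interchangeable. *)
Lemma taylor_expectation (f : R -> R) (K x a b : R) :
  measurable_fun setT f -> (forall x, `|f x| <= K) ->
  (forall h, `|f (x + h) - f x - a * h - b * h ^+ 2| <= K * rho h) ->
  `|\int[Q]_w f (x + Y w) - (f x + b * v)| <= K * \int[Q]_w rho (Y w).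
Proof.
move=> mf fK fT; have [iq <-] := iQuad (f x) a b.
rewrite -RintegralZl//; last exact: rho_integrable.
apply: Rintegral_close => //.
- apply: (@bounded_integrable _ _ _ _ _ K) => //.
  exact: (measurableT_comp (measurable_shifted x mf)).
- exact: (integrableZl measurableT K rho_integrable).
- by move=> w; apply: le_trans (fT (Y w)); rewrite !opprD !addrA.
Qed.

Lemma expectation_shift_square x :
  (\int[Q]_w ((x + Y w) ^+ 2)%:E = (x ^+ 2 + v)%:E)%E.
Proof.
have [iq Eq] := iQuad (x ^+ 2) (2 * x) 1; rewrite mul1r in Eq.
rewrite -Eq EFin_Rintegral//; apply: eq_integral => w _.
by congr EFin; ring.
Qed.

End taylor_expectation.

Lemma gaussian_taylor {R : realType} (v : R) (f : R -> R) (K x a b : R) :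
  0 <= v -> measurable_fun setT f -> (forall x, `|f x| <= K) ->
  (forall h, `|f (x + h) - f x - a * h - b * h ^+ 2| <= K * rho h) ->
  `|\int[gaussian v]_z f (x + z) - (f x + b * v)| <=
    K * \int[gaussian v]_z rho z.
Proof.
move=> v0 mf fK fT.
apply: (@taylor_expectation _ (measurableTypeR R) R (gaussian v) id v) => //.
- exact: gaussian_integrable2.
- by rewrite /Rintegral gaussian_mean.
- by rewrite /Rintegral gaussian_second_moment.
Qed.

Lemma gaussian_rho_integrable {R : realType} (v : R) : 0 <= v ->
  (gaussian v).-integrable setT (EFin \o rho).
Proof.
move=> v0; apply: (@rho_integrable _ (measurableTypeR R) R (gaussian v) id) => //.
exact: gaussian_integrable2.
Qed.

Lemma gaussian_rho_le2 {R : realType} (v : R) : 0 <= v ->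
  \int[gaussian v]_z rho z <= v.
Proof.
move=> v0; rewrite -[leRHS](_ : \int[gaussian v]_z (z ^+ 2) = v).
  apply: le_Rintegral => //.
  - exact: gaussian_rho_integrable.
  - exact: gaussian_integrable2.
  - by move=> z _; exact: rho_le2.
by rewrite /Rintegral gaussian_second_moment.
Qed.

Lemma gaussian_rho_le3 {R : realType} (v : R) : 0 <= v ->
  \int[gaussian v]_z rho z <= 72 * Num.sqrt v ^+ 3.
Proof.
move=> v0; rewrite -lee_fin (EFin_Rintegral (gaussian_rho_integrable v0)).
apply: le_trans (gaussian_third_moment v0); apply: ge0_le_integral => //.
- by move=> z _; rewrite lee_fin rho_ge0.
- by apply/measurable_EFinP; exact: measurable_rho.
- by apply/measurable_EFinP; exact: measurable_cube.
- by move=> z _; rewrite lee_fin rho_le3.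
Qed.

(** Convolution splits off a Gaussian of variance [b]. Expanding in it costs at most [K * b] from
    the quadratic coefficient and [K * b] from the remainder, as [rho] is at most the square. *)
Lemma gaussian_variance_lipschitz {R : realType} (a b K : R) (f : R -> R) :
  0 <= a -> 0 <= b -> taylor2 K f ->
  `|\int[gaussian (a + b)]_z f z - \int[gaussian a]_z f z| <= 2 * K * b.
Proof.
move=> a0 b0 fT; have mf := taylor2_measurable fT; have K0 := taylor2_ge0 fT.
have [fK _ fx] := fT.
rewrite [X in `|X - _|](gaussian_conv a0 b0 mf fK).
have mfD : measurable_fun setT (fun p : measurableTypeR R * measurableTypeR R =>
    f (p.1 + p.2)).
  by apply: (measurableT_comp mf); apply: measurable_funD.
apply: Rintegral_close_cst.
- apply: (@bounded_integrable _ _ _ _ _ K).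
    exact: (@measurable_Rintegral2 _ _ (measurableTypeR R) (measurableTypeR R) R
      (gaussian a) (gaussian b) (fun p => f (p.1 + p.2)) K mfD (fun z => fK _)).
  move=> y; apply: Rintegral_bounded => //.
  exact: (measurable_shifted y mf).
- exact: (@bounded_integrable _ _ _ _ _ K).
move=> y; have [p [q [qK fy]]] := fx y.
have := gaussian_taylor b0 mf fK fy.
have /(ler_wpM2l K0) := gaussian_rho_le2 b0.
have : `|q * b| <= K * b by rewrite normrM (ger0_norm b0) ler_wpM2r.
rewrite !ler_norml => /andP[h1 h2] h3 /andP[h4 h5].
by apply/andP; split; lra.
Qed.

(** * Sums of independent variables and the exchange of their summands *)

Section independent_sequence.
Context d (T : measurableType d) (R : realType) (P : probability T R).
Variables (n : nat) (X : nat -> T -> R).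

(** The sets are arbitrary, so taking some of them to be [setT] also gives the factorisation for
    every subfamily. *)
Definition indep_seq := forall B : nat -> set R, (forall i, measurable (B i)) ->
  P (\big[setI/setT]_(0 <= i < n) (X i @^-1` B i)) =
  (\prod_(0 <= i < n) P (X i @^-1` B i))%E.

Hypotheses (mX : forall i, measurable_fun setT (X i)) (iX : indep_seq).

Let S k w := \sum_(0 <= i < k) X i w.

Lemma measurable_partial_sum k : measurable_fun setT (S k).
Proof.
rewrite /S; elim: k => [|k IH].
  by rewrite (_ : (fun=> _) = cst 0)//; apply/funext => w; rewrite big_geq.
rewrite (_ : (fun w => _) = (fun w => \sum_(0 <= i < k) X i w + X k w)).
  exact: measurable_funD.
by apply/funext => w; rewrite big_nat_recr.
Qed.

Let mXB i B : measurable B -> measurable (X i @^-1` B).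
Proof. by move=> mB; rewrite -[_ @^-1` _]setTI; exact: mX. Qed.

Let tail (B : nat -> set R) k := \big[setI/setT]_(k <= i < n) (X i @^-1` B i).

Let mtail B k : (forall i, measurable (B i)) -> measurable (tail B k).
Proof.
move=> mB; rewrite /tail; apply: big_ind => //.
  by move=> U V; exact: measurableI.
by move=> i _; exact: mXB.
Qed.

(** Induction on the length of the sum: moving [X k] out of the tail and into the sum is one use of
    [indep_add_event], with the remaining tail as the event. *)
Lemma partial_sum_indep_tail k : (k <= n)%N ->
  forall (A : set R) (B : nat -> set R), measurable A ->
  (forall i, measurable (B i)) ->
  P (S k @^-1` A `&` tail B k) =
  (P (S k @^-1` A) * \prod_(k <= i < n) P (X i @^-1` B i))%E.
Proof.
elim: k => [_ A B mA mB|k IH kn A B mA mB].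
  (* The empty sum is the constant 0, so its preimage of [A] is everything or nothing. *)
  have [A0|A0] := pselect (A 0).
    have -> : S 0%N @^-1` A = setT.
      by apply/seteqP; split => // w _; rewrite /= /S big_geq.
    by rewrite setTI probability_setT mul1e; exact: iX.
  have -> : S 0%N @^-1` A = set0.
    by apply/seteqP; split => // w; rewrite /= /S big_geq.
  by rewrite set0I measure0 mul0e.
have {}IH := IH (ltnW kn).
(* Placing [B'] at position [k] makes the event on [X k] part of a tail that starts at [k], where
   the induction hypothesis factors it off together with the rest. *)
pose up (B' : set R) (B : nat -> set R) i := if i == k then B' else B i.
have mup B' C : measurable B' -> (forall i, measurable (C i)) ->
    forall i, measurable (up B' C i).
  by move=> mB' mC i; rewrite /up; case: ifP.
have tailup B' C : tail (up B' C) k = X k @^-1` B' `&` tail C k.+1.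
  rewrite /tail big_ltn//; congr (_ `&` _); first by rewrite /up eqxx.
  apply: eq_big_nat => i /andP[ki _]; rewrite /up.
  by case: eqP ki => // ->; rewrite ltnn.
have produp B' C : (\prod_(k <= i < n) P (X i @^-1` up B' C i) =
    P (X k @^-1` B') * \prod_(k.+1 <= i < n) P (X i @^-1` C i))%E.
  rewrite big_ltn//; congr (_ * _)%E; first by rewrite /up eqxx.
  apply: eq_big_nat => i /andP[ki _]; rewrite /up.
  by case: eqP ki => // ->; rewrite ltnn.
have H3 A' B' C : measurable A' -> measurable B' -> (forall i, measurable (C i)) ->
    P (S k @^-1` A' `&` X k @^-1` B' `&` tail C k.+1) =
    (P (S k @^-1` A') * P (X k @^-1` B') *
     \prod_(k.+1 <= i < n) P (X i @^-1` C i))%E.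
  move=> mA' mB' mC; rewrite -setIA -tailup IH//; last exact: mup.
  by rewrite produp muleA.
have tailT : tail (fun=> setT) k.+1 = setT.
  by rewrite /tail big1// => i _; rewrite preimage_setT.
have prodT : (\prod_(k.+1 <= i < n) P (X i @^-1` setT) = 1)%E.
  by rewrite big1// => i _; rewrite preimage_setT probability_setT.
have H2 A' B' : measurable A' -> measurable B' ->
    P (S k @^-1` A' `&` X k @^-1` B') =
    (P (S k @^-1` A') * P (X k @^-1` B'))%E.
  move=> mA' mB'; have := H3 A' B' (fun=> setT) mA' mB'.
  by rewrite tailT setIT prodT mule1; apply.
have H1 : P (tail B k.+1) = (\prod_(k.+1 <= i < n) P (X i @^-1` B i))%E.
  have := H3 setT setT B measurableT measurableT mB.
  by rewrite !preimage_setT !setTI probability_setT !mul1e.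
have SE : S k.+1 = (fun w => S k w + X k w).
  by apply/funext => w; rewrite /S big_nat_recr.
rewrite SE -H1; apply: indep_add_event => //.
- exact: measurable_partial_sum.
- exact: mtail.
- by move=> A' B' mA' mB'; rewrite H3// H2// H1.
Qed.

Lemma partial_sum_indep_next k : (k < n)%N -> forall A B : set R,
  measurable A -> measurable B ->
  P (S k @^-1` A `&` X k @^-1` B) = (P (S k @^-1` A) * P (X k @^-1` B))%E.
Proof.
move=> kn A B mA mB.
pose C i := if i == k then B else setT.
have mC i : measurable (C i) by rewrite /C; case: ifP.
have CE i : (k < i)%N -> X i @^-1` C i = setT.
  by rewrite /C; case: eqP => [->|_ _]; rewrite ?ltnn// preimage_setT.
have tE : tail C k = X k @^-1` B.
  rewrite /tail big_ltn// [in LHS]/C eqxx.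
  rewrite [X in _ `&` X](_ : _ = setT) ?setIT//.
  rewrite big_nat; apply: big1 => i /andP[ki _]; exact: CE.
have pE : (\prod_(k <= i < n) P (X i @^-1` C i) = P (X k @^-1` B))%E.
  rewrite big_ltn// [in X in (X * _)%E]/C eqxx.
  rewrite [X in (_ * X)%E](_ : _ = 1%E) ?mule1//.
  rewrite big_nat; apply: big1 => i /andP[ki _].
  by rewrite CE// probability_setT.
have := partial_sum_indep_tail (ltnW kn) mA mC.
by rewrite tE pE.
Qed.

Variable v : nat -> R.
Hypotheses
  (iX2 : forall i, P.-integrable setT (EFin \o (fun w => X i w ^+ 2)))
  (EX : forall i, \int[P]_w X i w = 0)
  (EX2 : forall i, \int[P]_w X i w ^+ 2 = v i).

Let v0 i : 0 <= v i.
Proof. by rewrite -EX2; apply: Rintegral_ge0 => w _; exact: sqr_ge0. Qed.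

Let sumv0 k : 0 <= \sum_(0 <= i < k) v i.
Proof. by apply: sumr_ge0 => i _; exact: v0. Qed.

Lemma partial_sum_second_moment k : (k <= n)%N ->
  (\int[P]_w (S k w ^+ 2)%:E = (\sum_(0 <= i < k) v i)%:E)%E.
Proof.
elim: k => [_|k IH kn].
  rewrite (eq_integral (cst 0%E)) ?integral0 ?big_geq// => w _.
  by rewrite /S big_geq// expr0n.
have msq : measurable_fun setT (fun z : R * R => ((z.1 + z.2) ^+ 2)%:E).
  by apply/measurable_EFinP; apply: measurable_funX; exact: measurable_funD.
have sq0 (z : R * R) : (0 <= ((z.1 + z.2) ^+ 2)%:E)%E.
  by rewrite lee_fin sqr_ge0.
have := indep_ge0_integral (measurable_partial_sum k) (mX k)
  (partial_sum_indep_next kn) msq sq0.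
rewrite /=; under [X in X = _ -> _]eq_integral do rewrite /S -big_nat_recr//.
move=> ->.
rewrite (eq_integral (fun w => (S k w ^+ 2)%:E + (v k)%:E)%E); last first.
  by move=> w _; rewrite (expectation_shift_square (mX k) (iX2 k) (EX k) (EX2 k)).
rewrite ge0_integralD//; last 3 first.
- by move=> w _; rewrite lee_fin sqr_ge0.
- by apply/measurable_EFinP/measurable_funX; exact: measurable_partial_sum.
- by move=> w _; rewrite lee_fin.
rewrite IH ?(ltnW kn)// integral_cst//.
rewrite [X in (_ * X)%E](_ : _ = 1%E) ?mule1; last exact: probability_setT.
by rewrite big_nat_recr.
Qed.

(* Lindeberg's replacement, in Trotter's operator form: the summands are traded
   one at a time for centred Gaussians of the same variance. *)
Lemma lindeberg_replacement k (f : R -> R) K : (k <= n)%N -> taylor2 K f ->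
  forall x,
  `|\int[P]_w f (x + S k w) - \int[gaussian (\sum_(0 <= i < k) v i)]_z f (x + z)|
  <= K * \sum_(0 <= i < k) (\int[P]_w rho (X i w) + \int[gaussian (v i)]_z rho z).
Proof.
move=> + fT; have mf := taylor2_measurable fT; have K0 := taylor2_ge0 fT.
have [fK _ fx] := fT.
elim: k => [_ x|k IH kn x].
  rewrite !big_geq// mulr0 normr_le0 subr_eq0; apply/eqP.
  transitivity (f x).
    rewrite -[RHS](Rintegral_const P); apply: eq_Rintegral => w _.
    by rewrite /S big_geq// addr0.
  rewrite /Rintegral integral_gaussian0 ?addr0//.
  by apply/measurable_EFinP; exact: measurable_shifted.
set V := \sum_(0 <= i < k) v i; have V0 : 0 <= V := sumv0 k.
pose W := \sum_(0 <= i < k) (\int[P]_w rho (X i w) + \int[gaussian (v i)]_z rho z).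
have mS := measurable_partial_sum k.
have mF1 : measurable_fun setT (fun p : R * R => f (x + (p.1 + p.2))).
  apply: (measurableT_comp mf); apply: measurable_funD => //.
  exact: measurable_funD.
(* By independence [X k] can be integrated outside, where it merely shifts the base point. The
   induction hypothesis is therefore needed at every [x]. *)
have E1 : \int[P]_w f (x + S k.+1 w) =
    \int[P]_w' \int[P]_w f (x + X k w' + S k w).
  have ind A B : measurable A -> measurable B ->
      P (X k @^-1` A `&` S k @^-1` B) = (P (X k @^-1` A) * P (S k @^-1` B))%E.
    by move=> mA mB; rewrite setIC muleC; exact: partial_sum_indep_next.
  have := indep_Rintegral (mX k) mS ind mF1 (fun p => fK _).
  move=> /= H; apply: etrans (etrans H _).
    by apply: eq_Rintegral => w _; rewrite /S big_nat_recr//= [X k w + _]addrC.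
  by apply: eq_Rintegral => w _; apply: eq_Rintegral => w' _; rewrite addrA.
have mXS : measurable_fun setT (fun p : T * T => f (x + X k p.1 + S k p.2)).
  apply: (measurableT_comp mf); apply: measurable_funD.
    by apply: measurable_funD => //; exact: (measurableT_comp (mX k)).
  exact: (measurableT_comp mS).
have mXG : measurable_fun setT
    (fun p : T * measurableTypeR R => f (x + X k p.1 + p.2)).
  apply: (measurableT_comp mf); apply: measurable_funD; last exact: measurable_snd.
  by apply: measurable_funD => //; exact: (measurableT_comp (mX k)).
have mGG : measurable_fun setT
    (fun p : measurableTypeR R * measurableTypeR R => f (x + (p.1 + p.2))).
  apply: (measurableT_comp mf); apply: measurable_funD => //.
  by apply: measurable_funD; [exact: measurable_fst|exact: measurable_snd].
pose A1 := \int[P]_w' \int[gaussian V]_z f (x + X k w' + z).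
have C1 : `|\int[P]_w f (x + S k.+1 w) - A1| <= K * W.
  rewrite E1 /A1; apply: Rintegral_close_cst.
  - apply: (@bounded_integrable _ _ _ _ _ K).
      exact: (@measurable_Rintegral2 _ _ T T R P P _ K mXS (fun p => fK _)).
    move=> w; apply: Rintegral_bounded => //.
    exact: (measurableT_comp (measurable_shifted (x + X k w) mf) mS).
  - apply: (@bounded_integrable _ _ _ _ _ K).
      exact: (@measurable_Rintegral2 _ _ T (measurableTypeR R) R P (gaussian V) _ K
        mXG (fun p => fK _)).
    move=> w; apply: Rintegral_bounded => //.
    exact: (measurable_shifted (x + X k w) mf).
  - by move=> w; exact: (IH (ltnW kn) (x + X k w)).
pose A2 := \int[gaussian V]_z \int[P]_w' f (x + X k w' + z).
have A12 : A1 = A2.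
  exact: (@Rintegral_swap _ _ T (measurableTypeR R) R P (gaussian V)
    (fun p => f (x + X k p.1 + p.2)) K mXG (fun p => fK _)).
pose A3 := \int[gaussian V]_z \int[gaussian (v k)]_y f (x + (z + y)).
(* Under the Gaussian integral, the two Taylor expansions at [x + z] share the main term
   [f (x + z) + q * v k], so only the two [rho] integrals remain. *)
have C2 : `|A2 - A3| <=
    K * (\int[P]_w rho (X k w) + \int[gaussian (v k)]_z rho z).
  apply: Rintegral_close_cst.
  - apply: (@bounded_integrable _ _ _ _ _ K).
      exact: (@measurable_Rintegral1 _ _ T (measurableTypeR R) R P (gaussian V) _ K
        mXG (fun p => fK _)).
    move=> z; apply: Rintegral_bounded => //.
    apply: (measurableT_comp mf); apply: measurable_funD => //.
    exact: measurable_funD.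
  - apply: (@bounded_integrable _ _ _ _ _ K).
      exact: (@measurable_Rintegral2 _ _ (measurableTypeR R) (measurableTypeR R) R
        (gaussian V) (gaussian (v k)) _ K mGG (fun p => fK _)).
    move=> z; apply: Rintegral_bounded => //.
    apply: (measurableT_comp mf); apply: measurable_funD => //.
    exact: measurable_funD.
  - move=> z; have [p [q [_ fz]]] := fx (x + z).
    have := taylor_expectation (mX k) (iX2 k) (EX k) (EX2 k) mf fK fz.
    have := gaussian_taylor (v0 k) mf fK fz.
    have -> : \int[P]_w f (x + z + X k w) = \int[P]_w f (x + X k w + z).
      by apply: eq_Rintegral => w _; rewrite addrAC.
    have -> : \int[gaussian (v k)]_y f (x + z + y) =
        \int[gaussian (v k)]_y f (x + (z + y)).
      by apply: eq_Rintegral => y _; rewrite addrA.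
    rewrite !ler_norml => /andP[h1 h2] /andP[h3 h4].
    by apply/andP; split; lra.
have A3E : A3 = \int[gaussian (V + v k)]_z f (x + z).
  exact: (esym (gaussian_conv V0 (v0 k) (measurable_shifted x mf) (fun z => fK _))).
have VE : \sum_(0 <= i < k.+1) v i = V + v k by rewrite big_nat_recr.
have WE : \sum_(0 <= i < k.+1) (\int[P]_w rho (X i w) + \int[gaussian (v i)]_z rho z) =
    W + (\int[P]_w rho (X k w) + \int[gaussian (v k)]_z rho z).
  by rewrite big_nat_recr.
have A4 : \int[gaussian (\sum_(0 <= i < k.+1) v i)]_z f (x + z) = A3.
  exact: (etrans (congr1 (fun t => \int[gaussian t]_z f (x + z)) VE) (esym A3E)).
have {A12}C1 : `|\int[P]_w f (x + S k.+1 w) - A2| <= K * W.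
  exact: (eq_ind _ (fun t => `|_ - t| <= K * W) C1 _ A12).
rewrite [X in `|_ - X|]A4 WE mulrDr.
by apply: (le_trans (ler_distD A2 _ _)); apply: lerD.
Qed.

End independent_sequence.

(** * Smooth test functions *)

Section derivative_bounds.
Context {R : realType}.
Implicit Types (F G f : R -> R) (x h C : R).

Definition derive_of F G := forall x, is_derive x (1 : R) F (G x).

Lemma derive_of_continuous F G : derive_of F G -> continuous F.
Proof.
move=> FG x; apply: differentiable_continuous; apply/derivable1_diffP.
by have [] := FG x.
Qed.

Lemma derive_of_mvt F G x h : derive_of F G -> 0 <= h ->
  exists2 z, x <= z <= x + h & F (x + h) - F x = G z * h.
Proof.
move=> FG h0.
have xh : x <= x + h by rewrite lerDl.
have [z zx ->] := @MVT_segment R F G x (x + h) xh (fun y _ => FG y)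
  (continuous_subspaceT (derive_of_continuous FG)).
by exists z; [move: zx; rewrite in_itv|rewrite [x + h]addrC addrK].
Qed.

Lemma derive_of_shift F G x : derive_of F G ->
  derive_of (fun t => F (x + t)) (fun t => G (x + t)).
Proof.
move=> FG t.
have H1 : is_derive t (1 : R) (fun t : R => x + t) (0 + 1) by exact: is_deriveD.
have := @is_derive1_comp R F (fun t => x + t) t _ _ (FG (x + t)) H1.
by rewrite add0r mulr1.
Qed.

Lemma derive_of_sub F G F' G' : derive_of F G -> derive_of F' G' ->
  derive_of (fun x => F x - F' x) (fun x => G x - G' x).
Proof. by move=> FG FG' x; apply: is_deriveB. Qed.

Lemma derive_of_cst C : derive_of (fun=> C) (fun=> 0).
Proof. by move=> x; exact: is_derive_cst. Qed.

Lemma derive_of_scale C F G : derive_of F G ->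
  derive_of (fun x => C * F x) (fun x => C * G x).
Proof. by move=> FG x; exact: (@is_deriveZ _ _ _ F C x 1 _ (FG x)). Qed.

Lemma derive_of_lin C : derive_of (fun x => C * x) (fun=> C).
Proof.
move=> x; have := @is_deriveZ _ _ _ (@id R) C x 1 _ (is_derive_id x 1).
by rewrite /GRing.scale/= mulr1.
Qed.

Lemma derive_of_half_sqr C : derive_of (fun x => C / 2 * x ^+ 2) (fun x => C * x).
Proof.
move=> x; have := @is_deriveZ _ _ _ (fun x : R => x ^+ 2) (C / 2) x 1 _
  (@is_deriveX _ _ (@id R) 2 x 1 _ (is_derive_id x 1)).
by move=> /is_derive_eq; apply; rewrite /GRing.scale/= expr1; field.
Qed.

(** The mean value theorem raises the power by one and keeps the constant. The factorials of
    Taylor's formula are given up, which affects constants only. *)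
Lemma derive_of_pow_bound F G C n : derive_of F G -> F 0 = 0 ->
  (forall x, `|G x| <= C * `|x| ^+ n) ->
  forall x, `|F x| <= C * `|x| ^+ n.+1.
Proof.
move=> FG F0 GC x.
have C0 : 0 <= C.
  by have := GC 1; rewrite normr1 expr1n mulr1; exact: le_trans.
have [z [zx Fz]] : exists z, `|z| <= `|x| /\ `|F x| = `|G z| * `|x|.
  have [x0|x0] := leP 0 x.
    have [z zx] := derive_of_mvt 0 FG x0; rewrite add0r F0 subr0 => ->.
    exists z; split; last by rewrite normrM.
    by move: zx; rewrite add0r => /andP[z0 zx]; rewrite !ger0_norm.
  have x0' : 0 <= - x by rewrite oppr_ge0 ltW.
  have [z] := derive_of_mvt x FG x0'; rewrite subrr F0 sub0r => zx Fz.
  exists z; split; last by rewrite -normrN Fz normrM normrN.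
  by move/andP: zx => [z0 zx]; rewrite !ler0_norm// ?lerN2// ltW.
rewrite Fz exprSr mulrA ler_wpM2r// (le_trans (GC z))// ler_wpM2l//.
by apply: lerXn2r; rewrite ?nnegrE.
Qed.

Lemma taylor2_of_derivatives f f1 f2 f3 C :
  derive_of f f1 -> derive_of f1 f2 -> derive_of f2 f3 ->
  (forall x, `|f x| <= C) -> (forall x, `|f1 x| <= C) ->
  (forall x, `|f2 x| <= C) -> (forall x, `|f3 x| <= C) ->
  taylor2 (2 * C) f.
Proof.
move=> d1 d2 d3 fC f1C f2C f3C.
have C0 : 0 <= C by apply: le_trans (fC 0).
have sub0 F G x : derive_of F G ->
    derive_of (fun h => F (x + h) - F x) (fun h => G (x + h)).
  move=> FG h; have := derive_of_sub (derive_of_shift x FG) (derive_of_cst (F x)) h.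
  by rewrite subr0.
have B1 F G x : derive_of F G -> (forall x, `|G x| <= C) ->
    forall h, `|F (x + h) - F x| <= C * `|h| ^+ 1.
  move=> FG GC.
  apply: (@derive_of_pow_bound (fun h => F (x + h) - F x)
    (fun h => G (x + h)) C 0 (sub0 _ _ x FG)).
    by rewrite addr0 subrr.
  by move=> h; rewrite expr0 mulr1.
have sub1 F G x : derive_of F G ->
    derive_of (fun h => F (x + h) - F x - G x * h) (fun h => G (x + h) - G x).
  by move=> FG; apply: derive_of_sub; [exact: sub0|exact: derive_of_lin].
have B2 F G H x : derive_of F G -> derive_of G H -> (forall x, `|H x| <= C) ->
    forall h, `|F (x + h) - F x - G x * h| <= C * `|h| ^+ 2.
  move=> FG GH HC; apply: derive_of_pow_bound.
  - exact: sub1.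
  - by rewrite addr0 subrr mulr0 subrr.
  - exact: (B1 _ _ x GH HC).
split.
- by move=> x; apply: (le_trans (fC x)); lra.
- move=> x y; have := B1 _ _ y d1 f1C (x - y).
  rewrite [y + _]addrC subrK expr1 => /le_trans; apply.
  by rewrite ler_wpM2r//; lra.
- move=> x; exists (f1 x), (f2 x / 2); split.
    by rewrite normrM (@ger0_norm _ 2^-1) ?invr_ge0//; have := f2C x; lra.
  have B3 : forall h, `|f (x + h) - f x - f1 x * h - f2 x / 2 * h ^+ 2| <= C * `|h| ^+ 3.
    apply: derive_of_pow_bound.
    + apply: derive_of_sub; first exact: (sub1 _ _ x d1).
      exact: derive_of_half_sqr.
    + by rewrite addr0 subrr expr0n !mulr0 !subrr.
    + exact: (B2 _ _ _ x d2 d3 f3C).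
  (* Where the cube is smaller, the third-order remainder serves. Where the square is smaller, the
     remainder after the linear term and the quadratic term are each at most [C * h ^+ 2], whence
     the factor 2 of the statement. *)
  move=> h; rewrite /rho minEle; case: ifP => _; last first.
    by apply: (le_trans (B3 h)); rewrite ler_wpM2r ?exprn_ge0//; lra.
  have := B2 _ _ _ x d1 d2 f2C h.
  rewrite real_normK ?num_real// => b2.
  have b3 : `|f2 x / 2 * h ^+ 2| <= C * h ^+ 2.
    rewrite normrM (ger0_norm (sqr_ge0 h)) ler_wpM2r ?sqr_ge0//.
    by rewrite normrM (@ger0_norm _ 2^-1) ?invr_ge0//; have := f2C x; lra.
  by apply: (le_trans (ler_normB _ _)); lra.
Qed.

(* Primitives are only needed for functions vanishing on a left half-line,
   for which [\int_(a - 1)^x] is a primitive on the whole line. *)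
Lemma left_vanishing_primitive (a : R) f : continuous f ->
  (forall x, x <= a -> f x = 0) ->
  exists F, derive_of F f /\ forall x, x <= a -> F x = 0.
Proof.
move=> cf fa.
(* Starting at [a - 1] puts every [x >= a] strictly inside the interval of integration, as the
   fundamental theorem of calculus requires; points below [a] are covered by [Fa]. *)
pose F x := (\int[lebesgue_measure]_(t in `[(a - 1), x]) f t)%R.
have Fa x : x <= a -> F x = 0.
  move=> xa; rewrite /F; transitivity (\int[lebesgue_measure]_(t in `[(a - 1), x]) (0 : R))%R.
    apply: eq_Rintegral => t; rewrite inE/= in_itv/= => /andP[_ tx].
    by apply: fa; exact: le_trans xa.
  by rewrite Rintegral_cst// mul0r.
exists F; split => // x.
have [xa|ax] := ltP x a.
  rewrite fa ?(ltW xa)//.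
  have d0 : is_derive x (1 : R) (cst (0 : R)) (0 : R) by exact: is_derive_cst.
  apply: (near_eq_is_derive _ d0).
  near=> y; rewrite /= Fa//; apply: ltW.
  by near: y; apply: lt_nbhsl.
have fi : lebesgue_measure.-integrable `[(a - 1), (x + 1)] (EFin \o f).
  apply: continuous_compact_integrable; first exact: segment_compact.
  exact: continuous_subspaceT.
have x1 : x < x + 1 by rewrite ltrDl.
have a1 : a - 1 < x by rewrite (lt_le_trans _ ax)// gtrBl.
have [dF F'] := @continuous_FTC1_closed R f (a - 1) x (x + 1) x1 fi a1 (cf x).
exact: (DeriveDef dF (etrans (esym (derive1E _ _)) F')).
Unshelve. all: by end_near. Qed.

End derivative_bounds.

Section smoothing.
Context {R : realType}.

Definition fdiff (h : R) (F : R -> R) x := F (h + x) - F x.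

Lemma derive_of_fdiff h F G : derive_of F G -> derive_of (fdiff h F) (fdiff h G).
Proof. by move=> FG; apply: derive_of_sub => //; exact: derive_of_shift. Qed.

Lemma fdiff_bound h F C : (forall x, `|F x| <= C) ->
  forall x, `|fdiff h F x| <= 2 * C.
Proof.
by move=> FC x; rewrite (le_trans (ler_normB _ _))// mulr2n mulrDl mul1r lerD.
Qed.

Lemma fdiff_mvt h F G x : 0 <= h -> derive_of F G ->
  exists2 z, x <= z <= x + h & fdiff h F x = G z * h.
Proof. by move=> h0 FG; rewrite /fdiff [h + x]addrC; exact: derive_of_mvt. Qed.

(* The third divided difference of a triple primitive of [g] is [C^3] with
   bounded derivatives and, by the mean value theorem, is a value of [g] nearby. *)
Lemma smooth_uniform_approx (a M e h : R) (g : R -> R) :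
  continuous g -> (forall x, x <= a -> g x = 0) -> (forall x, `|g x| <= M) ->
  0 < h -> (forall x y, x <= y <= x + 3 * h -> `|g x - g y| <= e) ->
  exists f K, taylor2 K f /\ forall x, `|g x - f x| <= e.
Proof.
move=> cg ga gM h0 ge.
have [G1 [d1 G1a]] := left_vanishing_primitive cg ga.
have [G2 [d2 G2a]] := left_vanishing_primitive (derive_of_continuous d1) G1a.
have [G3 [d3 G3a]] := left_vanishing_primitive (derive_of_continuous d2) G2a.
have h0' := ltW h0; have hn0 : h != 0 by rewrite gt_eqF.
pose D := fdiff h.
have dD F G : derive_of F G -> derive_of (D F) (D G) by exact: derive_of_fdiff.
have mvt F G x : derive_of F G -> exists2 z, x <= z <= x + h & D F x = G z * h.
  by move=> FG; exact: fdiff_mvt.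
(* Each of the three mean value points moves by at most [h], which accounts for the window [3 * h]
   in the hypothesis on [g]. *)
have D3 x : exists2 z, x <= z <= x + 3 * h & D (D (D G3)) x = g z * h ^+ 3.
  have [z1 z1x ->] := mvt _ _ x (dD _ _ (dD _ _ d3)).
  have [z2 z2x ->] := mvt _ _ z1 (dD _ _ d2).
  have [z3 z3x ->] := mvt _ _ z2 d1.
  exists z3; last by ring.
  by move: z1x z2x z3x => /andP[? ?] /andP[? ?] /andP[? ?]; apply/andP; split; lra.
have D2 x : exists2 z, x <= z <= x + 3 * h & D (D G2) x = g z * h ^+ 2.
  have [z1 z1x ->] := mvt _ _ x (dD _ _ d2).
  have [z2 z2x ->] := mvt _ _ z1 d1.
  exists z2; last by ring.
  by move: z1x z2x => /andP[? ?] /andP[? ?]; apply/andP; split; lra.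
have M0 : 0 <= M by apply: le_trans (gM 0).
have b0 x : `|D (D (D G3)) x| <= M * h ^+ 3.
  have [z _ ->] := D3 x; rewrite normrM (ger0_norm (exprn_ge0 3 h0')).
  by rewrite ler_wpM2r ?exprn_ge0.
(* Each derivative uses up one primitive. A difference with no primitive left to act on costs a
   factor 2 where it would otherwise give a factor [h]. *)
have b1 x : `|D (D (D G2)) x| <= 2 * (M * h ^+ 2).
  apply: fdiff_bound => {}x; have [z _ ->] := D2 x.
  by rewrite normrM (ger0_norm (exprn_ge0 2 h0')) ler_wpM2r ?exprn_ge0.
have b2 x : `|D (D (D G1)) x| <= 2 * (2 * (M * h)).
  do 2 apply: fdiff_bound; move=> {}x; have [z _ ->] := mvt _ _ x d1.
  by rewrite normrM (ger0_norm h0') ler_wpM2r.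
have b3 x : `|D (D (D g)) x| <= 2 * (2 * (2 * M)).
  by do 3 apply: fdiff_bound.
pose c := (h ^+ 3)^-1.
have c0 : 0 <= c by rewrite invr_ge0 exprn_ge0.
have cb (F : R -> R) (B C x : R) : `|F x| <= B -> B <= C -> `|c * F x| <= c * C.
  by move=> FB BC; rewrite normrM (ger0_norm c0) ler_wpM2l// (le_trans FB).
pose C := M * h ^+ 3 + 2 * (M * h ^+ 2) + 2 * (2 * (M * h)) + 2 * (2 * (2 * M)).
have p3 : 0 <= M * h ^+ 3 by rewrite mulr_ge0// exprn_ge0.
have p2 : 0 <= M * h ^+ 2 by rewrite mulr_ge0// exprn_ge0.
have p1 : 0 <= M * h by rewrite mulr_ge0.
exists (fun x => c * D (D (D G3)) x), (2 * (c * C)); split.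
  apply: (@taylor2_of_derivatives _ _ (fun x => c * D (D (D G2)) x)
    (fun x => c * D (D (D G1)) x) (fun x => c * D (D (D g)) x)).
  - exact: (derive_of_scale c (dD _ _ (dD _ _ (dD _ _ d3)))).
  - exact: (derive_of_scale c (dD _ _ (dD _ _ (dD _ _ d2)))).
  - exact: (derive_of_scale c (dD _ _ (dD _ _ (dD _ _ d1)))).
  - by move=> x; apply: (cb _ _ _ _ (b0 x)); rewrite /C; lra.
  - by move=> x; apply: (cb _ _ _ _ (b1 x)); rewrite /C; lra.
  - by move=> x; apply: (cb _ _ _ _ (b2 x)); rewrite /C; lra.
  - by move=> x; apply: (cb _ _ _ _ (b3 x)); rewrite /C; lra.
move=> x; have [z zx ->] := D3 x.
by rewrite mulrCA mulVf ?mulr1 ?expf_neq0//; exact: ge.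
Qed.

(** Near each point of the segment, half of its continuity radius serves for all neighbours at once;
    compactness then makes one radius serve for every [x]. *)
Lemma heine_segment (A e : R) (g : R -> R) : continuous g -> 0 < e ->
  exists2 r, 0 < r & forall x y, `|x| <= A -> `|x - y| < r -> `|g x - g y| < e.
Proof.
move=> cg e0.
have /compact_near_coveringP := @segment_compact R (- A) A.
pose U (r : R) (x : R) := forall y, `|x - y| < r -> `|g x - g y| < e.
move=> /(_ R (0^'+) U _).
have H : forall x, `[(- A), A]%classic x ->
    \forall x' \near x & r \near 0^'+, U r x'.
  move=> x _.
  have e2 : 0 < e / 2 by rewrite divr_gt0.
  have /cvgrPdist_lt/(_ _ e2)[r /= r0 xr] := cg x.
  have r2 : 0 < r / 2 by rewrite divr_gt0.
  exists ([set x' | `|x - x'| < r / 2], [set s | s < r / 2]) => /=.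
    split; first by exists (r / 2).
    exact: nbhs_right_lt.
  move=> [x' s] /= [xx' sr] y x'y.
  have h1 := xr x'; have h2 := xr y; rewrite /= in h1 h2.
  have {}h1 : `|g x - g x'| < e / 2 by apply: h1; lra.
  have {}h2 : `|g x - g y| < e / 2.
    apply: h2; apply: (le_lt_trans (ler_distD x' _ _)); lra.
  apply: (le_lt_trans (ler_distD (g x) _ _)); rewrite [`|g x' - _|]distrC; lra.
move=> /(_ H)[r /= r0 rU].
exists (r / 2); first by rewrite divr_gt0.
move=> x y xA xy; apply: (rU (r / 2)) => //=.
- by rewrite sub0r normrN gtr0_norm ?divr_gt0//; lra.
- by rewrite divr_gt0.
- by rewrite in_itv/= -ler_norml.
Qed.

Let clamp (A x : R) := Num.max (- A) (Num.min A x).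

Let clamp_norm (A x : R) : 0 <= A -> `|clamp A x| <= A.
Proof.
move=> A0; rewrite ler_norml /clamp le_max lexx/= ge_max.
by rewrite ge_min lexx/= andbT; lra.
Qed.

Let clamp_lip (A x y : R) : 0 <= A -> `|clamp A x - clamp A y| <= `|x - y|.
Proof.
move=> A0; rewrite /clamp !(maxEle, minEle); rewrite ler_norml.
have := ler_norm (x - y); have := ler_norm (y - x); rewrite (distrC y).
by do ![case: ifP => /=]; rewrite ?ler_norml => *; apply/andP; split; lra.
Qed.

Let clamp_id (A x : R) : `|x| <= A -> clamp A x = x.
Proof.
rewrite ler_norml => /andP[h1 h2]; rewrite /clamp.
by rewrite (min_idPr h2) (max_idPr h1).
Qed.

(** Clamping the argument to the segment makes [g] uniformly continuous. Outside, the error is at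
    most [2 * M], which is below [2 * M / A * |x|]; in this linear form it is controlled by a first
    absolute moment. *)
Lemma bounded_continuous_approx (M e A : R) (g : R -> R) :
  continuous g -> (forall x, `|g x| <= M) -> 0 < e -> 0 < A ->
  exists f K, taylor2 K f /\ forall x, `|g x - f x| <= e + 2 * M / A * `|x|.
Proof.
move=> cg gM e0 A0; have A0' := ltW A0.
have M0 : 0 <= M by apply: le_trans (gM 0).
have [r r0 gr] := heine_segment A cg e0.
(* Subtracting the value at [- A] makes the clamped function vanish on the left half-line, where the
   primitives start; the constant is added back to the approximation. *)
pose q := g (- A); pose g1 x := g (clamp A x) - q.
have g1u x y : `|x - y| < r -> `|g1 x - g1 y| <= e.
  move=> xy; rewrite /g1 opprB addrA subrK; apply/ltW/gr; first exact: clamp_norm.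
  by apply: le_lt_trans xy; exact: clamp_lip.
have cg1 : continuous g1.
  move=> x; apply: cvgB; last exact: cvg_cst.
  apply: continuous_comp; last exact: cg.
  apply: (@lipschitz_continuous _ 1) => {}x y.
  by rewrite mul1r; exact: clamp_lip.
have g1a x : x <= - A -> g1 x = 0.
  move=> xA; rewrite /g1 /clamp (min_idPr _) ?(max_idPl xA) ?subrr//.
  by apply: (le_trans xA); lra.
have g1M x : `|g1 x| <= M + M by rewrite (le_trans (ler_normB _ _))//; apply: lerD; exact: gM.
(* Three steps of length [r / 4] stay below the modulus [r]. *)
have h0 : 0 < r / 4 by rewrite divr_gt0.
have [f [K [fT gf]]] := smooth_uniform_approx cg1 g1a g1M h0
  (e := e) (fun x y xy => g1u x y ltac:(move: xy => /andP[? ?]; rewrite ltr_norml; apply/andP; split; lra)).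
exists (fun x => f x + q), (K + M); split.
  have K0 := taylor2_ge0 fT.
  have [f1 f2 f3] := fT; split.
  - by move=> x; rewrite (le_trans (ler_normD _ _))//; apply: lerD; [exact: f1|exact: gM].
  - move=> x y; rewrite opprD addrACA subrr addr0 (le_trans (f2 x y))//.
    by rewrite ler_wpM2r// lerDl.
  - move=> x; have [a [b [bK fx]]] := f3 x; exists a, b; split.
      by rewrite (le_trans bK)// lerDl.
    move=> h; rewrite (_ : _ + q - (_ + q) = f (x + h) - f x); last by ring.
    by rewrite (le_trans (fx h))// ler_wpM2r ?rho_ge0// lerDl.
move=> x; have := gf x; rewrite /g1 => gfx.
have [xA|Ax] := leP `|x| A.
  rewrite clamp_id// in gfx.
  rewrite opprD addrA addrAC (le_trans gfx)// lerDl mulr_ge0// divr_ge0//.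
  by rewrite mulr_ge0.
have -> : g x - (f x + q) = (g x - g (clamp A x)) + (g (clamp A x) - q - f x) by ring.
rewrite (le_trans (ler_normD _ _))// addrC lerD//.
apply: (@le_trans _ _ (2 * M)).
  rewrite (le_trans (ler_normB _ _))//; have := gM x; have := gM (clamp A x); lra.
rewrite -mulrA ler_peMr ?mulr_ge0// mulrC ler_pdivlMr// mul1r ltW//.
Qed.

End smoothing.

(** * From Taylor-class test functions to convergence in distribution *)

Section weak_convergence.
Context {R : realType}.

Lemma square_moment_norm d (T : measurableType d) (Q : probability T R)
    (Y : T -> R) (v : R) : measurable_fun setT Y ->
  (\int[Q]_w (Y w ^+ 2)%:E = v%:E)%E ->
  (\int[Q]_w `|Y w|%:E <= (1 + v)%:E)%E.
Proof.
move=> mY EY2.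
have mY2 : measurable_fun setT (fun w => (Y w ^+ 2)%:E).
  by apply/measurable_EFinP; exact: measurable_funX.
apply: (@le_trans _ _ (\int[Q]_w (1%:E + (Y w ^+ 2)%:E)))%E.
  apply: ge0_le_integral => //.
  - by apply/measurable_EFinP; exact: measurableT_comp.
  - exact: emeasurable_funD.
  - move=> w _; rewrite -EFinD lee_fin ler_norml; apply/andP; split; nra.
rewrite ge0_integralD//; last by move=> w _; rewrite lee_fin sqr_ge0.
rewrite EY2 integral_cst// EFinD leeD2r//.
by rewrite [X in (_ * X)%E](_ : _ = 1%E) ?mule1//; exact: probability_setT.
Qed.

Lemma Rintegral_norm_le d (T : measurableType d) (Q : probability T R)
    (Y : T -> R) (B : R) : measurable_fun setT Y ->
  (\int[Q]_w `|Y w|%:E <= B%:E)%E ->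
  Q.-integrable setT (EFin \o (fun w => `|Y w|)) /\ \int[Q]_w `|Y w| <= B.
Proof.
move=> mY YB; have iY : Q.-integrable setT (EFin \o (fun w => `|Y w|)).
  apply/integrableP; split; first by apply/measurable_EFinP; exact: measurableT_comp.
  under eq_integral do rewrite /= normr_id.
  by rewrite (le_lt_trans YB)// ltry.
by split => //; rewrite -lee_fin (EFin_Rintegral iY).
Qed.

Lemma Rintegral_approx d (T : measurableType d) (Q : probability T R)
    (Y : T -> R) (g f : R -> R) (M K e c B : R) :
  measurable_fun setT Y -> measurable_fun setT g -> measurable_fun setT f ->
  (forall x, `|g x| <= M) -> (forall x, `|f x| <= K) -> 0 <= c ->
  (forall x, `|g x - f x| <= e + c * `|x|) ->
  (\int[Q]_w `|Y w|%:E <= B%:E)%E ->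
  `|\int[Q]_w g (Y w) - \int[Q]_w f (Y w)| <= e + c * B.
Proof.
move=> mY mg mf gM fK c0 gf YB.
have [iY YB'] := Rintegral_norm_le mY YB.
have ic : Q.-integrable setT (EFin \o (fun w => c * `|Y w|)).
  exact: (integrableZl measurableT c iY).
have := @Rintegral_close _ _ _ Q (fun w => g (Y w)) (fun w => f (Y w))
  (fun w => e + c * `|Y w|).
rewrite (RintegralD measurableT (integrable_const Q e) ic) (Rintegral_const Q).
rewrite RintegralZl// => H; apply: (le_trans (H _ _ _ _)).
- by apply: (@bounded_integrable _ _ _ _ _ M) => //; exact: (measurableT_comp mg).
- by apply: (@bounded_integrable _ _ _ _ _ K) => //; exact: (measurableT_comp mf).
- exact: (@integrableD _ _ _ Q setT measurableT _ _ (integrable_const Q e) ic).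
- by move=> w; exact: gf.
- by rewrite lerD2l ler_wpM2l.
Qed.

Variables (d : nat -> measure_display) (T : forall N, measurableType (d N)).
Variables (P : forall N, probability (T N) R).

(** The uniform bound on the first absolute moments acts as tightness: it makes the linear error of
    [bounded_continuous_approx] small uniformly in [N] once [A] is large. *)
Lemma cvg_in_distr_of_taylor2 (X : forall N, T N -> R) (s2 B : R) :
  0 <= s2 ->
  (\forall N \near \oo, measurable_fun setT (X N)) ->
  (\forall N \near \oo, (\int[P N]_w `|X N w|%:E <= B%:E)%E) ->
  (forall K f, taylor2 K f ->
    (fun N => \int[P N]_w f (X N w)) @ \oo --> \int[gaussian s2]_z f z) ->
  cvg_in_distr_normal P X s2.
Proof.
move=> s20 mX XB HT g cg [M gM].
have mg : measurable_fun setT g by exact: continuous_measurable_fun.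
have M0 : 0 <= M by apply: le_trans (gM 0).
have gi : (gaussian s2).-integrable setT (EFin \o g).
  exact: (@bounded_integrable _ _ _ (gaussian s2) g M mg gM).
rewrite gauss_expectE//.
have -> : (\int[gaussian s2]_x (g x)%:E)%E = (\int[gaussian s2]_x g x)%:E.
  exact: (esym (EFin_Rintegral gi)).
suff H : (fun N => \int[P N]_w g (X N w)) @ \oo --> \int[gaussian s2]_x g x.
  have HE : (fun N => (\int[P N]_w g (X N w))%:E) @ \oo --> (\int[gaussian s2]_x g x)%:E.
    by apply: cvg_EFin; [exact: nearW|exact: H].
  apply: cvg_trans HE; apply: near_eq_cvg; near=> N.
  have mXN : measurable_fun setT (X N) by near: N.
  apply: EFin_Rintegral; apply: (@bounded_integrable _ _ _ _ _ M) => //.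
  exact: (measurableT_comp mg).
apply/cvgrPdist_le => e e0.
pose C := `|B| + (1 + s2).
have C0 : 0 < C by rewrite /C ltr_wpDl// ltr_pwDl.
(* Chosen so that [2 * M / A * C <= e / 8]; the extra 1 keeps [A] positive when [M = 0]. *)
pose A := 16 * M * C / e + 1.
have A0 : 0 < A by rewrite /A ltr_wpDl// divr_ge0 ?(ltW e0)// !mulr_ge0// ltW.
pose c := 2 * M / A.
have c0 : 0 <= c by rewrite divr_ge0 ?(ltW A0)// mulr_ge0.
have cC : c * C <= e / 8.
  have eA : e / 8 * A = 2 * M * C + e / 8 by rewrite /A; field; rewrite gt_eqF.
  by rewrite /c mulrAC ler_pdivrMr// eA lerDl divr_ge0// ltW.
have e8 : 0 < e / 8 by rewrite divr_gt0.
have [f [K [fT gf]]] := bounded_continuous_approx cg gM e8 A0.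
have mf := taylor2_measurable fT; have [fK _ _] := fT.
have G1 : `|\int[gaussian s2]_x g x - \int[gaussian s2]_x f x| <= e / 8 + c * (1 + s2).
  apply: (@Rintegral_approx _ (measurableTypeR R) (gaussian s2) id g f M K) => //.
  apply: square_moment_norm => //; exact: gaussian_second_moment.
have c1 : c * (1 + s2) <= c * C by rewrite ler_wpM2l// /C lerDr.
have c2 : c * B <= c * C.
  by rewrite ler_wpM2l// /C (le_trans (ler_norm B))// lerDl; lra.
have e4 : 0 < e / 4 by rewrite divr_gt0.
have /cvgrPdist_le/(_ _ e4) Hf := HT K f fT.
near=> N.
have mXN : measurable_fun setT (X N) by near: N.
have XBN : (\int[P N]_w `|X N w|%:E <= B%:E)%E by near: N.
have G2 := Rintegral_approx mXN mg mf gM fK c0 gf XBN.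
have G3 : `|\int[gaussian s2]_z f z - \int[P N]_w f (X N w)| <= e / 4 by near: N.
move: G1 G2 G3; move: (\int[gaussian s2]_x g x) (\int[gaussian s2]_x f x)
  (\int[P N]_w g (X N w)) (\int[P N]_w f (X N w)) => x1 x2 x3 x4.
rewrite -/c !ler_norml => /andP[h1 h2] /andP[h3 h4] /andP[h5 h6].
by apply/andP; split; lra.
Unshelve. all: by end_near. Qed.

(** Three errors add up: [r] through the Lipschitz bound, [E] through the replacement, and the gap
    between [V N] and [s2] through the dependence of Gaussian expectations on the variance. *)
Lemma cvg_in_distr_of_approx (X M : forall N, T N -> R) (s2 : R)
    (V E r : nat -> R) :
  (\forall N \near \oo, measurable_fun setT (X N)) ->
  (\forall N \near \oo, measurable_fun setT (M N)) ->
  (\forall N \near \oo, (\int[P N]_w `|X N w - M N w|%:E <= (r N)%:E)%E) ->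
  (\forall N \near \oo, (\int[P N]_w (M N w ^+ 2)%:E = (V N)%:E)%E) ->
  (\forall N \near \oo, 0 <= V N) ->
  (forall K f, taylor2 K f -> \forall N \near \oo,
    `|\int[P N]_w f (M N w) - \int[gaussian (V N)]_z f z| <= K * E N) ->
  r @ \oo --> 0 -> V @ \oo --> s2 -> E @ \oo --> 0 ->
  cvg_in_distr_normal P X s2.
Proof.
move=> mX mM XM M2 V0 HT r0 Vs E0.
have s20 : 0 <= s2 by exact: (cvgr_to_ge Vs V0).
(* The bound on E|X| comes from [|M| <= 1 + M ^+ 2] with [V N <= s2 + 1] eventually, plus
   [r N <= 1]. *)
apply: (@cvg_in_distr_of_taylor2 X s2 (1 + (s2 + 1) + 1)) => //.
  near=> N.
  have mXN : measurable_fun setT (X N) by near: N.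
  have mMN : measurable_fun setT (M N) by near: N.
  have XMN : (\int[P N]_w `|X N w - M N w|%:E <= (r N)%:E)%E by near: N.
  have M2N : (\int[P N]_w (M N w ^+ 2)%:E = (V N)%:E)%E by near: N.
  have rN : r N <= 1 by near: N; apply: (cvgr_le 0).
  have VN : V N <= s2 + 1 by near: N; apply: (cvgr_le s2) => //; rewrite ltrDl.
  apply: (@le_trans _ _ (\int[P N]_w (`|M N w|%:E + `|X N w - M N w|%:E)))%E.
    apply: ge0_le_integral => //.
    - by apply/measurable_EFinP; exact: measurableT_comp.
    - apply: emeasurable_funD; apply/measurable_EFinP; apply: measurableT_comp => //.
      exact: measurable_funB.
    - move=> w _; rewrite -EFinD lee_fin -[X in `|X| <= _](subrKC (M N w)).
      exact: ler_normD.
  rewrite ge0_integralD//; last 2 first.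
  - by apply/measurable_EFinP; exact: measurableT_comp.
  - by apply/measurable_EFinP; apply: measurableT_comp => //; exact: measurable_funB.
  rewrite EFinD; apply: leeD.
    by apply: (le_trans (square_moment_norm mMN M2N)); rewrite lee_fin lerD2l.
  by apply: (le_trans XMN); rewrite lee_fin.
move=> K f fT; apply/cvgrPdist_le => e e0.
have mf := taylor2_measurable fT; have K0 := taylor2_ge0 fT; have [fK fL _] := fT.
have K1 : 0 < K + 1 by rewrite ltr_wpDl.
have e3 : 0 < e / 4 / (K + 1) by rewrite !divr_gt0.
near=> N.
have mXN : measurable_fun setT (X N) by near: N.
have mMN : measurable_fun setT (M N) by near: N.
have XMN : (\int[P N]_w `|X N w - M N w|%:E <= (r N)%:E)%E by near: N.
have VN0 : 0 <= V N by near: N.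
have HN : `|\int[P N]_w f (M N w) - \int[gaussian (V N)]_z f z| <= K * E N.
  by near: N; exact: HT.
have rN : r N <= e / 4 / (K + 1) by near: N; apply: (cvgr_le 0).
have EN : E N <= e / 4 / (K + 1) by near: N; apply: (cvgr_le 0).
have VN : `|s2 - V N| <= e / 4 / (K + 1).
  by near: N; move/cvgrPdist_le : Vs => /(_ _ e3).
have KK t : t <= e / 4 / (K + 1) -> K * t <= e / 4.
  rewrite ler_pdivlMr// => h.
  have [t0|t0] := leP 0 t; first by rewrite mulrDr mulr1 in h; nra.
  by nra.
have mXM : measurable_fun setT (fun w => X N w - M N w) by exact: measurable_funB.
have [iXM XM'] := Rintegral_norm_le mXM XMN.
have S1 : `|\int[P N]_w f (X N w) - \int[P N]_w f (M N w)| <= K * r N.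
  apply: (@le_trans _ _ (K * \int[P N]_w `|X N w - M N w|)); last exact: ler_wpM2l.
  rewrite -RintegralZl//; apply: Rintegral_close.
  - by apply: (@bounded_integrable _ _ _ _ _ K) => //; exact: (measurableT_comp mf).
  - by apply: (@bounded_integrable _ _ _ _ _ K) => //; exact: (measurableT_comp mf).
  - exact: (integrableZl measurableT K iXM).
  - by move=> w; exact: fL.
have S2 : `|\int[gaussian s2]_z f z - \int[gaussian (V N)]_z f z| <=
    2 * (K * `|s2 - V N|).
  have [sV|Vs'] := leP (V N) s2.
    have h0 : 0 <= s2 - V N by rewrite subr_ge0.
    have := gaussian_variance_lipschitz VN0 h0 fT.
    by rewrite subrKC (ger0_norm h0) mulrA.
  have h0 : 0 <= V N - s2 by rewrite subr_ge0 ltW.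
  have := gaussian_variance_lipschitz s20 h0 fT.
  have n1 : `|s2 - V N| = V N - s2 by rewrite distrC ger0_norm.
  by rewrite subrKC [X in X <= _ -> _]distrC [X in 2 * (K * X)]n1 mulrA.
have S3 := KK _ VN.
have {}S1 := le_trans S1 (KK _ rN).
have {}HN := le_trans HN (KK _ EN).
have tri (x1 x2 x3 x4 t : R) : `|x3 - x4| <= e / 4 -> `|x1 - x2| <= 2 * t ->
    `|x4 - x2| <= e / 4 -> t <= e / 4 -> `|x1 - x3| <= e.
  rewrite !ler_norml => /andP[h1 h2] /andP[h3 h4] /andP[h5 h6] h7.
  by apply/andP; split; lra.
exact: (tri _ _ _ _ _ S1 S2 HN S3).
Unshelve. all: by end_near. Qed.

End weak_convergence.

(** * Dominated series *)

Section geometric_sums.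
Context {R : realType}.

Lemma cvg_geometric0 (q : R) : 0 <= q -> q < 1 -> (fun n => q ^+ n) @ \oo --> 0.
Proof.
move=> q0 q1; have := @cvg_geometric R 1 q; rewrite ger0_norm// => /(_ q1).
by under eq_cvg do rewrite /= mul1r.
Qed.

Lemma geometric_sum_le (q : R) m n : 0 <= q -> q < 1 ->
  \sum_(m <= l < n) q ^+ l <= q ^+ m / (1 - q).
Proof.
move=> q0 q1; have q1' : 0 < 1 - q by rewrite subr_gt0.
have [nm|mn] := leqP n m.
  by rewrite big_geq// divr_ge0 ?exprn_ge0// ltW.
rewrite ler_pdivlMr// -(subnKC (ltnW mn)); elim: (n - m)%N => [|k IH].
  by rewrite addn0 big_geq// mul0r exprn_ge0.
suff : (\sum_(m <= l < m + k.+1) q ^+ l) * (1 - q) = q ^+ m - q ^+ (m + k.+1).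
  by move=> ->; rewrite gerBl exprn_ge0.
elim: {IH}k => [|k IH].
  by rewrite addn1 big_nat1 exprSr; ring.
by rewrite addnS big_nat_recr/= ?mulrDl ?IH ?exprSr; [ring|rewrite leq_addr].
Qed.

Lemma sum_nat_diff (a : nat -> R) m n : (m <= n)%N ->
  \sum_(0 <= l < n) a l - \sum_(0 <= l < m) a l = \sum_(m <= l < n) a l.
Proof. by move=> mn; rewrite (big_cat_nat (n := m))//= addrAC subrr add0r. Qed.

Section geometric_domination.
Variables (C q : R).
Hypotheses (q0 : 0 <= q) (q1 : q < 1).

Lemma geometric_tail_bound (a : nat -> R) m n :
  (forall l, `|a l| <= C * q ^+ l) -> (m <= n)%N ->
  `|\sum_(0 <= l < n) a l - \sum_(0 <= l < m) a l| <= C * (q ^+ m / (1 - q)).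
Proof.
move=> aC mn; rewrite sum_nat_diff//.
have C0 : 0 <= C by have := aC 0%N; rewrite expr0 mulr1; exact: le_trans.
rewrite (le_trans (ler_norm_sum _ _ _))//.
rewrite (le_trans (ler_sum _ (fun l _ => aC l)))// -mulr_sumr.
by rewrite ler_wpM2l// geometric_sum_le.
Qed.

Lemma geometric_dominated_cvg (a : nat -> R) :
  (forall l, `|a l| <= C * q ^+ l) -> cvgn (fun n => \sum_(0 <= l < n) a l).
Proof.
move=> aC; apply: normed_cvg.
have C0 : 0 <= C by have := aC 0%N; rewrite expr0 mulr1; exact: le_trans.
apply: (@series_le_cvg _ _ (geometric C q)) => //=.
- by move=> n; rewrite mulr_ge0// exprn_ge0.
- by apply: is_cvg_geometric_series; rewrite ger0_norm.
Qed.

(** Dominated convergence for sums whose length grows as well: the majorant fixes one cut [m] beyond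
    which all tails are small, and the finitely many terms below it converge one by one. *)
Lemma tannery (a : nat -> nat -> R) (b : nat -> R) (L : nat -> nat) :
  (\forall N \near \oo, forall l, `|a N l| <= C * q ^+ l) ->
  (forall l, (fun N => a N l) @ \oo --> b l) ->
  L @ \oo --> \oo ->
  (fun N => \sum_(0 <= l < L N) a N l) @ \oo -->
  limn (fun n => \sum_(0 <= l < n) b l).
Proof.
move=> aC ab Loo.
have bC l : `|b l| <= C * q ^+ l.
  apply: (cvgr_to_le (cvg_norm (ab l))).
  near=> N; have aCN : forall l, `|a N l| <= C * q ^+ l by near: N.
  exact: aCN.
have cb := geometric_dominated_cvg bC.
set s := limn _.
apply/cvgrPdist_le => e e0.
have e3 : 0 < e / 3 by rewrite divr_gt0.
have tail0 : (fun m => C * (q ^+ m / (1 - q))) @ \oo --> 0.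
  rewrite -(mulr0 C) -(mul0r (1 - q)^-1).
  apply: cvgM; first exact: cvg_cst.
  by apply: cvgM; [exact: cvg_geometric0|exact: cvg_cst].
have /cvgrPdist_le/(_ _ e3)[m _ Hm] := tail0.
have {Hm}mt : C * (q ^+ m / (1 - q)) <= e / 3.
  by have := Hm m (leqnn m); rewrite /= sub0r normrN => /(le_trans (ler_norm _)).
have sm : `|s - \sum_(0 <= l < m) b l| <= e / 3.
  apply: (cvgr_to_le (cvg_norm (cvgB cb (@cvg_cst _ _ _ _ _)))).
  near=> n; apply: le_trans mt; apply: geometric_tail_bound => //.
  by near: n; exists m.
have abm : (fun N => \sum_(0 <= l < m) a N l) @ \oo --> \sum_(0 <= l < m) b l.
  elim: m {mt sm} => [|m IH].
    rewrite big_geq//; under eq_fun do rewrite big_geq//; exact: cvg_cst.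
  rewrite big_nat_recr//=; under eq_fun do rewrite big_nat_recr//=.
  exact: cvgD.
move/cvgrPdist_le : abm => /(_ _ e3) abm.
have Lm : \forall N \near \oo, (m <= L N)%N.
  by apply: (Loo [set n | (m <= n)%N]); exists m.
near=> N.
have aCN : forall l, `|a N l| <= C * q ^+ l by near: N.
have LN : (m <= L N)%N by near: N.
have h1 : `|\sum_(0 <= l < m) b l - \sum_(0 <= l < m) a N l| <= e / 3 by near: N.
have h2 := le_trans (geometric_tail_bound aCN LN) mt.
move: sm h1 h2; rewrite !ler_norml => /andP[? ?] /andP[? ?] /andP[? ?].
by apply/andP; split; lra.
Unshelve. all: by end_near. Qed.

End geometric_domination.
End geometric_sums.

(** * Limits of series of random variables *)

Section series_of_functions.
Context {R : realType}.

(** Convergence is not assumed: an infinite right-hand side bounds even the default value of [limn],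
    and a finite one forces absolute convergence, so that [limn] is then the true limit. *)
Lemma limn_series_bound (u : nat -> R) L :
  (`|limn (fun n => \sum_(0 <= l < n) u l) - \sum_(0 <= l < L) u l|%:E <=
   \sum_(k <oo) `|u (L + k)%N|%:E)%E.
Proof.
set B := (\sum_(k <oo) _)%E.
have u0 k : (0 <= `|u (L + k)%N|%:E)%E by rewrite lee_fin.
have [Binf|Bfin] := eqVneq B +oo%E; first by rewrite Binf leey.
have B0 : (0 <= B)%E by apply: nneseries_ge0.
have Bf : B \is a fin_num by rewrite ge0_fin_numE// ltey.
have part n : \sum_(0 <= k < n) `|u (L + k)%N| <= fine B.
  rewrite -lee_fin fineK// -sumEFin.
  exact: nneseries_lim_ge.
have part2 n : \sum_(L <= l < L + n) `|u l| <= fine B.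
  apply: le_trans (part n); rewrite -{1}[L]add0n big_addn addKn le_eqVlt.
  by apply/orP; left; apply/eqP; apply: eq_bigr => i _; rewrite addnC.
have cu : cvgn (fun n => \sum_(0 <= l < n) u l).
  suff cn : cvgn (series (fun l => `|u l|)) by exact: (normed_cvg cn).
  apply: nondecreasing_is_cvgn.
    by apply/nondecreasing_seqP => n; rewrite seriesSr lerDl.
  exists (\sum_(0 <= l < L) `|u l| + fine B) => _ [n _ <-]; rewrite seriesEnat/=.
  have [nL|Ln] := leqP n L.
    rewrite (@le_trans _ _ (\sum_(0 <= l < L) `|u l|))// ?lerDl ?fine_ge0//.
    by rewrite (big_cat_nat (n := n) (p := L))//= lerDl sumr_ge0.
  by rewrite (big_cat_nat (n := L) (p := n))//= ?lerD2l ?(ltnW Ln)// -(subnKC (ltnW Ln)).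
rewrite -(fineK Bf) lee_fin.
apply: (cvgr_to_le (cvg_norm (cvgB cu (@cvg_cst _ _ _ _ _)))).
near=> n; have Ln : (L <= n)%N by near: n; exists L.
rewrite -[X in X <= _]/(`|\sum_(0 <= l < n) u l - \sum_(0 <= l < L) u l|).
rewrite sum_nat_diff// (le_trans (ler_norm_sum _ _ _))//.
by rewrite -(subnKC Ln).
Unshelve. all: by end_near. Qed.

Context d (T : measurableType d).

(** The Cauchy criterion, with tolerances [1 / (k + 1)], describes the convergence set by countable
    operations. On it the limit is measurable; off it [limn] is the constant default [point]. *)
Lemma measurable_limn (f : nat -> T -> R) : (forall n, measurable_fun setT (f n)) ->
  measurable_fun setT (fun w => limn (fun n => f n w)).
Proof.
move=> mf.
pose C := \bigcap_(k in [set: nat]) \bigcup_(m in [set: nat])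
  \bigcap_(n in [set: nat]) [set w | `|f (m + n)%N w - f m w| <= k.+1%:R^-1].
have mC : measurable C.
  apply: bigcap_measurable => [|k _]; first by exists 0%N.
  apply: bigcup_measurable => m _.
  apply: bigcap_measurable => [|n _]; first by exists 0%N.
  have mg : measurable_fun setT (fun w => `|f (m + n)%N w - f m w|).
    by apply: measurableT_comp => //; exact: measurable_funB.
  have := mg measurableT `]-oo, k.+1%:R^-1]%classic (measurable_itv _).
  by rewrite setTI; congr measurable; apply/seteqP; split => w /=; rewrite in_itv.
have CP w : C w <-> cvgn (fun n => f n w).
  split=> [Cw|/cvg_ex[l fl] k _].
    apply/cauchy_cvgP/cauchy_exP => e e0.
    have [k] := ltr_add_invr e0; rewrite add0r => ke.
    have [m _ Hm] := Cw k I; exists (f m w), m => // n /= mn.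
    have := Hm (n - m)%N I; rewrite /= subnKC// => h.
    by rewrite /ball/= distrC (le_lt_trans h).
  have e0 : 0 < (k.+1%:R^-1 : R) / 2 by rewrite divr_gt0// invr_gt0.
  have /cvgrPdist_le/(_ _ e0)[m _ Hm] := fl.
  exists m => // n _ /=.
  have h1 := Hm m (leqnn m); have h2 := Hm (m + n)%N (leq_addr _ _).
  have key (t a b c : R) : `|c - a| <= t / 2 -> `|c - b| <= t / 2 -> `|b - a| <= t.
    rewrite !ler_norml => /andP[? ?] /andP[? ?].
    by apply/andP; split; lra.
  exact: (key _ _ _ _ h1 h2).
rewrite -(setUv C); apply/measurable_funU => //; first exact: measurableC.
split.
  apply: (@measurable_fun_cvg _ _ _ C f) => [n|w /CP//].
  exact: measurable_funTS.
apply: (@eq_measurable_fun _ _ _ _ _ (cst point)) => [w|]; last first.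
  exact: measurable_cst.
rewrite inE /= => nC; apply/esym/dvgP => /CP; exact: nC.
Qed.

Lemma integral_limn_series_bound (P : probability T R) (u : nat -> T -> R) L
    (e : nat -> R) (B : R) :
  (forall k, measurable_fun setT (u (L + k)%N)) ->
  (forall k, (\int[P]_w `|u (L + k)%N w|%:E <= (e k)%:E)%E) ->
  (forall n, \sum_(0 <= k < n) e k <= B) ->
  (forall n, measurable_fun setT (fun w => \sum_(0 <= l < n) u l w)) ->
  (\int[P]_w `|limn (fun n => \sum_(0 <= l < n) u l w) -
     \sum_(0 <= l < L) u l w|%:E <= B%:E)%E.
Proof.
move=> mu ue eB ms.
have mnu k : measurable_fun setT (fun w => `|u (L + k)%N w|%:E).
  by apply/measurable_EFinP; exact: measurableT_comp.
apply: (@le_trans _ _ (\int[P]_w (\sum_(k <oo) `|u (L + k)%N w|%:E))%E).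
  apply: ge0_le_integral => //.
  - apply/measurable_EFinP; apply: measurableT_comp => //.
    by apply: measurable_funB => //; exact: measurable_limn.
  - by apply: ge0_emeasurable_sum => // k w _ _; rewrite lee_fin.
  - by move=> w _; exact: limn_series_bound.
rewrite integral_nneseries//.
apply: (@le_trans _ _ (\sum_(k <oo) (e k)%:E)%E).
  apply: lee_nneseries => [k _ _|k _]; last exact: ue.
  by apply: integral_ge0 => w _; rewrite lee_fin.
have e0 k : (0 <= (e k)%:E)%E.
  by apply: le_trans (ue k); apply: integral_ge0 => w _; rewrite lee_fin.
apply: lime_le; first exact: is_cvg_nneseries.
by apply: nearW => n; rewrite sumEFin lee_fin.
Qed.

End series_of_functions.

(** * Independence across samples *)

(** Classical decidable equality, so that samples can be listed and tested with [uniq], [index] and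
    membership. *)
HB.instance Definition _ := gen_eqMixin idx.

Section same_law_transfer.
Context {R : realType} d d0 (T : measurableType d) (T0 : measurableType d0).
Variables (P : probability T R) (P0 : probability T0 R) (X : T -> R) (Y : T0 -> R).
Hypotheses (mX : measurable_fun setT X) (mY : measurable_fun setT Y).
Hypothesis XY : same_law P X P0 Y.

Lemma same_law_ge0_integral (phi : R -> \bar R) : measurable_fun setT phi ->
  (forall x, 0 <= phi x)%E ->
  (\int[P]_w phi (X w) = \int[P0]_w phi (Y w))%E.
Proof.
move=> mphi phi0.
have e1 := ge0_integral_pushforward mX P measurableT mphi (fun y _ => phi0 y).
have e2 := ge0_integral_pushforward mY P0 measurableT mphi (fun y _ => phi0 y).
rewrite preimage_setT in e1; rewrite preimage_setT in e2.
apply: etrans (esym e1) _; apply: etrans e2.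
by apply: eq_measure_integral => A mA _; exact: XY.
Qed.

Lemma same_law_integrable (phi : R -> R) : measurable_fun setT phi ->
  P0.-integrable setT (EFin \o (fun w => phi (Y w))) ->
  P.-integrable setT (EFin \o (fun w => phi (X w))).
Proof.
move=> mphi /integrableP[_ phioo]; apply/integrableP; split.
  by apply/measurable_EFinP; exact: (measurableT_comp mphi).
have := @same_law_ge0_integral (fun x => `|phi x|%:E).
move=> /(_ _ (fun x => normr_ge0 _)) h; rewrite [X in (X < _)%E]h//.
by apply/measurable_EFinP; exact: measurableT_comp.
Qed.

Lemma same_law_Rintegral (phi : R -> R) : measurable_fun setT phi ->
  P0.-integrable setT (EFin \o (fun w => phi (Y w))) ->
  \int[P]_w phi (X w) = \int[P0]_w phi (Y w).
Proof.
move=> mphi iY; have iX := same_law_integrable mphi iY.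
have mEphi : measurable_fun setT (EFin \o phi) by exact/measurable_EFinP.
have e1 := integral_pushforward mX mEphi iX measurableT.
have e2 := integral_pushforward mY mEphi iY measurableT.
rewrite preimage_setT in e1; rewrite preimage_setT in e2.
congr fine; apply: etrans (esym e1) _; apply: etrans e2.
by apply: eq_measure_integral => A mA _; exact: XY.
Qed.

End same_law_transfer.

Section centred_variable.
Context {R : realType} d0 (T0 : measurableType d0) (P0 : probability T0 R).
Variables (Y : T0 -> R) (m : R).
Hypotheses (mY : measurable_fun setT Y) (EY : ('E_P0[Y] = m%:E)%E).
Hypothesis (Y2 : (\int[P0]_w (Y w ^+ 2)%:E < +oo)%E).

Let iY2 : P0.-integrable setT (EFin \o (fun w => Y w ^+ 2)).
Proof.
apply/integrableP; split; first by apply/measurable_EFinP; exact: measurable_funX.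
by under eq_integral do rewrite /= ger0_norm ?sqr_ge0//.
Qed.

Let iY : P0.-integrable setT (EFin \o Y).
Proof. exact: square_integrable_integrable. Qed.

Let REY : \int[P0]_w Y w = m.
Proof. by have := EY; rewrite unlock /Rintegral => ->. Qed.

Lemma variance_centred : ('V_P0[Y] = \int[P0]_w ((Y w - m) ^+ 2)%:E)%E.
Proof.
rewrite /variance unlock EY/= unlock; apply: eq_integral => w _.
by rewrite expr2.
Qed.

Let iL : P0.-integrable setT (EFin \o (fun w => 2 * m * Y w)).
Proof. exact: (integrableZl measurableT (2 * m) iY). Qed.

Let iLm : P0.-integrable setT (EFin \o (fun w => 2 * m * Y w - m ^+ 2)).
Proof. exact: (integrableB measurableT iL (integrable_const P0 (m ^+ 2))). Qed.

Let sqE w : (Y w - m) ^+ 2 = Y w ^+ 2 - (2 * m * Y w - m ^+ 2).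
Proof. by ring. Qed.

Lemma centred_square_integrable :
  P0.-integrable setT (EFin \o (fun w => (Y w - m) ^+ 2)).
Proof.
rewrite (_ : (fun w => _) = (fun w => Y w ^+ 2 - (2 * m * Y w - m ^+ 2))).
  exact: (integrableB measurableT iY2 iLm).
by apply/funext => w; exact: sqE.
Qed.

Lemma centred_mean : \int[P0]_w (Y w - m) = 0.
Proof.
rewrite (RintegralB measurableT iY (integrable_const P0 m)).
by rewrite REY (Rintegral_const P0) subrr.
Qed.

Lemma centred_variance : \int[P0]_w (Y w - m) ^+ 2 = fine ('V_P0[Y])%E.
Proof. by rewrite variance_centred. Qed.

Lemma fine_variance_ge0 : 0 <= fine ('V_P0[Y])%E.
Proof. by rewrite fine_ge0// variance_ge0. Qed.

Lemma fine_variance_le B : (\int[P0]_w (Y w ^+ 2)%:E <= B%:E)%E ->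
  fine ('V_P0[Y])%E <= B.
Proof.
move=> YB; rewrite -centred_variance.
have -> : \int[P0]_w (Y w - m) ^+ 2 = \int[P0]_w Y w ^+ 2 - m ^+ 2.
  transitivity (\int[P0]_w (Y w ^+ 2 - (2 * m * Y w - m ^+ 2))).
    by apply: eq_Rintegral => w _; exact: sqE.
  rewrite (RintegralB measurableT iY2 iLm).
  rewrite (RintegralB measurableT iL (integrable_const P0 (m ^+ 2))).
  by rewrite RintegralZl// REY (Rintegral_const P0); ring.
rewrite lerBlDr (@le_trans _ _ B)// ?lerDl ?sqr_ge0//.
by rewrite -lee_fin (EFin_Rintegral iY2).
Qed.

(** The Cauchy-Schwarz bound, got by integrating [|y| <= y ^+ 2 / (2 * t) + t / 2], which is a
    square being nonnegative. *)
Lemma mean_norm_le t : 0 < t -> (\int[P0]_w (Y w ^+ 2)%:E <= (t ^+ 2)%:E)%E ->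
  (\int[P0]_w `|Y w|%:E <= t%:E)%E.
Proof.
move=> t0 Yt.
have mn : measurable_fun setT (fun w => `|Y w|%:E).
  by apply/measurable_EFinP; exact: measurableT_comp.
have m2 : measurable_fun setT (fun w => (Y w ^+ 2)%:E).
  by apply/measurable_EFinP; exact: measurable_funX.
have t2 : 0 <= (2 * t)^-1 by rewrite invr_ge0 mulr_ge0// ltW.
apply: (@le_trans _ _ (\int[P0]_w (((2 * t)^-1)%:E * (Y w ^+ 2)%:E + (t / 2)%:E)))%E.
  apply: ge0_le_integral => //.
  - by apply: emeasurable_funD => //; exact: measurable_funeM.
  - move=> w _; rewrite -EFinM -EFinD lee_fin.
    rewrite -subr_ge0 (_ : _ - _ = (2 * t)^-1 * (`|Y w| - t) ^+ 2).
      by rewrite mulr_ge0// sqr_ge0.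
    by rewrite -(real_normK (num_real (Y w))); field; rewrite gt_eqF.
rewrite ge0_integralD//; last 3 first.
- by move=> w _; rewrite -EFinM lee_fin mulr_ge0// sqr_ge0.
- exact: measurable_funeM.
- by move=> w _; rewrite lee_fin divr_ge0// ltW.
rewrite ge0_integralZl_EFin//; last by move=> w _; rewrite lee_fin sqr_ge0.
rewrite integral_cst//.
rewrite [X in (_ + _ * X)%E](_ : _ = 1%E) ?mule1; last exact: probability_setT.
apply: (@le_trans _ _ (((2 * t)^-1)%:E * (t ^+ 2)%:E + (t / 2)%:E))%E.
  by rewrite leeD2r// lee_wpmul2l.
by rewrite -EFinM -EFinD lee_fin le_eqVlt; apply/orP; left; apply/eqP; field; rewrite gt_eqF.
Qed.

End centred_variable.

Lemma cvg_inv_sqrt {R : realType} :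
  (fun N : nat => (Num.sqrt (N%:R : R))^-1) @ \oo --> (0 : R).
Proof.
apply/cvgrPdist_le => e e0; near=> N.
have N0 : e ^- 2 <= N%:R by near: N; exact: nbhs_infty_ger.
have s0 : e^-1 <= Num.sqrt N%:R.
  rewrite -(@ler_pXn2r _ 2) ?nnegrE ?invr_ge0 ?sqrtr_ge0 ?(ltW e0)//.
  by rewrite sqr_sqrtr// exprVn.
rewrite sub0r normrN ger0_norm ?invr_ge0// -[leRHS]invrK.
by rewrite lef_pV2 ?posrE ?invr_gt0// (lt_le_trans _ s0)// invr_gt0.
Unshelve. all: by end_near. Qed.

(** * Replacement cost of one level *)

Section lindeberg_terms.
Context {R : realType} d0 (T0 : measurableType d0) (P0 : probability T0 R).
Variables (Z : T0 -> R) (V : R).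
Hypotheses (mZ : measurable_fun setT Z).
Hypotheses (iZ2 : P0.-integrable setT (EFin \o (fun w => Z w ^+ 2))).
Hypotheses (EZ2 : \int[P0]_w Z w ^+ 2 = V).

Let V0 : 0 <= V.
Proof. by rewrite -EZ2; apply: Rintegral_ge0 => w _; exact: sqr_ge0. Qed.

(** Cost of trading [n] summands distributed as [a * Z] for Gaussians of the same variance. *)
Definition lind_term (n : nat) (a : R) :=
  n%:R * (\int[P0]_w rho (a * Z w) + \int[gaussian (a ^+ 2 * V)]_z rho z).

Let aV0 a : 0 <= a ^+ 2 * V.
Proof. by rewrite mulr_ge0// sqr_ge0. Qed.

Let iaZ a : P0.-integrable setT (EFin \o (fun w => rho (a * Z w))).
Proof.
apply: rho_integrable; first exact: measurable_funM.
rewrite (_ : (fun w => _) = (fun w => a ^+ 2 * Z w ^+ 2)).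
  exact: (integrableZl measurableT (a ^+ 2) iZ2).
by apply/funext => w; rewrite exprMn.
Qed.

(** What [n * rho (a * Z)] becomes after the scaling is taken out: below [c^-1] times this, with [t]
    of order [1 / sqrt N]. It is dominated by [Z ^+ 2] and tends to 0 with [t]. *)
Let truncated t w := Num.min (Z w ^+ 2) (t * `|Z w| ^+ 3).

Let truncated_ge0 t w : 0 <= t -> 0 <= truncated t w.
Proof. by move=> t0; rewrite le_min sqr_ge0 mulr_ge0// exprn_ge0. Qed.

Let mtruncated t : measurable_fun setT (truncated t).
Proof.
apply: measurable_minr; first exact: measurable_funX.
apply: measurable_funM => //; apply: measurable_funX; exact: measurableT_comp.
Qed.

Let itruncated t : 0 <= t -> P0.-integrable setT (EFin \o truncated t).
Proof.
move=> t0; apply: (le_integrable measurableT _ _ iZ2); first exact/measurable_EFinP.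
move=> w _; rewrite /= lee_fin (ger0_norm (truncated_ge0 _ t0)) ger0_norm ?sqr_ge0//.
by rewrite ge_min lexx.
Qed.

Section at_scale.
Variables (n N : nat) (c : R).
Hypotheses (c0 : 0 < c) (N0 : (0 < N)%N) (cn : c * N%:R <= n%:R).

Let Nr : 0 < N%:R :> R. Proof. by rewrite ltr0n. Qed.
Let cN0 : 0 < c * N%:R. Proof. exact: mulr_gt0. Qed.
Let n0 : 0 < n%:R :> R. Proof. exact: lt_le_trans cN0 cn. Qed.
Let sN0 : 0 < Num.sqrt N%:R :> R. Proof. by rewrite sqrtr_gt0. Qed.
Let a := Num.sqrt N%:R / n%:R : R.
Let t := c^-1 * (Num.sqrt N%:R)^-1 : R.

Let a0 : 0 <= a. Proof. by rewrite divr_ge0. Qed.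
Let t0 : 0 <= t. Proof. by rewrite mulr_ge0// invr_ge0// ltW. Qed.

Lemma scale_square : n%:R * a ^+ 2 <= c^-1.
Proof.
rewrite /a expr_div_n sqr_sqrtr// (_ : n%:R * _ = N%:R / n%:R); last first.
  by field; rewrite gt_eqF.
by rewrite ler_pdivrMr// mulrC ler_pdivlMr// mulrC.
Qed.

Let a_le : a <= t.
Proof.
rewrite /a /t ler_pdivrMr// -ler_pdivrMl; last by rewrite mulr_gt0// invr_gt0.
rewrite invfM !invrK -mulrA -expr2 sqr_sqrtr//.
Qed.

Let scale_cube : n%:R * a ^+ 3 <= c^-1 * t.
Proof.
rewrite exprSr mulrA; apply: ler_pM => //; last exact: scale_square.
by rewrite mulr_ge0// sqr_ge0.
Qed.

Let lind_law_le : n%:R * \int[P0]_w rho (a * Z w) <= c^-1 * \int[P0]_w truncated t w.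
Proof.
rewrite -!RintegralZl//; [|exact: itruncated..].
apply: le_Rintegral => //.
- exact: (integrableZl measurableT n%:R (iaZ a)).
- exact: (integrableZl measurableT c^-1 (itruncated t0)).
move=> w _; rewrite /truncated minEle; case: ifP => _.
  apply: (@le_trans _ _ (n%:R * (a * Z w) ^+ 2)); first by rewrite ler_wpM2l ?rho_le2.
  by rewrite exprMn mulrA ler_wpM2r ?sqr_ge0// scale_square.
apply: (@le_trans _ _ (n%:R * `|a * Z w| ^+ 3)); first by rewrite ler_wpM2l ?rho_le3.
by rewrite normrM (ger0_norm a0) exprMn [leLHS]mulrA [leRHS]mulrA ler_wpM2r ?exprn_ge0.
Qed.

Let lind_gauss_le : n%:R * \int[gaussian (a ^+ 2 * V)]_z rho z <=
  c^-1 * (72 * t * Num.sqrt V ^+ 3).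
Proof.
apply: (@le_trans _ _ (n%:R * (72 * Num.sqrt (a ^+ 2 * V) ^+ 3))).
  by rewrite ler_wpM2l// gaussian_rho_le3.
rewrite sqrtrM ?sqr_ge0// sqrtr_sqr (ger0_norm a0) exprMn.
rewrite (_ : n%:R * _ = (n%:R * a ^+ 3) * (72 * Num.sqrt V ^+ 3)); last by ring.
rewrite (_ : c^-1 * _ = (c^-1 * t) * (72 * Num.sqrt V ^+ 3)); last by ring.
by rewrite ler_wpM2r// mulr_ge0// exprn_ge0.
Qed.

Lemma lind_term_ge0 : 0 <= lind_term n a.
Proof.
rewrite mulr_ge0// addr_ge0//; apply: Rintegral_ge0 => w _; exact: rho_ge0.
Qed.

(** The law and the Gaussian contribute at most [V / c] each. The bound does not depend on [N], so
    it can serve as majorant over the levels. *)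
Lemma lind_term_le : lind_term n a <= 2 * (V / c).
Proof.
rewrite /lind_term mulrDr mulr2n mulrDl mul1r; apply: lerD.
  apply: (le_trans lind_law_le); rewrite mulrC ler_wpM2r ?invr_ge0 ?(ltW c0)//.
  rewrite -EZ2; apply: le_Rintegral => //; first exact: itruncated.
  by move=> w _; rewrite ge_min lexx.
apply: (@le_trans _ _ (n%:R * (a ^+ 2 * V))).
  by rewrite ler_wpM2l// gaussian_rho_le2.
by rewrite mulrA mulrC ler_wpM2l// scale_square.
Qed.

Lemma lind_term_le_truncated : lind_term n a <=
  c^-1 * (\int[P0]_w truncated t w) + c^-1 * (72 * t * Num.sqrt V ^+ 3).
Proof. by rewrite /lind_term mulrDr; exact: lerD. Qed.

End at_scale.

Let cvg_truncated (t : nat -> R) : (forall N, 0 <= t N) -> t @ \oo --> 0 ->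
  (fun N => \int[P0]_w truncated (t N) w) @ \oo --> 0.
Proof.
move=> t0 tc.
have [] := @dominated_convergence _ _ _ P0 setT measurableT
  (fun N w => (truncated (t N) w)%:E) (cst 0%E) (fun w => (Z w ^+ 2)%:E).
- by move=> N; apply/measurable_EFinP.
- exact: measurable_cst.
- apply: aeW => w _ /=.
  have tw : (fun N => truncated (t N) w) @ \oo --> 0.
    have H : \forall N \near \oo, 0 <= truncated (t N) w <= t N * `|Z w| ^+ 3.
      by apply: nearW => N; rewrite truncated_ge0//= ge_min lexx orbT.
    apply: (squeeze_cvgr H); first exact: cvg_cst.
    rewrite -(mul0r (`|Z w| ^+ 3)); apply: cvgM => //; exact: cvg_cst.
  by apply: cvg_EFin; [exact: nearW|exact: tw].
- exact: iZ2.
- apply: aeW => w N _ /=; rewrite lee_fin ger0_norm ?truncated_ge0//.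
  by rewrite ge_min lexx.
move=> _ _; rewrite integral0 => /fine_cvgP[_].
exact.
Qed.

(** Dominated convergence on the truncated square handles the law of [Z] with a second moment only;
    the Gaussian part is cubic and decays explicitly, like [1 / sqrt N]. *)
Lemma cvg_lind_term (n : nat -> nat) (c : R) : 0 < c ->
  (forall N, (0 < N)%N -> c * N%:R <= (n N)%:R) ->
  (fun N => lind_term (n N) (Num.sqrt N%:R / (n N)%:R)) @ \oo --> 0.
Proof.
move=> c0 cn.
pose t (N : nat) : R := c^-1 * (Num.sqrt N%:R)^-1.
have tc : t @ \oo --> 0.
  by rewrite -(mulr0 c^-1); apply: cvgM; [exact: cvg_cst|exact: cvg_inv_sqrt].
have t0 N : 0 <= t N by rewrite mulr_ge0// invr_ge0// ltW.
have H : \forall N \near \oo, 0 <= lind_term (n N) (Num.sqrt N%:R / (n N)%:R) <=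
    c^-1 * (\int[P0]_w truncated (t N) w) + c^-1 * (72 * t N * Num.sqrt V ^+ 3).
  near=> N; have N0 : (0 < N)%N by near: N; exists 1%N.
  apply/andP; split; first exact: lind_term_ge0.
  exact: lind_term_le_truncated (cn N N0).
apply: (squeeze_cvgr H); first exact: cvg_cst.
rewrite -[X in _ --> X](_ : c^-1 * 0 + c^-1 * (72 * 0 * Num.sqrt V ^+ 3) = 0).
  apply: cvgD; apply: cvgM; try exact: cvg_cst; first exact: cvg_truncated.
  by apply: cvgM; [apply: cvgM => //; exact: cvg_cst|exact: cvg_cst].
by rewrite !(mulr0, mul0r) addr0.
Unshelve. all: by end_near. Qed.

End lindeberg_terms.

Section independence_of_lists.
Context {R : realType} d (T : measurableType d) (P : probability T R).
Context (I : eqType) (X : I -> T -> R).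

(** Restates independence over numbered blocks for lists of indices: each element of [s] is a block
    of its own, and the whole of [s'] lies in the common block. *)
Lemma indep_and_of_list (A Bs : set I) (x0 : I) (s s' : seq I) (B : I -> set R) :
  indep_and_of P X A Bs -> uniq s ->
  (forall x, x \in s -> A x) -> (forall x, x \in s' -> Bs x) ->
  (forall i, measurable (B i)) ->
  P (\big[setI/setT]_(x <- s) (X x @^-1` B x) `&`
     \big[setI/setT]_(x <- s') (X x @^-1` B x)) =
  (\prod_(x <- s) P (X x @^-1` B x) *
   P (\big[setI/setT]_(x <- s') (X x @^-1` B x)))%E.
Proof.
move=> ind us sA s'B mB.
pose ks (a : 'I_(size s).+1) : option I :=
  if unlift ord0 a is Some b then Some (nth x0 s b) else None.
(* A singleton block outside [A] is empty, so it must be given no variable; inside [A] it gets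
   exactly one. *)
pose n (k : option I) : nat :=
  if k is Some i then nat_of_bool `[< A i >] else size s'.
pose F (k : option I) : 'I_(n k) -> I :=
  match k return 'I_(n k) -> I with
  | Some i => fun=> i | None => fun j => nth x0 s' j end.
have iks : injective ks.
  move=> a b; rewrite /ks; case: unliftP => [a' ->|->]; case: unliftP => [b' ->|->]//.
  move=> [/eqP]; rewrite nth_uniq// => /eqP ab.
  by congr lift; exact: val_inj.
have FB k j : match k with Some i => [set j | j = i /\ A i] | None => Bs end (F k j).
  case: k j => [i|] j /=; last by apply: s'B; rewrite mem_nth.
  by split => //; move: j; rewrite /n; case: asboolP => // _ [].
have := ind _ ks n F B iks FB mB.
rewrite /= big_ord_recl/= [in RHS]big_ord_recl/=.
have ks0 : ks ord0 = None by rewrite /ks unlift_none.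
have ksS a : ks (lift ord0 a) = Some (nth x0 s a) by rewrite /ks liftK.
have EN : \big[setI/setT]_(j < n (ks ord0)) (X (F (ks ord0) j) @^-1` B (F (ks ord0) j)) =
    \big[setI/setT]_(x <- s') (X x @^-1` B x).
  by rewrite ks0 /= [RHS](big_nth x0) big_mkord.
have ES (a : 'I_(size s)) : \big[setI/setT]_(j < n (ks (lift ord0 a)))
    (X (F (ks (lift ord0 a)) j) @^-1` B (F (ks (lift ord0 a)) j)) =
    X (nth x0 s a) @^-1` B (nth x0 s a).
  rewrite ksS /=; have -> : `[< A (nth x0 s a) >] = true.
    by apply/asboolP; apply: sA; rewrite mem_nth.
  by rewrite big_ord1.
move=> H.
have SE : \big[setI/setT]_(x <- s) (X x @^-1` B x) = \big[setI/setT]_(a < size s)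
    \big[setI/setT]_(j < n (ks (lift ord0 a)))
      (X (F (ks (lift ord0 a)) j) @^-1` B (F (ks (lift ord0 a)) j)).
  by rewrite (big_nth x0) big_mkord; apply: eq_bigr => a _; rewrite ES.
have PE : (\prod_(x <- s) P (X x @^-1` B x) = \prod_(a < size s)
    P (\big[setI/setT]_(j < n (ks (lift ord0 a)))
      (X (F (ks (lift ord0 a)) j) @^-1` B (F (ks (lift ord0 a)) j))))%E.
  by rewrite (big_nth x0) big_mkord; apply: eq_bigr => a _; rewrite ES.
by rewrite SE PE -EN setIC muleC.
Qed.

(** Two independence statements are chained: the first separates the elements of [s] from each other
    and from [s'], the second separates the elements of [s']. It is meant for the copies of [D0]
    followed by the samples of the low levels. *)
Lemma indep_seq_of_lists (A Bs A' Bs' : set I) (x0 : I) (s s' : seq I)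
    (phi : I -> R -> R) :
  indep_and_of P X A Bs -> indep_and_of P X A' Bs' -> uniq (s ++ s') ->
  (forall x, x \in s -> A x) -> (forall x, x \in s' -> Bs x) ->
  (forall x, x \in s' -> A' x) -> (forall i, measurable_fun setT (phi i)) ->
  indep_seq P (size (s ++ s'))
    (fun j w => phi (nth x0 (s ++ s') j) (X (nth x0 (s ++ s') j) w)).
Proof.
move=> ind ind' us sA s'B s'A mphi B mB.
(* The sets are given by position but independence is stated by index; [index] recovers the position
   because the list has no repetition. *)
pose C x := phi x @^-1` B (index x (s ++ s')).
have mC x : measurable (C x) by rewrite /C -[_ @^-1` _]setTI; exact: mphi.
pose G x := X x @^-1` C x.
have GE j : (0 <= j < size (s ++ s'))%N ->
    (fun w => phi (nth x0 (s ++ s') j) (X (nth x0 (s ++ s') j) w)) @^-1` B j =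
    G (nth x0 (s ++ s') j).
  by move=> /= js; rewrite /G /C index_uniq.
rewrite (eq_big_nat _ _ (F2 := fun j => G (nth x0 (s ++ s') j))) => [|j js]; last exact: GE.
rewrite [RHS](eq_big_nat _ _ (F2 := fun j => P (G (nth x0 (s ++ s') j)))) => [|j js]; last first.
  by rewrite GE.
rewrite -(big_nth x0 xpredT G) -(big_nth x0 xpredT (fun x => P (G x))) !big_cat/=.
move: us; rewrite cat_uniq => /and3P[us _ us'].
rewrite (indep_and_of_list x0 ind us sA s'B mC); congr (_ * _)%E.
have := @indep_and_of_list A' Bs' x0 s' [::] C ind' us' s'A.
rewrite !big_nil setIT probability_setT mule1; apply => //.
Qed.

End independence_of_lists.

(** * The multilevel estimators *)

Section nat_ceil_facts.
Context {R : realType}.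
Implicit Type x : R.

Lemma nat_ceilE x : 0 < x -> (nat_ceil x)%:R = (Num.ceil x)%:~R :> R.
Proof.
move=> x0; have c0 : 0 <= Num.ceil x by rewrite ceil_ge0 (lt_trans _ x0)// ltrN10.
by rewrite /nat_ceil -[in RHS](gez0_abs c0).
Qed.

Lemma nat_ceil_ge x : 0 < x -> x <= (nat_ceil x)%:R.
Proof. by move=> x0; rewrite nat_ceilE// ceil_ge. Qed.

Lemma nat_ceil_lt x : 0 < x -> (nat_ceil x)%:R < x + 1.
Proof. by move=> x0; rewrite nat_ceilE//; have := ceilB1_lt x; rewrite rmorphB/=; lra. Qed.

Lemma nat_ceil_gt0 x : 0 < x -> (0 < nat_ceil x)%N.
Proof. by move=> x0; rewrite -(ltr0n R) (lt_le_trans x0)// nat_ceil_ge. Qed.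

Lemma nat_ceil_le1 x : 0 < x -> x <= 1 -> nat_ceil x = 1%N.
Proof.
move=> x0 x1; apply/eqP; rewrite eqn_leq nat_ceil_gt0// andbT.
by rewrite -ltnS -(ltr_nat R) (lt_le_trans (nat_ceil_lt x0))//; lra.
Qed.

End nat_ceil_facts.

Section multilevel.
Context {R : realType}.
Variables (mu : R) (mut : nat -> R) (Hmut : mut @ \oo --> mu).
Variables (d0 : measure_display) (T0 : measurableType d0) (P0 : probability T0 R).
Variables (D0 : T0 -> R) (Dl : nat -> T0 -> R).
Variables (VD phiD phiN cl cu : R) (c : nat -> R).
Hypotheses (HD0m : measurable_fun setT D0)
  (HD0E : ('E_P0[D0] = (mut 0%N)%:E)%E)
  (HD0V : (\int[P0]_w ((D0 w) ^+ 2)%:E < +oo)%E)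
  (HDlm : forall l, measurable_fun setT (Dl l))
  (HDlE : forall l, ('E_P0[Dl l] = (mut l.+1 - mut l)%:E)%E)
  (HDl2 : forall l, (\int[P0]_w ((Dl l w) ^+ 2)%:E <= (VD * phiD ^- l)%:E)%E)
  (HVD : 0 < VD) (HphiD : 2 < phiD)
  (Hcpos : forall l, 0 < c l) (Hcdec : forall l, c l.+1 <= c l)
  (Hclu : 0 < cl /\ cl <= cu)
  (HA2 : forall l, cl * phiN ^- l <= c l /\ c l <= cu * phiN ^- l)
  (HphiN : 2 < phiN) (HphiND : phiN < phiD).
Variables (L : nat -> nat) (HL : forall N, is_LN c N (L N)).

Let phiD0 : 0 < phiD. Proof. by rewrite (lt_trans _ HphiD). Qed.
Let phiN0 : 0 < phiN. Proof. by rewrite (lt_trans _ HphiN). Qed.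
Let cl0 : 0 < cl. Proof. by case: Hclu. Qed.

Let q := phiN / phiD.
Let q0 : 0 <= q. Proof. by rewrite divr_ge0// ltW. Qed.
Let q1 : q < 1. Proof. by rewrite ltr_pdivrMr// mul1r. Qed.

Let p := (Num.sqrt phiD)^-1.
Let p0 : 0 < p. Proof. by rewrite invr_gt0 sqrtr_gt0. Qed.
Let p1 : p < 1.
Proof.
rewrite invf_lt1 ?sqrtr_gt0// -[ltLHS]sqrtr1 ltr_sqrt//.
by rewrite (lt_trans _ HphiD)// ltr1n.
Qed.

(** Square root of the bound on the second moment at level [l], hence a bound on the mean absolute
    value there. *)
Let tau l := Num.sqrt VD * p ^+ l.

Let tau_gt0 l : 0 < tau l.
Proof. by rewrite mulr_gt0 ?sqrtr_gt0// exprn_gt0. Qed.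

Let tau_sqr l : tau l ^+ 2 = VD * phiD ^- l.
Proof.
rewrite /tau exprMn sqr_sqrtr ?(ltW HVD)//; congr (_ * _).
by rewrite -exprM mulnC exprM /p exprVn sqr_sqrtr ?(ltW phiD0)// exprVn.
Qed.

Let Dl_lty l : (\int[P0]_w ((Dl l w) ^+ 2)%:E < +oo)%E.
Proof. by rewrite (le_lt_trans (HDl2 l))// ltry. Qed.

Let Dl_norm l : (\int[P0]_w `|Dl l w|%:E <= (tau l)%:E)%E.
Proof. by apply: (mean_norm_le (HDlm l) (tau_gt0 l)); rewrite tau_sqr. Qed.

Let mut_diff l : `|mut l.+1 - mut l| <= tau l.
Proof.
rewrite -lee_fin; apply: le_trans (Dl_norm l).
have -> : (`|mut l.+1 - mut l|%:E = `|\int[P0]_w (Dl l w)%:E|)%E.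
  by have := HDlE l; rewrite unlock => ->.
by apply: le_abse_integral => //; exact/measurable_EFinP.
Qed.

(** Each increment of [mut] is a mean of [Dl], at most [tau] in absolute value, so the bias is
    bounded by a geometric tail. *)
Let tail_mut m : `|mut m - mu| <= Num.sqrt VD * (p ^+ m / (1 - p)).
Proof.
rewrite distrC.
apply: (cvgr_to_le (cvg_norm (cvgB Hmut (@cvg_cst _ _ _ _ _)))).
near=> n; have mn : (m <= n)%N by near: n; exists m.
rewrite -[X in X <= _]/(`|mut n - mut m|).
have := geometric_tail_bound (ltW p0) p1 mut_diff mn.
rewrite !telescope_sumr// opprB addrA addrAC.
by rewrite -[X in `|X| <= _](_ : mut n - mut m = _)//; ring.
Unshelve. all: by end_near. Qed.

Let V0 := fine ('V_P0[D0])%E.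
Let V l := fine ('V_P0[Dl l])%E.

Let V_ge0 l : 0 <= V l. Proof. exact: fine_variance_ge0. Qed.

Let V_div_c l : V l / c l <= VD / cl * q ^+ l.
Proof.
have Vle : V l <= VD * phiD ^- l by exact: (fine_variance_le (HDlm l) (HDlE l) (Dl_lty l)).
have [cl_c _] := HA2 l.
have p' : 0 < cl * phiN ^- l by rewrite mulr_gt0// invr_gt0 exprn_gt0.
apply: (@le_trans _ _ (VD * phiD ^- l / (cl * phiN ^- l))).
  apply: ler_pM => //; first by rewrite invr_ge0 ltW.
  by rewrite lef_pV2 ?posrE.
rewrite le_eqVlt; apply/orP; left; apply/eqP.
rewrite /q expr_div_n invfM invrK.
by rewrite mulrACA; congr (_ * _); rewrite mulrC.
Qed.

Let c_le m n : (m <= n)%N -> c n <= c m.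
Proof.
by move=> /subnKC <-; elim: (n - m)%N => [|k IH]; rewrite ?addn0// addnS (le_trans (Hcdec _)).
Qed.

Let L_infty : L @ \oo --> \oo.
Proof.
move=> A [m _ mA].
have H : \forall N \near \oo, (m <= L N)%N.
  near=> N; rewrite leqNgt; apply/negP => Lm.
  have [cLN _] := HL N.
  have : (c m)^-1 < N%:R by near: N; exact: nbhs_infty_gtr.
  rewrite -[X in X < _]mul1r ltr_pdivrMr// ltNge mulrC (le_trans _ cLN)//.
  by rewrite ler_wpM2r// c_le// ltnW.
by apply: filterS H => N; exact: mA.
Unshelve. all: by end_near. Qed.

Let cN0 N l : (0 < N)%N -> 0 < c l * N%:R.
Proof. by move=> N0; rewrite mulr_gt0// ltr0n. Qed.

Let cN_le1 N l : (L N <= l)%N -> c l * N%:R <= 1.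
Proof.
by move=> Ll; have [cLN _] := HL N; rewrite (le_trans _ cLN)// ler_wpM2r// c_le.
Qed.

(** [c (L N) * N <= 1] and the lower bound on [c] give [N <= phiN ^+ L N / cl]. Multiplying the
    square root by [p ^+ L N] leaves a power of [sqrt (phiN / phiD)], which is below 1. *)
Let sqrtN_p N : Num.sqrt N%:R * p ^+ L N <= (Num.sqrt cl)^-1 * Num.sqrt q ^+ L N.
Proof.
have Ncl : N%:R <= cl^-1 * phiN ^+ L N.
  have [cLN _] := HL N; have [clc _] := HA2 (L N).
  have h : cl * phiN ^- L N * N%:R <= 1 by rewrite (le_trans _ cLN)// ler_wpM2r.
  move: h; rewrite mulrAC ler_pdivrMr ?exprn_gt0// mul1r => h.
  by rewrite mulrC ler_pdivlMr// mulrC.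
apply: (@le_trans _ _ (Num.sqrt (cl^-1 * phiN ^+ L N) * p ^+ L N)).
  by rewrite ler_wpM2r ?exprn_ge0 ?(ltW p0)// ler_wsqrtr.
rewrite sqrtrM ?invr_ge0 ?(ltW cl0)// -sqrtrV ?(ltW cl0)// -mulrA ler_wpM2l//.
rewrite /q sqrtrM ?(ltW phiN0)// sqrtrV ?(ltW phiD0)// exprMn -/p.
have -> : Num.sqrt (phiN ^+ L N) = Num.sqrt phiN ^+ L N.
  elim: (L N) => [|k IH]; first by rewrite !expr0 sqrtr1.
  by rewrite !exprS sqrtrM ?IH// ltW.
by [].
Qed.

Let cvg_sqrtN_p : (fun N => Num.sqrt N%:R * p ^+ L N) @ \oo --> 0.
Proof.
have H : \forall N \near \oo, 0 <= Num.sqrt N%:R * p ^+ L N <=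
    (Num.sqrt cl)^-1 * Num.sqrt q ^+ L N.
  by apply: nearW => N; rewrite sqrtN_p andbT mulr_ge0// exprn_ge0// ltW.
apply: (squeeze_cvgr H); first exact: cvg_cst.
rewrite -(mulr0 (Num.sqrt cl)^-1); apply: cvgM; first exact: cvg_cst.
have sq1 : Num.sqrt q < 1 by rewrite -[ltRHS]sqrtr1 ltr_sqrt.
exact: (cvg_comp _ _ L_infty (cvg_geometric0 (sqrtr_ge0 q) sq1)).
Qed.

Let n N l := nat_ceil (c l * N%:R).

Let n_ge N l : (0 < N)%N -> c l * N%:R <= (n N l)%:R.
Proof. by move=> N0; exact/nat_ceil_ge/cN0. Qed.

Let a N l : R := Num.sqrt N%:R / (n N l)%:R.
Let a0 N : R := Num.sqrt N%:R / N%:R.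

Let VN N := N%:R * (a0 N ^+ 2 * V0) +
  \sum_(0 <= l < L N) (n N l)%:R * (a N l ^+ 2 * V l).

Let Z0 w := D0 w - mut 0%N.
Let Zl l w := Dl l w - (mut l.+1 - mut l).

Let EN N := lind_term P0 Z0 V0 N (a0 N) +
  \sum_(0 <= l < L N) lind_term P0 (Zl l) (V l) (n N l) (a N l).

Let mZ0 : measurable_fun setT Z0. Proof. exact: measurable_funB. Qed.
Let mZl l : measurable_fun setT (Zl l). Proof. exact: measurable_funB. Qed.
Let iZ0 := centred_square_integrable (mut 0%N) HD0m HD0V.
Let iZl l := centred_square_integrable (mut l.+1 - mut l) (HDlm l) (Dl_lty l).
Let EZ0 := centred_variance HD0E.
Let EZl l := centred_variance (HDlE l).

Let cvg_scale l : (fun N => (n N l)%:R * a N l ^+ 2) @ \oo --> (c l)^-1.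
Proof.
apply/cvgrPdist_le => e e0; near=> N.
have N0 : (0 < N)%N by near: N; exists 1%N.
have Nr : 0 < N%:R :> R by rewrite ltr0n.
have n0 : 0 < (n N l)%:R :> R by rewrite ltr0n nat_ceil_gt0// cN0.
have c0 := Hcpos l.
have -> : (n N l)%:R * a N l ^+ 2 = N%:R / (n N l)%:R.
  by rewrite /a expr_div_n sqr_sqrtr//; field; rewrite gt_eqF.
have h1 := n_ge l N0; have h2 : (n N l)%:R < c l * N%:R + 1 by exact/nat_ceil_lt/cN0.
(* With [n] the sample size, the distance is at most [1 / (c l * n)] since rounding up adds less
   than 1, and [n >= c l * N]; hence this threshold. *)
have Ne : (e * c l * c l)^-1 <= N%:R by near: N; exact: nbhs_infty_ger.
have -> : (c l)^-1 - N%:R / (n N l)%:R = ((n N l)%:R - c l * N%:R) / (c l * (n N l)%:R).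
  by field; rewrite !gt_eqF.
rewrite ger0_norm; last by rewrite divr_ge0 ?subr_ge0// mulr_ge0// ltW.
rewrite ler_pdivrMr ?mulr_gt0//; apply: (@le_trans _ _ 1); first lra.
have h3 : 1 <= e * c l * c l * N%:R.
  by rewrite -ler_pdivrMl ?mulr1// !mulr_gt0.
apply: (le_trans h3); rewrite -!mulrA ler_wpM2l ?(ltW e0)// ler_wpM2l ?(ltW c0)//.
Unshelve. all: by end_near. Qed.

Let cvg_VN : VN @ \oo --> sigmaS2 P0 D0 Dl c.
Proof.
rewrite /sigmaS2; apply: cvgD.
  apply: (@cvg_trans _ ((fun=> V0) @ \oo)); last exact: cvg_cst.
  apply: near_eq_cvg; near=> N.
  have N0 : (0 < N)%N by near: N; exists 1%N.
  have Nr : 0 < N%:R :> R by rewrite ltr0n.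
  by rewrite /a0 expr_div_n sqr_sqrtr//; field; rewrite gt_eqF.
apply: (@tannery R (VD / cl) q q0 q1 (fun N l => (n N l)%:R * (a N l ^+ 2 * V l))
  (fun l => fine ('V_P0[Dl l])%E / c l)) => //.
- near=> N; have N0 : (0 < N)%N by near: N; exists 1%N.
  move=> l; apply: le_trans (V_div_c l).
  rewrite mulrA ger0_norm ?mulr_ge0 ?sqr_ge0 ?V_ge0// mulrC ler_wpM2l ?V_ge0//.
  exact: (scale_square (Hcpos l) N0 (n_ge l N0)).
- move=> l; rewrite mulrC; under eq_fun do rewrite mulrA.
  by apply: cvgM; [exact: cvg_scale|exact: cvg_cst].
Unshelve. all: by end_near. Qed.

Let cvg_EN : EN @ \oo --> 0.
Proof.
(* The limit is written as 0 plus a null series to fit [tannery]. *)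
rewrite -[X in _ --> X](_ : 0 + limn (fun n => \sum_(0 <= l < n) (0 : R)) = 0).
  apply: cvgD.
    apply: (cvg_lind_term mZ0 iZ0 EZ0 (n := id) ltr01) => N N0.
    by rewrite mul1r.
  apply: (@tannery R (2 * (VD / cl)) q q0 q1
    (fun N l => lind_term P0 (Zl l) (V l) (n N l) (a N l))) => //.
  - near=> N; have N0 : (0 < N)%N by near: N; exists 1%N.
    move=> l; rewrite ger0_norm; last exact: lind_term_ge0.
    rewrite -mulrA; apply: (@le_trans _ _ (2 * (V l / c l))).
      exact: (lind_term_le (mZl l) (iZl l) (EZl l) (Hcpos l) N0 (n_ge l N0)).
    by rewrite ler_wpM2l// V_div_c.
  - move=> l; apply: (cvg_lind_term (mZl l) (iZl l) (EZl l) (Hcpos l)) => N N0.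
    exact: n_ge.
rewrite add0r (_ : (fun n => _) = cst 0) ?lim_cst//.
by apply/funext => k; rewrite big1.
Unshelve. all: by end_near. Qed.

Variables (d : nat -> measure_display) (T : forall N, measurableType (d N)).
Variables (P : forall N, probability (T N) R).
Unset Implicit Arguments.
Variables (D0s : forall N, nat -> T N -> R) (Ds : forall N, nat -> nat -> T N -> R).
Variable (Ns : forall N, nat -> T N -> nat).
Set Implicit Arguments.
Hypotheses (Hmeas : forall N, (0 < N)%N -> forall i, used_idx c N (L N) i ->
     measurable_fun setT (allvars (D0s N) (Ds N) (Ns N) i))
  (HNdet : forall N, (0 < N)%N -> forall l, (l <= L N)%N ->
     forall w, Ns N l w = nat_ceil (c l * N%:R))
  (HNber : forall N, (0 < N)%N -> forall l, (L N < l)%N ->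
     (forall w, (Ns N l w <= 1)%N) /\
     P N [set w | Ns N l w = 1%N] = (c l * N%:R)%:E)
  (HNind : forall N, (0 < N)%N ->
     indep_and_of (P N) (allvars (D0s N) (Ds N) (Ns N)) (Nrand_idx (L N))
       (used_idx c N (L N) `\` Nrand_idx (L N)))
  (HD0law : forall N, (0 < N)%N -> forall r, (r < N)%N ->
     same_law (P N) (D0s N r) P0 D0)
  (HD0ind : forall N, (0 < N)%N ->
     indep_and_of (P N) (allvars (D0s N) (Ds N) (Ns N)) (D0_idx N)
       (used_idx c N (L N) `\` D0_idx N))
  (HDlaw : forall N, (0 < N)%N -> forall l r,
     (Dlow_idx c N (L N) `|` Dhigh_idx (L N)) (ID l r) ->
     same_law (P N) (Ds N l r) P0 (Dl l))
  (HA4 : forall N, (0 < N)%N ->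
     indep_and_of (P N) (allvars (D0s N) (Ds N) (Ns N))
       (Dlow_idx c N (L N)) (Dhigh_idx (L N))).

(** * The estimators at a fixed [N] *)

Section fixed_N.
Variable N : nat.
Hypothesis N0 : (0 < N)%N.

Let X := allvars (D0s N) (Ds N) (Ns N).
Let s1 := [seq I0 r | r <- iota 0 N].
Let s2 := [seq ID l r | l <- iota 0 (L N), r <- iota 0 (n N l)].
Let coef i := match i with I0 _ => a0 N | ID l _ => a N l | IN _ => 0 end.
Let mean i := match i with
  | I0 _ => mut 0%N | ID l _ => mut l.+1 - mut l | IN _ => 0 end.
Let phi i x := coef i * (x - mean i).

(** Level [L N] is left to the remainder, because its single sample may depend on those of the
    higher levels. The subtracted means telescope to [mut (L N)], not [mu]; the bias goes to the
    remainder too. *)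
Definition main_part w :=
  Num.sqrt N%:R * (S0 N (D0s N) w - mut 0%N +
    \sum_(0 <= l < L N) (Sl c N (L N) (Ds N) (Ns N) l w - (mut l.+1 - mut l))).

Let Nr : 0 < N%:R :> R. Proof. by rewrite ltr0n. Qed.

Let n_gt0 l : 0 < (n N l)%:R :> R.
Proof. by rewrite ltr0n nat_ceil_gt0// cN0. Qed.

Let ENl_low l : (l <= L N)%N -> ENl c N (L N) l = (n N l)%:R.
Proof. by rewrite /ENl => ->. Qed.

Let sum_lists (f : idx -> R) : \sum_(i <- s1 ++ s2) f i =
  \sum_(r < N) f (I0 r) + \sum_(0 <= l < L N) \sum_(r < n N l) f (ID l r).
Proof.
have io k : iota 0 k = index_iota 0 k by rewrite /index_iota subn0.
rewrite big_cat/= big_map big_allpairs_dep/= !io big_mkord; congr (_ + _).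
by apply: eq_bigr => l _; rewrite io big_mkord.
Qed.

Let main_partE w : main_part w = \sum_(i <- s1 ++ s2) phi i (X i w).
Proof.
rewrite sum_lists /main_part mulrDr; congr (_ + _).
  rewrite /phi/= -mulr_sumr sumrB sumr_const card_ord /S0 /a0.
  by rewrite -mulr_natl; field; rewrite gt_eqF.
rewrite mulr_sumr; apply: eq_big_nat => l /= lL.
rewrite /phi/= -mulr_sumr sumrB sumr_const card_ord /Sl ENl_low ?(ltnW lL)//.
rewrite (HNdet N0 (ltnW lL)) -/(n N l) /a -mulr_natl.
by field; rewrite gt_eqF.
Qed.

Let s1_D0 i : i \in s1 -> D0_idx N i.
Proof. by move=> /mapP[r]; rewrite mem_iota => /= rN ->. Qed.

Let s2_low i : i \in s2 -> Dlow_idx c N (L N) i.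
Proof.
by move=> /allpairsPdep[l [r [+ + ->]]]; rewrite !mem_iota => /= lL rn; split.
Qed.

Let s2_notD0 i : i \in s2 -> (used_idx c N (L N) `\` D0_idx N) i.
Proof.
move=> is2; split; first by left; left; right; exact: s2_low.
by move=> h; have := s2_low is2; case: i is2 h.
Qed.

Let uniq_s : uniq (s1 ++ s2).
Proof.
rewrite cat_uniq; apply/and3P; split.
- by rewrite map_inj_uniq ?iota_uniq// => x y [].
- apply/hasPn => i /s2_low; case: i => // l r _; apply/negP => /mapP[] //.
- apply: allpairs_uniq_dep; first exact: iota_uniq.
    by move=> l _; exact: iota_uniq.
  by move=> [l r] [l' r'] _ _ /= [-> ->].
Qed.

Let Xj j w := phi (nth (I0 0) (s1 ++ s2) j) (X (nth (I0 0) (s1 ++ s2) j) w).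

(** Past the end of the list, [nth] returns [I0 0], itself a sample index because [N > 0]; the facts
    on summands thus hold for all [j]. *)
Let nth_idx j : let i := nth (I0 0) (s1 ++ s2) j in D0_idx N i \/ Dlow_idx c N (L N) i.
Proof.
move=> /=; have [js|js] := ltnP j (size (s1 ++ s2)); last by left; rewrite nth_default.
have := mem_nth (I0 0) js; rewrite mem_cat => /orP[/s1_D0|/s2_low]; by [left|right].
Qed.

Let vv i := match i with I0 _ => a0 N ^+ 2 * V0 | ID l _ => a N l ^+ 2 * V l | IN _ => 0 end.
Let rr i := match i with
  | I0 _ => \int[P0]_w rho (a0 N * Z0 w)
  | ID l _ => \int[P0]_w rho (a N l * Zl l w) | IN _ => 0 end.

Let low_used i : D0_idx N i \/ Dlow_idx c N (L N) i -> used_idx c N (L N) i.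
Proof. by move=> [h|h]; left; left; [left|right]. Qed.

Let mphi i : measurable_fun setT (phi i).
Proof. by apply: measurable_funM => //; exact: measurable_funB. Qed.

(** Everything about one centred and scaled sample is a statement on its law, hence transferred from
    the reference variable on [T0]. *)
Let facts i : D0_idx N i \/ Dlow_idx c N (L N) i ->
  [/\ measurable_fun setT (fun w => phi i (X i w)),
   (P N).-integrable setT (EFin \o (fun w => phi i (X i w) ^+ 2)),
   \int[P N]_w phi i (X i w) = 0,
   \int[P N]_w phi i (X i w) ^+ 2 = vv i &
   \int[P N]_w rho (phi i (X i w)) = rr i].
Proof.
move=> ii; have mXi := Hmeas N0 (low_used ii).
have key (Y : T0 -> R) (VY : R) : measurable_fun setT Y ->
    P0.-integrable setT (EFin \o (fun w => (Y w - mean i) ^+ 2)) ->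
    \int[P0]_w (Y w - mean i) = 0 ->
    \int[P0]_w (Y w - mean i) ^+ 2 = VY -> same_law (P N) (X i) P0 Y ->
  [/\ measurable_fun setT (fun w => phi i (X i w)),
   (P N).-integrable setT (EFin \o (fun w => phi i (X i w) ^+ 2)),
   \int[P N]_w phi i (X i w) = 0,
   \int[P N]_w phi i (X i w) ^+ 2 = coef i ^+ 2 * VY &
   \int[P N]_w rho (phi i (X i w)) = \int[P0]_w rho (coef i * (Y w - mean i))].
  move=> mY iY EY EY2 law.
  have mYm : measurable_fun setT (fun w => Y w - mean i) by exact: measurable_funB.
  have mphi2 : measurable_fun setT (fun x => phi i x ^+ 2) by exact: measurable_funX.
  have mrphi : measurable_fun setT (fun x => rho (phi i x)).
    exact: (measurableT_comp measurable_rho).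
  have iphi2 : P0.-integrable setT (EFin \o (fun w => phi i (Y w) ^+ 2)).
    rewrite (_ : (fun w => _) = (fun w => coef i ^+ 2 * (Y w - mean i) ^+ 2)).
      exact: (integrableZl measurableT (coef i ^+ 2) iY).
    by apply/funext => w; rewrite /phi exprMn.
  have mphiY : measurable_fun setT (fun w => phi i (Y w)) by exact: (measurableT_comp (mphi i)).
  have i1 := square_integrable_integrable mYm iY.
  have iphi := square_integrable_integrable mphiY iphi2.
  have irho := rho_integrable mphiY iphi2.
  split.
  - exact: (measurableT_comp (mphi i)).
  - exact: (same_law_integrable mXi mY law mphi2).
  - rewrite (same_law_Rintegral mXi mY law (mphi i) iphi) /phi.
    by rewrite RintegralZl// EY mulr0.
  - rewrite (same_law_Rintegral mXi mY law mphi2 iphi2) -EY2 -RintegralZl//.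
    by apply: eq_Rintegral => w _; rewrite /phi exprMn.
  - by rewrite (same_law_Rintegral mXi mY law mrphi irho).
case: ii => [|] ii; case: i ii mXi key => [r|l r|l]//= ii mXi key.
- apply: (key D0 V0 HD0m iZ0 (centred_mean HD0m HD0E HD0V) EZ0).
  exact: HD0law.
- apply: (key (Dl l) (V l) (HDlm l) (iZl l) (centred_mean (HDlm l) (HDlE l) (Dl_lty l)) (EZl l)).
  by apply: HDlaw => //; left.
Qed.

Let mXj j : measurable_fun setT (Xj j).
Proof. by have [] := facts (nth_idx j). Qed.
Let iXj2 j : (P N).-integrable setT (EFin \o (fun w => Xj j w ^+ 2)).
Proof. by have [] := facts (nth_idx j). Qed.
Let EXj j : \int[P N]_w Xj j w = 0.
Proof. by have [] := facts (nth_idx j). Qed.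
Let vj j := vv (nth (I0 0) (s1 ++ s2) j).
Let EXj2 j : \int[P N]_w Xj j w ^+ 2 = vj j.
Proof. by have [] := facts (nth_idx j). Qed.

Let iXj : indep_seq (P N) (size (s1 ++ s2)) Xj.
Proof.
exact: (@indep_seq_of_lists R _ (T N) (P N) idx X _ _ _ _ (I0 0) s1 s2 phi
  (HD0ind N0) (HA4 N0) uniq_s s1_D0 s2_notD0 s2_low mphi).
Qed.

Let main_part_sum w : \sum_(0 <= j < size (s1 ++ s2)) Xj j w = main_part w.
Proof. by rewrite main_partE (big_nth (I0 0)). Qed.

Let sum_vv : \sum_(0 <= j < size (s1 ++ s2)) vv (nth (I0 0) (s1 ++ s2) j) = VN N.
Proof.
rewrite -(big_nth (I0 0) xpredT vv) sum_lists /= sumr_const card_ord -mulr_natl.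
rewrite /VN; congr (_ + _).
by apply: eq_bigr => l _; rewrite sumr_const card_ord mulr_natl.
Qed.

Let sum_rr : \sum_(0 <= j < size (s1 ++ s2))
    (rr (nth (I0 0) (s1 ++ s2) j) +
     \int[gaussian (vv (nth (I0 0) (s1 ++ s2) j))]_z rho z) = EN N.
Proof.
rewrite -(big_nth (I0 0) xpredT (fun i => rr i + \int[gaussian (vv i)]_z rho z)).
rewrite sum_lists /= sumr_const card_ord -mulr_natl.
by congr (_ + _); apply: eq_bigr => l _; rewrite sumr_const card_ord -mulr_natl.
Qed.

Lemma measurable_main_part : measurable_fun setT main_part.
Proof.
have := measurable_partial_sum mXj (size (s1 ++ s2)).
by congr (measurable_fun setT _); apply/funext => w; exact: main_part_sum.
Qed.

Lemma main_part_second_moment :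
  (\int[P N]_w (main_part w ^+ 2)%:E = (VN N)%:E)%E.
Proof.
have := @partial_sum_second_moment _ (T N) R (P N) (size (s1 ++ s2)) Xj
  mXj iXj vj iXj2 EXj EXj2
  (size (s1 ++ s2)) (leqnn _).
rewrite sum_vv => <-; apply: eq_integral => w _; by rewrite main_part_sum.
Qed.

Lemma main_part_lindeberg K f : taylor2 K f ->
  `|\int[P N]_w f (main_part w) - \int[gaussian (VN N)]_z f z| <= K * EN N.
Proof.
move=> fT.
have := @lindeberg_replacement _ (T N) R (P N) (size (s1 ++ s2)) Xj
  mXj iXj vj iXj2 EXj EXj2
  (size (s1 ++ s2)) f K (leqnn _) fT 0.
rewrite sum_vv -sum_rr => H.
have E1 : \int[P N]_w f (0 + \sum_(0 <= i < size (s1 ++ s2)) Xj i w) =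
    \int[P N]_w f (main_part w).
  by apply: eq_Rintegral => w _; rewrite add0r main_part_sum.
have E2 : \int[gaussian (VN N)]_z f (0 + z) = \int[gaussian (VN N)]_z f z.
  by apply: eq_Rintegral => z _; rewrite add0r.
move: H; rewrite [X in X <= _ -> _](congr2 (fun x y : R => `|x - y|) E1 E2).
move=> /le_trans; apply; rewrite ler_wpM2l ?(taylor2_ge0 fT)//.
rewrite le_eqVlt; apply/orP; left; apply/eqP; apply: eq_bigr => j _.
by congr (_ + _); have [] := facts (nth_idx j).
Qed.

Let mD0s r : (r < N)%N -> measurable_fun setT (D0s N r).
Proof. by move=> rN; have := @Hmeas N N0 (I0 r); apply; left; left; left. Qed.

Let mDs_low l r : (l < L N)%N -> (r < n N l)%N -> measurable_fun setT (Ds N l r).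
Proof. by move=> lL rn; have := @Hmeas N N0 (ID l r); apply; left; left; right. Qed.

Let mDs_high l : (L N <= l)%N -> measurable_fun setT (Ds N l 0%N).
Proof. by move=> lL; have := @Hmeas N N0 (ID l 0); apply; left; right. Qed.

Let mNs l : (L N < l)%N -> measurable_fun setT (fun w => (Ns N l w)%:R : R).
Proof. by move=> lL; have := @Hmeas N N0 (IN l); apply; right. Qed.

Let high_norm l : (L N <= l)%N -> (\int[P N]_w `|Ds N l 0%N w|%:E <= (tau l)%:E)%E.
Proof.
move=> lL; have law : same_law (P N) (Ds N l 0%N) P0 (Dl l) by apply: HDlaw => //; right.
apply: le_trans (Dl_norm l); rewrite le_eqVlt; apply/orP; left; apply/eqP.
apply: (same_law_ge0_integral (mDs_high lL) (HDlm l) law (phi := fun x => `|x|%:E)).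
  by apply/measurable_EFinP; exact: normr_measurable.
by move=> x; rewrite lee_fin.
Qed.

Let Ns_indep l l' : (L N < l)%N -> (L N <= l')%N -> forall A B : set R,
  measurable A -> measurable B ->
  P N ((fun w => (Ns N l w)%:R) @^-1` A `&` Ds N l' 0%N @^-1` B) =
  (P N ((fun w => (Ns N l w)%:R) @^-1` A) * P N (Ds N l' 0%N @^-1` B))%E.
Proof.
move=> lL l'L A B mA mB.
have := @indep_and_of_list R _ (T N) (P N) idx X _ _ (I0 0) [:: IN l] [:: ID l' 0]
  (fun i => if i is IN _ then A else B) (HNind N0) isT.
rewrite !big_seq1; apply.
- by move=> x; rewrite inE => /eqP ->.
- move=> x; rewrite inE => /eqP ->; split; last by [].
  by left; right.
- by case.
Qed.

Let Ns_norm l : (L N < l)%N ->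
  (\int[P N]_w `|(Ns N l w)%:R|%:E = (c l * N%:R)%:E :> \bar R)%E.
Proof.
move=> lL; have [Ns1 <-] := HNber N0 lL.
have mE : measurable [set w | Ns N l w = 1%N].
  rewrite (_ : [set w | _] = setT `&` (fun w => (Ns N l w)%:R : R) @^-1` [set 1]).
    exact: mNs.
  rewrite setTI; apply/seteqP; split => w /= => [->//|/eqP].
  by rewrite -[1]/(1%:R) eqr_nat => /eqP.
transitivity (\int[P N]_w (\1_[set w | Ns N l w = 1%N] w)%:E)%E; last first.
  by rewrite integral_indic// setIT.
apply: eq_integral => w _; congr EFin; rewrite indicE normr_nat.
have := Ns1 w; case E : (Ns N l w) => [|[|]]// _.
  by rewrite memNset//= E.
by rewrite mem_set.
Qed.

Let weighted_norm l l' : (L N < l)%N -> (L N <= l')%N ->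
  (\int[P N]_w `|(Ns N l w)%:R * Ds N l' 0%N w|%:E <= (c l * N%:R * tau l')%:E)%E.
Proof.
move=> lL l'L.
have mF : measurable_fun setT (fun z : R * R => (`|z.1| * `|z.2|)%:E).
  apply/measurable_EFinP; apply: measurable_funM;
  by apply: (measurableT_comp (@normr_measurable _ setT)).
have F0 (z : R * R) : (0 <= (`|z.1| * `|z.2|)%:E)%E by rewrite lee_fin mulr_ge0.
under eq_integral do rewrite normrM.
have -> := indep_ge0_integral (mNs lL) (mDs_high l'L) (Ns_indep lL l'L) mF F0.
have mD : measurable_fun setT (fun w => `|Ds N l' 0%N w|%:E).
  by apply/measurable_EFinP; apply: measurableT_comp => //; exact: mDs_high.
have mn : measurable_fun setT (fun w => `|(Ns N l w)%:R : R|%:E).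
  by apply/measurable_EFinP; apply: measurableT_comp => //; exact: mNs.
rewrite (eq_integral (fun w => `|(Ns N l w)%:R|%:E * \int[P N]_w' `|Ds N l' 0%N w'|%:E)%E).
  rewrite ge0_integralZr//; last by apply: integral_ge0 => w _; rewrite lee_fin.
  rewrite Ns_norm// [X in (_ <= X)%E]EFinM.
  by apply: lee_wpmul2l; [rewrite lee_fin ltW// cN0|exact: high_norm].
move=> w _ /=; under eq_integral do rewrite EFinM.
by rewrite ge0_integralZl// => w' _; rewrite lee_fin.
Qed.

Let ENl_high l : (L N < l)%N -> ENl c N (L N) l = c l * N%:R.
Proof. by move=> lL; rewrite /ENl leqNgt lL. Qed.

Let SlN := Sl c N (L N) (Ds N) (Ns N).

Let Sl_high l w : (L N < l)%N ->
  SlN l w = (c l * N%:R)^-1 * ((Ns N l w)%:R * Ds N l 0%N w).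
Proof.
move=> lL; rewrite /SlN /Sl ENl_high//; congr (_ * _).
have [Ns1 _] := HNber N0 lL.
have := Ns1 w; case E : (Ns N l w) => [|[|]]// _.
  by rewrite big_ord0 mul0r.
by rewrite big_ord1 mul1r.
Qed.

(** Since [c (L N) * N] is positive and at most 1, its ceiling is 1: the level consists of one
    sample with weight 1. *)
Let Sl_L w : SlN (L N) w = Ds N (L N) 0%N w.
Proof.
rewrite /SlN /Sl ENl_low// (HNdet N0 (leqnn _)) /n.
by rewrite nat_ceil_le1 ?cN0 ?cN_le1// big_ord1 invr1 mul1r.
Qed.

Let mSl l : measurable_fun setT (SlN l).
Proof.
have [lL|Ll|->] := ltngtP l (L N).
- rewrite (_ : SlN l = fun w => (ENl c N (L N) l)^-1 *
      \sum_(r < n N l) Ds N l r w); last first.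
    by apply/funext => w; rewrite /SlN /Sl (HNdet N0 (ltnW lL)).
  apply: measurable_funM => //.
  rewrite (_ : (fun w => _) = \sum_(r < n N l) Ds N l r); last first.
    by apply/funext => w; rewrite fct_sumE.
  elim/big_ind : _ => //; first exact: measurable_cst.
    by move=> f g mf mg; exact: measurable_funD.
  by move=> r _; exact: mDs_low.
- rewrite (_ : SlN l = fun w => (c l * N%:R)^-1 * ((Ns N l w)%:R * Ds N l 0%N w)).
    apply: measurable_funM => //; apply: measurable_funM; first exact: mNs.
    by apply: mDs_high; exact: ltnW.
  by apply/funext => w; exact: Sl_high.
- rewrite (_ : SlN (L N) = Ds N (L N) 0%N); first exact: mDs_high.
  by apply/funext => w; exact: Sl_L.
Qed.

Let mS0 : measurable_fun setT (S0 N (D0s N)).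
Proof.
apply: measurable_funM => //.
rewrite (_ : (fun w => _) = \sum_(r < N) D0s N r); last first.
  by apply/funext => w; rewrite fct_sumE.
elim/big_ind : _ => //; first exact: measurable_cst.
  by move=> f g mf mg; exact: measurable_funD.
by move=> r _; exact: mD0s.
Qed.

Let mSumSl k : measurable_fun setT (fun w => \sum_(0 <= l < k) SlN l w).
Proof.
elim: k => [|k IH].
  by rewrite (_ : (fun w => _) = cst 0)//; apply/funext => w; rewrite big_geq.
rewrite (_ : (fun w => _) = (fun w => \sum_(0 <= l < k) SlN l w + SlN k w)).
  exact: measurable_funD.
by apply/funext => w; rewrite big_nat_recr.
Qed.

(** Independence gives the Bernoulli variable mean [c l * N], which the normalisation cancels. The
    two levels are separate because the coupled estimator weights the sample of level [L N] by the
    variables of higher levels. *)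
Let scaled_norm l l' : (L N < l)%N -> (L N <= l')%N ->
  (\int[P N]_w `|(c l * N%:R)^-1 * ((Ns N l w)%:R * Ds N l' 0%N w)|%:E <=
   (tau l')%:E)%E.
Proof.
move=> lL l'L; have cn0 := cN0 l N0.
have i0 : 0 <= (c l * N%:R)^-1 by rewrite invr_ge0 ltW.
under eq_integral do rewrite normrM EFinM (ger0_norm i0).
rewrite ge0_integralZl_EFin//; last first.
  apply/measurable_EFinP; apply: measurableT_comp => //.
  by apply: measurable_funM; [exact: mNs|exact: mDs_high].
apply: (@le_trans _ _ (((c l * N%:R)^-1)%:E * (c l * N%:R * tau l')%:E)%E).
  by rewrite lee_wpmul2l// weighted_norm.
by rewrite -EFinM lee_fin mulKf// gt_eqF.
Qed.

Let Sl_norm k : (\int[P N]_w `|SlN (L N + k)%N w|%:E <= (tau (L N) * p ^+ k)%:E)%E.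
Proof.
rewrite -[tau (L N) * _](_ : tau (L N + k)%N = _); last by rewrite /tau exprD mulrA.
case: k => [|k].
  rewrite addn0; under eq_integral do rewrite Sl_L; exact: high_norm.
have Lk : (L N < L N + k.+1)%N by rewrite addnS ltnS leq_addr.
under eq_integral do rewrite Sl_high//.
by apply: scaled_norm => //; exact: ltnW.
Qed.

Let geom_bound (x : R) m : 0 <= x -> x < 1 ->
  \sum_(0 <= k < m) tau (L N) * x ^+ k <= tau (L N) / (1 - x).
Proof.
move=> x0 x1; rewrite -mulr_sumr ler_wpM2l ?(ltW (tau_gt0 _))//.
by have := geometric_sum_le 0 m x0 x1; rewrite expr0 mul1r.
Qed.

Let telescope_means : \sum_(0 <= l < L N) (mut l.+1 - mut l) = mut (L N) - mut 0%N.
Proof. by rewrite telescope_sumr. Qed.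

Let mu_bound : `|mut (L N) - mu| <= tau (L N) / (1 - p).
Proof. by have := tail_mut (L N); rewrite mulrA. Qed.

(** For either estimator, the scaled error minus the main part has this shape: [G] collects the
    terms from level [L N] on, and [mut (L N) - mu] is the bias. *)
Let perturbation_norm (G : T N -> R) (B : R) : measurable_fun setT G ->
  (\int[P N]_w `|G w|%:E <= B%:E)%E ->
  (\int[P N]_w `|Num.sqrt N%:R * (G w + (mut (L N) - mu))|%:E <=
   (Num.sqrt N%:R * (B + tau (L N) / (1 - p)))%:E)%E.
Proof.
move=> mG GB.
have mG' : measurable_fun setT (fun w => `|G w|%:E).
  by apply/measurable_EFinP; exact: measurableT_comp.
under eq_integral do rewrite normrM EFinM (ger0_norm (sqrtr_ge0 _)).
rewrite ge0_integralZl_EFin//; last first.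
  by apply/measurable_EFinP; apply: measurableT_comp => //; exact: measurable_funD.
rewrite EFinM lee_wpmul2l//.
apply: (@le_trans _ _ (\int[P N]_w (`|G w|%:E + `|mut (L N) - mu|%:E)))%E.
  apply: ge0_le_integral => //.
  - by apply/measurable_EFinP; apply: measurableT_comp => //; exact: measurable_funD.
  - exact: emeasurable_funD.
  - by move=> w _; rewrite -EFinD lee_fin ler_normD.
rewrite ge0_integralD// integral_cst//.
rewrite [X in (_ + _ * X)%E](_ : _ = 1%E) ?mule1; last exact: probability_setT.
by rewrite EFinD leeD// lee_fin.
Qed.

Lemma measurable_Sest : measurable_fun setT
  (fun w => Num.sqrt N%:R * (Sest c N (L N) (D0s N) (Ds N) (Ns N) w - mu)).
Proof.
apply: measurable_funM => //; apply: measurable_funB => //.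
apply: measurable_funD; first exact: mS0.
exact: (measurable_limn mSumSl).
Qed.

(** Of the two terms [1 / (1 - p)], one sums the levels from [L N] on and the other bounds the
    bias. *)
Lemma Sest_remainder :
  (\int[P N]_w `|Num.sqrt N%:R * (Sest c N (L N) (D0s N) (Ds N) (Ns N) w - mu) -
     main_part w|%:E <=
   (Num.sqrt VD * (2 / (1 - p)) * (Num.sqrt N%:R * p ^+ L N))%:E)%E.
Proof.
pose G w := limn (fun k => \sum_(0 <= l < k) SlN l w) - \sum_(0 <= l < L N) SlN l w.
have mG : measurable_fun setT G.
  by apply: measurable_funB; [exact: (measurable_limn mSumSl)|exact: mSumSl].
have GB : (\int[P N]_w `|G w|%:E <= (tau (L N) / (1 - p))%:E)%E.
  apply: (integral_limn_series_bound (e := fun k => tau (L N) * p ^+ k)) => //.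
  - by move=> m; apply: geom_bound => //; exact: ltW.
have := perturbation_norm mG GB.
rewrite [X in (_ <= X%:E)%E -> _](_ : _ =
  Num.sqrt VD * (2 / (1 - p)) * (Num.sqrt N%:R * p ^+ L N)); last first.
  by rewrite /tau; field; rewrite subr_eq0 gt_eqF.
apply: le_trans; rewrite le_eqVlt; apply/orP; left; apply/eqP.
apply: eq_integral => w _; congr (`| _ |%:E).
rewrite /main_part /Sest sumrB telescope_means -/SlN /G; ring.
Qed.

Variable cR : R.
Hypotheses (cR0 : 0 <= cR) (cR1 : cR < 1).

Let uR k w := ((Ns N (L N + k.+1)%N w == 1%N)%:R / ENl c N (L N) (L N + k.+1)%N)
      * (Ds N (L N + k.+1)%N 0%N w - Ds N (L N) 0%N w * cR ^+ k.+1).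

Let Lk k : (L N < L N + k.+1)%N. Proof. by rewrite addnS ltnS leq_addr. Qed.

Let uRE k w : uR k w =
  (c (L N + k.+1)%N * N%:R)^-1 * ((Ns N (L N + k.+1)%N w)%:R * Ds N (L N + k.+1)%N 0%N w)
  - cR ^+ k.+1 * ((c (L N + k.+1)%N * N%:R)^-1 *
     ((Ns N (L N + k.+1)%N w)%:R * Ds N (L N) 0%N w)).
Proof.
rewrite /uR ENl_high//; have [Ns1 _] := HNber N0 (Lk k).
have -> : (Ns N (L N + k.+1)%N w == 1%N)%:R = (Ns N (L N + k.+1)%N w)%:R :> R.
  by have := Ns1 w; case: (Ns N (L N + k.+1)%N w) => [|[|]].
by ring.
Qed.

Let mWD k l : (L N <= l)%N -> measurable_fun setT (fun w =>
  (c (L N + k.+1)%N * N%:R)^-1 * ((Ns N (L N + k.+1)%N w)%:R * Ds N l 0%N w)).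
Proof.
move=> Ll; apply: measurable_funM => //.
by apply: measurable_funM; [exact: mNs|exact: mDs_high].
Qed.

Let muR k : measurable_fun setT (uR k).
Proof.
rewrite (_ : uR k = fun w =>
  (c (L N + k.+1)%N * N%:R)^-1 * ((Ns N (L N + k.+1)%N w)%:R * Ds N (L N + k.+1)%N 0%N w)
  - cR ^+ k.+1 * ((c (L N + k.+1)%N * N%:R)^-1 *
     ((Ns N (L N + k.+1)%N w)%:R * Ds N (L N) 0%N w))); last by apply/funext => w; exact: uRE.
apply: measurable_funB; first by apply: mWD; exact: ltnW.
by apply: measurable_funM => //; exact: mWD.
Qed.

Let mSumuR k : measurable_fun setT (fun w => \sum_(0 <= j < k) uR j w).
Proof.
elim: k => [|k IH].
  by rewrite (_ : (fun w => _) = cst 0)//; apply/funext => w; rewrite big_geq.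
rewrite (_ : (fun w => _) = (fun w => \sum_(0 <= j < k) uR j w + uR k w)).
  exact: measurable_funD.
by apply/funext => w; rewrite big_nat_recr.
Qed.

Let norm_add_bound (f g : T N -> R) (bf bg : R) : measurable_fun setT f ->
  measurable_fun setT g -> (\int[P N]_w `|f w|%:E <= bf%:E)%E ->
  (\int[P N]_w `|g w|%:E <= bg%:E)%E ->
  (\int[P N]_w `|f w + g w|%:E <= (bf + bg)%:E)%E.
Proof.
move=> mf mg fb gb.
have mnf : measurable_fun setT (fun w => `|f w|%:E).
  by apply/measurable_EFinP; exact: measurableT_comp.
have mng : measurable_fun setT (fun w => `|g w|%:E).
  by apply/measurable_EFinP; exact: measurableT_comp.
apply: (@le_trans _ _ (\int[P N]_w (`|f w|%:E + `|g w|%:E)))%E.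
  apply: ge0_le_integral => //.
  - by apply/measurable_EFinP; apply: measurableT_comp => //; exact: measurable_funD.
  - exact: emeasurable_funD.
  - by move=> w _; rewrite -EFinD lee_fin ler_normD.
by rewrite ge0_integralD// EFinD leeD.
Qed.

Let norm_scale_bound (k b : R) (f : T N -> R) : measurable_fun setT f ->
  (\int[P N]_w `|f w|%:E <= b%:E)%E ->
  (\int[P N]_w `|k * f w|%:E <= (`|k| * b)%:E)%E.
Proof.
move=> mf fb; under eq_integral do rewrite normrM EFinM.
rewrite ge0_integralZl_EFin//; last by apply/measurable_EFinP; exact: measurableT_comp.
by rewrite EFinM lee_wpmul2l.
Qed.

Let uR_norm k : (\int[P N]_w `|uR k w|%:E <=
  (tau (L N) * p ^+ k + tau (L N) * cR ^+ k)%:E)%E.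
Proof.
under eq_integral do rewrite uRE -mulNr.
(* The sample of level [L N + k.+1] and the coupled one of level [L N] are bounded separately. One
   factor [p] and one factor [cR] are then dropped, so that both geometric sums start at exponent
   0. *)
apply: (@le_trans _ _ (tau (L N + k.+1)%N + `|- cR ^+ k.+1| * tau (L N))%:E).
  apply: norm_add_bound.
  - by apply: mWD; exact: ltnW.
  - by apply: measurable_funM => //; exact: mWD.
  - by apply: scaled_norm => //; exact: ltnW.
  - by apply: norm_scale_bound; [exact: mWD|exact: scaled_norm].
rewrite lee_fin; have t0 := ltW (tau_gt0 (L N)); apply: lerD.
  rewrite /tau exprD mulrA ler_wpM2l// exprS ger_pMl ?exprn_gt0//.
  exact: ltW.
rewrite normrN ger0_norm ?exprn_ge0// mulrC ler_wpM2l// exprS.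
by rewrite ler_piMl ?exprn_ge0// ltW.
Qed.

Lemma measurable_ScR : measurable_fun setT
  (fun w => Num.sqrt N%:R * (ScR c N (L N) (D0s N) (Ds N) (Ns N) cR w - mu)).
Proof.
apply: measurable_funM => //; apply: measurable_funB => //.
apply: measurable_funD; last exact: (measurable_limn mSumuR).
apply: measurable_funD; last by apply: measurable_funM => //; exact: mDs_high.
by apply: measurable_funD; [exact: mS0|exact: mSumSl].
Qed.

(** Of the terms [1 / (1 - cR)], one comes from the weighted sample at level [L N] and one from its
    coupled copies above; of the terms [1 / (1 - p)], one from the higher levels and one from the
    bias. *)
Lemma ScR_remainder :
  (\int[P N]_w `|Num.sqrt N%:R * (ScR c N (L N) (D0s N) (Ds N) (Ns N) cR w - mu) -
     main_part w|%:E <=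
   (Num.sqrt VD * (2 / (1 - cR) + 2 / (1 - p)) * (Num.sqrt N%:R * p ^+ L N))%:E)%E.
Proof.
have cR1' : 0 < 1 - cR by rewrite subr_gt0.
pose H w := limn (fun k => \sum_(0 <= j < k) uR j w).
have mH : measurable_fun setT H by exact: (measurable_limn mSumuR).
have HB : (\int[P N]_w `|H w|%:E <= (tau (L N) / (1 - p) + tau (L N) / (1 - cR))%:E)%E.
  have := @integral_limn_series_bound _ _ (T N) (P N) uR 0
    (fun k => tau (L N) * p ^+ k + tau (L N) * cR ^+ k)
    (tau (L N) / (1 - p) + tau (L N) / (1 - cR)) muR uR_norm.
  under eq_integral do rewrite big_geq// subr0.
  apply => //; move=> m; rewrite big_split/=; apply: lerD; apply: geom_bound => //.
  exact: ltW.
pose G w := (1 - cR)^-1 * Ds N (L N) 0%N w + H w.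
have mDL := mDs_high (leqnn (L N)).
have mG : measurable_fun setT G.
  by apply: measurable_funD => //; apply: measurable_funM.
have GB : (\int[P N]_w `|G w|%:E <= (tau (L N) / (1 - cR) +
    (tau (L N) / (1 - p) + tau (L N) / (1 - cR)))%:E)%E.
  apply: norm_add_bound => //; first exact: measurable_funM.
  have := norm_scale_bound (1 - cR)^-1 mDL (high_norm (leqnn _)).
  by rewrite ger0_norm ?invr_ge0 ?(ltW cR1')// mulrC.
have := perturbation_norm mG GB.
rewrite [X in (_ <= X%:E)%E -> _](_ : _ =
  Num.sqrt VD * (2 / (1 - cR) + 2 / (1 - p)) * (Num.sqrt N%:R * p ^+ L N)); last first.
  by rewrite /tau; field; rewrite !subr_eq0 !gt_eqF.
apply: le_trans; rewrite le_eqVlt; apply/orP; left; apply/eqP.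
apply: eq_integral => w _; congr (`| _ |%:E).
rewrite /main_part /ScR sumrB telescope_means -/SlN /G /H /uR; ring.
Qed.

End fixed_N.

(** * Passage to the limit in [N] *)

Let VN_ge0 N : (0 < N)%N -> 0 <= VN N.
Proof.
move=> N0; have := main_part_second_moment N0 => h.
by rewrite -lee_fin -h; apply: integral_ge0 => w _; rewrite lee_fin sqr_ge0.
Qed.

Let near_pos : \forall N \near \oo, (0 < N)%N. Proof. by exists 1%N. Qed.

Let cvg_rem (k : R) : (fun N => k * (Num.sqrt N%:R * p ^+ L N)) @ \oo --> 0.
Proof. by rewrite -(mulr0 k); apply: cvgM; [exact: cvg_cst|exact: cvg_sqrtN_p]. Qed.

Lemma Sest_cvg_in_distr : cvg_in_distr_normal P
  (fun N w => Num.sqrt N%:R * (Sest c N (L N) (D0s N) (Ds N) (Ns N) w - mu))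
  (sigmaS2 P0 D0 Dl c).
Proof.
apply: (@cvg_in_distr_of_approx R d T P _ main_part _ VN EN
  (fun N => Num.sqrt VD * (2 / (1 - p)) * (Num.sqrt N%:R * p ^+ L N))).
- by apply: filterS near_pos => N N0; exact: measurable_Sest.
- by apply: filterS near_pos => N N0; exact: measurable_main_part.
- by apply: filterS near_pos => N N0; exact: Sest_remainder.
- by apply: filterS near_pos => N N0; exact: main_part_second_moment.
- by apply: filterS near_pos => N N0; exact: VN_ge0.
- by move=> K f fT; apply: filterS near_pos => N N0; exact: main_part_lindeberg.
- exact: cvg_rem.
- exact: cvg_VN.
- exact: cvg_EN.
Qed.

Lemma ScR_cvg_in_distr (cR : R) : 0 <= cR -> cR < (Num.sqrt phiN)^-1 ->
  cvg_in_distr_normal P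
  (fun N w => Num.sqrt N%:R * (ScR c N (L N) (D0s N) (Ds N) (Ns N) cR w - mu))
  (sigmaS2 P0 D0 Dl c).
Proof.
(* Since [phiN > 1], the bound on [cR] puts it below 1, and the geometric sums in the remainder are
   finite. *)
move=> cR0 cRphi; have cR1 : cR < 1.
  apply: (lt_trans cRphi); rewrite invf_lt1 ?sqrtr_gt0// -[ltLHS]sqrtr1 ltr_sqrt//.
  by rewrite (lt_trans _ HphiN)// ltr1n.
apply: (@cvg_in_distr_of_approx R d T P _ main_part _ VN EN
  (fun N => Num.sqrt VD * (2 / (1 - cR) + 2 / (1 - p)) * (Num.sqrt N%:R * p ^+ L N))).
- by apply: filterS near_pos => N N0; exact: measurable_ScR.
- by apply: filterS near_pos => N N0; exact: measurable_main_part.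
- by apply: filterS near_pos => N N0; exact: ScR_remainder.
- by apply: filterS near_pos => N N0; exact: main_part_second_moment.
- by apply: filterS near_pos => N N0; exact: VN_ge0.
- by move=> K f fT; apply: filterS near_pos => N N0; exact: main_part_lindeberg.
- exact: cvg_rem.
- exact: cvg_VN.
- exact: cvg_EN.
Qed.

End multilevel.

Theorem theorem1 (R : realType)
  (* mu(f) and the approximations mu~_{h_l}(f) -> mu(f) *)
  (mu : R) (mut : nat -> R) (Hmut : mut @ \oo --> mu)
  (* reference random variables D_0, D_{l,l+1} (their laws) *)
  (d0 : measure_display) (T0 : measurableType d0) (P0 : probability T0 R)
  (D0 : T0 -> R) (Dl : nat -> T0 -> R)
  (* constants *)
  (VD phiD phiN cl cu : R) (c : nat -> R)
  (* (A1) *)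
  (HD0m : measurable_fun setT D0)
  (HD0E : ('E_P0[D0] = (mut 0%N)%:E)%E)
  (HD0V : (\int[P0]_w ((D0 w) ^+ 2)%:E < +oo)%E)
  (HDlm : forall l, measurable_fun setT (Dl l))
  (HDlE : forall l, ('E_P0[Dl l] = (mut l.+1 - mut l)%:E)%E)
  (HDl2 : forall l, (\int[P0]_w ((Dl l w) ^+ 2)%:E <= (VD * phiD ^- l)%:E)%E)
  (HVD : 0 < VD) (HphiD : 2 < phiD)
  (* the constants c_{l,l+1} and (A2) *)
  (Hcpos : forall l, 0 < c l) (Hcdec : forall l, c l.+1 <= c l)
  (Hc0 : c @ \oo --> 0)
  (Hclu : 0 < cl /\ cl <= cu)
  (HA2 : forall l, cl * phiN ^- l <= c l /\ c l <= cu * phiN ^- l)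
  (HphiN : 2 < phiN) (HphiND : phiN < phiD)
  (* L(N) *)
  (L : nat -> nat) (HL : forall N, is_LN c N (L N))
  (* for every N, a probability space carrying the samples:
     D0s N r = D_0^{(r+1)}, Ds N l r = D_{l,l+1}^{(r+1)}, Ns N l = N_{l,l+1} *)
  (d : nat -> measure_display) (T : forall N, measurableType (d N))
  (P : forall N, probability (T N) R)
  (D0s : forall N, nat -> T N -> R) (Ds : forall N, nat -> nat -> T N -> R)
  (Ns : forall N, nat -> T N -> nat)
  (Hmeas : forall N, (0 < N)%N -> forall i, used_idx c N (L N) i ->
     measurable_fun setT (allvars (D0s N) (Ds N) (Ns N) i))
  (* N_{l,l+1} = ceil(c_{l,l+1} N) for l <= L(N) *)
  (HNdet : forall N, (0 < N)%N -> forall l, (l <= L N)%N ->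
     forall w, Ns N l w = nat_ceil (c l * N%:R))
  (* N_{l,l+1} ~ Bernoulli(c_{l,l+1} N) for l > L(N) *)
  (HNber : forall N, (0 < N)%N -> forall l, (L N < l)%N ->
     (forall w, (Ns N l w <= 1)%N) /\
     P N [set w | Ns N l w = 1%N] = (c l * N%:R)%:E)
  (* ... independent of everything else *)
  (HNind : forall N, (0 < N)%N ->
     indep_and_of (P N) (allvars (D0s N) (Ds N) (Ns N)) (Nrand_idx (L N))
       (used_idx c N (L N) `\` Nrand_idx (L N)))
  (* D_0^{(r)} i.i.d. copies of D_0, independent of everything else *)
  (HD0law : forall N, (0 < N)%N -> forall r, (r < N)%N ->
     same_law (P N) (D0s N r) P0 D0)
  (HD0ind : forall N, (0 < N)%N ->
     indep_and_of (P N) (allvars (D0s N) (Ds N) (Ns N)) (D0_idx N)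
       (used_idx c N (L N) `\` D0_idx N))
  (* D_{l,l+1}^{(r)} have the law of D_{l,l+1} *)
  (HDlaw : forall N, (0 < N)%N -> forall l r,
     (Dlow_idx c N (L N) `|` Dhigh_idx (L N)) (ID l r) ->
     same_law (P N) (Ds N l r) P0 (Dl l))
  (* (A4) *)
  (HA4 : forall N, (0 < N)%N ->
     indep_and_of (P N) (allvars (D0s N) (Ds N) (Ns N))
       (Dlow_idx c N (L N)) (Dhigh_idx (L N))) :
  let s2 := sigmaS2 P0 D0 Dl c in
  ((* if S_0, S_{0,1}, S_{1,2}, ... are independent, then S is asymptotically normal *)
   (forall N, (0 < N)%N ->
      mutually_indep (P N) (fun k : option nat => match k with
        | None => S0 N (D0s N)
        | Some l => Sl c N (L N) (Ds N) (Ns N) l end)) ->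
   cvg_in_distr_normal P
     (fun N w => Num.sqrt N%:R * (Sest c N (L N) (D0s N) (Ds N) (Ns N) w - mu)) s2)
  /\
  (forall cR : R, 0 <= cR -> cR < (Num.sqrt phiN)^-1 ->
   cvg_in_distr_normal P
     (fun N w => Num.sqrt N%:R * (ScR c N (L N) (D0s N) (Ds N) (Ns N) cR w - mu)) s2).
Proof.
move=> s2; split=> [_|cR cR0 cRphi].
  by eapply Sest_cvg_in_distr; eassumption.
by eapply ScR_cvg_in_distr; eassumption.
Qed.
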